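(* Let $m\ge1$ and $\kappa_m=\sqrt{\ln(4m)/\pi}$. The series $\mathbf N^{\mathcal B}_m(z)$ is analytic in the domain $D=\{z\in\mathbb C: |z|<\frac1{2m},\ z\notin[\frac1{4m},\frac1{2m}]\}$, and as $z\to\frac1{4m}$ in $D$, $$\mathbf N^{\mathcal B}_m(z)=\frac{8m\kappa_m}{\sqrt{(1-4mz)\ln((1-4mz)^{-1})}}+O\!\left(\frac{1}{\sqrt{(1-4mz)\ln^3((1-4mz)^{-1})}}\right).$$
   Context: An $m$-labeled binary tree is a non-empty finite rooted tree with node labels in $\{1,\dots,m\}$ in which every node has an optional left and an optional right child (distinguished); its size is its number of edges; $\mathcal B_{m,n}$ is the set of such trees of size $n$. For such a tree $t$, $\|\mathrm{dag}(t)\|$ denotes the number of distinct subtrees of $t$ (subtree = a node with all its descendants), i.e. the number of nodes of its minimal dag. $\mathbf N^{\mathcal B}_m(z)=\sum_{n\ge0}\big(\sum_{t\in\mathcal B_{m,n}}\|\mathrm{dag}(t)\|\big)z^n$. Logarithms and square roots are principal branches. *)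

(* Defs.v *)
From Stdlib Require Import Reals List Arith.
From Coquelicot Require Import Coquelicot.
Import ListNotations.
Open Scope R_scope.

(** * m-labeled binary trees
    A node carries a label (intended in {1..m}) and an optional left and an
    optional right child. *)
Inductive tree : Type := Node : nat -> option tree -> option tree -> tree.

(** size = number of edges *)
Fixpoint tsize (t : tree) : nat :=
  match t with
  | Node _ l r =>
      (match l with None => 0 | Some u => S (tsize u) end +
       match r with None => 0 | Some u => S (tsize u) end)%nat
  end.

Definition tree_eq_dec : forall x y : tree, {x = y} + {x <> y}.
Proof.
  fix IH 1. intros [a l r] [b l' r'].
  destruct (Nat.eq_dec a b) as [->|Hab]; [|right; congruence].
  assert (Ho : forall o o' : option tree, {o = o'} + {o <> o'}).
  { intros [u|] [v|]; try (right; congruence); try (left; reflexivity).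
    destruct (IH u v) as [->|H]; [left; reflexivity|right; congruence]. }
  destruct (Ho l l') as [->|H]; [|right; congruence].
  destruct (Ho r r') as [->|H]; [left; reflexivity|right; congruence].
Defined.

Fixpoint subtrees (t : tree) : list tree :=
  match t with
  | Node _ l r =>
      t :: (match l with None => [] | Some u => subtrees u end ++
            match r with None => [] | Some u => subtrees u end)
  end.

Definition dag_size (t : tree) : nat := length (nodup tree_eq_dec (subtrees t)).

(** Enumeration of B_{m,n}: all trees of size n with labels in {1,...,m}
    (each tree exactly once).  [fuel] bounds the recursion depth. *)
Fixpoint trees_upto (fuel m n : nat) : list tree :=
  match fuel with
  | O => []
  | S f =>
      let ot (k : nat) : list (option tree) :=
        match k with O => [None] | S k' => map Some (trees_upto f m k') end in
      flat_map (fun a =>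
        flat_map (fun i =>
          flat_map (fun l => map (fun r => Node a l r) (ot (n - i)%nat)) (ot i))
          (seq 0 (S n)))
        (seq 1 m)
  end.

Definition B (m n : nat) : list tree := trees_upto (S n) m n.

Definition NB_coeff (m n : nat) : nat :=
  fold_right (fun t acc => (dag_size t + acc)%nat) 0%nat (B m n).

(** principal argument, in (-PI, PI] *)
Definition Carg (z : C) : R :=
  let x := fst z in let y := snd z in
  if Rlt_dec 0 x then atan (y / x)
  else if Rlt_dec x 0 then
    (if Rle_dec 0 y then atan (y / x) + PI else atan (y / x) - PI)
  else if Rlt_dec 0 y then PI / 2
  else if Rlt_dec y 0 then - (PI / 2)
  else 0.

(** principal logarithm (for z <> 0) *)
Definition Clog (z : C) : C := (ln (Cmod z), Carg z).

Definition Csqrt (z : C) : C :=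
  (sqrt (Cmod z) * cos (Carg z / 2), sqrt (Cmod z) * sin (Carg z / 2)).

(* Main.v *)
(** For a tree [u] with [k] edges, the trees avoiding [u] as a subtree satisfy
    [A = m (1 + z A)^2 - z^k], so with [s = sqrt (1 - 4mz)] and
    [s_k = sqrt (1 - 4mz + 4m z^(k+2))] the trees containing [u] have generating
    function [2 z^k / (s + s_k)]. Summing over the [b_k] trees of each size [k], and
    using [2 / (s + s_k) = 1/s - eps_k / (s (s + s_k)^2)] with
    [eps_k = 4m z^(k+2) = s_k^2 - s^2], gives
    [s N = 4m / (1 + s)^2 - sum_k b_k z^k eps_k / (s + s_k)^2],
    whose right-hand side converges on the whole slit disc.  There
    [|Im z^(k+2)| < |Im z|], so [s] and [s_k] are holomorphic and lie in the same
    quadrant, whence [|s + s_k|^2 >= max (|s|^2) (|eps_k|)].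

    Near [z = 1/(4m)] the factor [eps_k / (s + s_k)^2 = (s_k - s) / (s_k + s)] is close
    to 1 for [k <= n] and to 0 for [k > n], geometrically fast on both sides of
    [n = ln (1/|1 - 4mz|) / ln (4m)].  Hence [s N] is, up to [O(n^(-3/2))], the tail
    [sum_(k > n) b_k (4m)^(-k)], which telescopes to [8m] times a normalised central
    binomial coefficient, and Wallis' inequalities give its size. *)
Require Import Defs.
From Stdlib Require Import Reals List Arith Lia Lra Permutation ClassicalEpsilon.
From Coquelicot Require Import Coquelicot.
Import ListNotations.
Open Scope R_scope.

(** * Counting subtrees *)

Section Counting.
Local Open Scope nat_scope.

(** The sum over [k] of [b_k z^k * 2 / (s + s_k)] diverges beyond [|z| = 1/(4m)], because [b_k]
    grows like [(4m)^k] up to a power of [k]. Splitting off [1/s] isolates the sum of the [b_k z^k],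
    which survives there in its closed form [4m / (1 + s)^2]; what remains carries the extra factor
    [z^(k+2)], so its ratio is [4m |z|^2], and this is below 1 in the whole disc. A single [s_k]
    serves all trees [u] of size [k], since the coefficients of [A] are determined by its quadratic
    equation, in which only the size of [u] appears. Branches are settled by algebra: every square
    root is recognised as the one with positive real part, and differences of roots are
    rationalised, so no continuity of the argument is ever proved. Inside [|z| < 1/(4m)] the
    positivity comes from the bound 2, the value of the Catalan generating function at its
    singularity. The identities for [A] and [B] are kept free of divisions by [z], so that [z = 0]
    is not a special case. *)

Definition lsum {A : Type} (f : A -> nat) (l : list A) : nat :=
  fold_right (fun x acc => f x + acc) 0 l.

Lemma lsum_app {A} (f : A -> nat) l1 l2 :
  lsum f (l1 ++ l2) = lsum f l1 + lsum f l2.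
Proof. induction l1 as [|x l IH]; simpl; lia. Qed.

Lemma lsum_flat_map {A B} (f : B -> nat) (g : A -> list B) l :
  lsum f (flat_map g l) = lsum (fun x => lsum f (g x)) l.
Proof. induction l as [|x l IH]; simpl; rewrite ?lsum_app; lia. Qed.

Lemma lsum_map {A B} (f : B -> nat) (g : A -> B) l :
  lsum f (map g l) = lsum (fun x => f (g x)) l.
Proof. induction l as [|x l IH]; simpl; lia. Qed.

Lemma lsum_ext_in {A} (f g : A -> nat) l :
  (forall x, In x l -> f x = g x) -> lsum f l = lsum g l.
Proof.
  induction l as [|x l IH]; simpl; intros H; [easy|].
  rewrite (H x (or_introl eq_refl)), IH; [easy|]. intros y Hy. apply H. now right.
Qed.

Lemma lsum_plus {A} (f g : A -> nat) l :
  lsum (fun x => f x + g x) l = lsum f l + lsum g l.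
Proof. induction l as [|x l IH]; simpl; lia. Qed.

Lemma lsum_mult_l {A} (c : nat) (f : A -> nat) l :
  lsum (fun x => c * f x) l = c * lsum f l.
Proof. induction l as [|x l IH]; simpl; lia. Qed.

Lemma lsum_mult_r {A} (c : nat) (f : A -> nat) l :
  lsum (fun x => f x * c) l = lsum f l * c.
Proof. induction l as [|x l IH]; simpl; lia. Qed.

Lemma lsum_const {A} (c : nat) (l : list A) : lsum (fun _ => c) l = length l * c.
Proof. induction l as [|x l IH]; simpl; lia. Qed.

Lemma lsum_swap {A B} (f : A -> B -> nat) l l' :
  lsum (fun x => lsum (f x) l') l = lsum (fun y => lsum (fun x => f x y) l) l'.
Proof.
  induction l as [|x l IH]; simpl.
  - now rewrite lsum_const, Nat.mul_0_r.
  - now rewrite lsum_plus, IH.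
Qed.

Lemma length_filter_lsum {A} (p : A -> bool) l :
  length (filter p l) = lsum (fun x => if p x then 1 else 0) l.
Proof. induction l as [|x l IH]; simpl; [easy|]. destruct (p x); simpl; lia. Qed.

Lemma lsum_seq_delta (f : nat -> nat) (k a n : nat) :
  lsum (fun i => (if Nat.eq_dec k i then 1 else 0) * f i) (seq a n)
  = if le_dec a k then if lt_dec k (a + n) then f k else 0 else 0.
Proof.
  revert a; induction n as [|n IH]; intros a; simpl.
  - destruct (le_dec a k), (lt_dec k (a + 0)); lia.
  - rewrite IH. destruct (Nat.eq_dec k a), (le_dec (S a) k), (le_dec a k),
      (lt_dec k (S a + n)), (lt_dec k (a + S n)); subst; lia.
Qed.

(** An absent child has weight 0 and a child of size [j] has weight [j + 1], its upper edge
    included; the weights of the two children then add up to the size of the node. *)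
Definition otrees (m k : nat) : list (option tree) :=
  match k with 0 => [None] | S k' => map Some (B m k') end.

Lemma flat_map_ext_in {A B} (f g : A -> list B) l :
  (forall x, In x l -> f x = g x) -> flat_map f l = flat_map g l.
Proof.
  induction l as [|x l IH]; simpl; intros H; [easy|].
  rewrite (H x (or_introl eq_refl)), IH; [easy|]. intros y Hy. apply H. now right.
Qed.

(** Recursive calls are made at sizes below [n], so any fuel above the size gives the full
    enumeration. *)
Lemma trees_upto_fuel (m f f' n : nat) :
  n < f -> n < f' -> trees_upto f m n = trees_upto f' m n.
Proof.
  revert f' n; induction f as [|f IH]; intros [|f'] n H H'; try lia.
  cbn [trees_upto]. apply flat_map_ext_in; intros a _.
  apply flat_map_ext_in; intros i Hi. apply in_seq in Hi.
  assert (E : forall k, k <= n ->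
    match k with 0 => [None] | S k' => map Some (trees_upto f m k') end =
    match k with 0 => [None] | S k' => map Some (trees_upto f' m k') end).
  { intros [|k] Hk; [easy|]. rewrite (IH f' k) by lia. easy. }
  rewrite (E i), (E (n - i)) by lia. easy.
Qed.

Lemma B_unfold (m n : nat) :
  B m n = flat_map (fun a => flat_map (fun i =>
            flat_map (fun l => map (fun r => Node a l r) (otrees m (n - i)))
              (otrees m i)) (seq 0 (S n))) (seq 1 m).
Proof.
  unfold B at 1; cbn [trees_upto].
  apply flat_map_ext_in; intros a _.
  apply flat_map_ext_in; intros i Hi. apply in_seq in Hi.
  assert (E : forall k, k <= n ->
    match k with 0 => [None] | S k' => map Some (trees_upto n m k') end =
    otrees m k).
  { intros [|k] Hk; [easy|]. unfold otrees, B.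
    rewrite (trees_upto_fuel m n (S k) k) by lia. easy. }
  rewrite (E i), (E (n - i)) by lia. easy.
Qed.

(** A statistic that factors over label, left child and right child becomes a convolution. Counting
    all trees, counting the copies of one tree and counting the trees that avoid one are the three
    instances. *)
Lemma lsum_B (m n : nat) (f : tree -> nat) (h : nat -> nat) (g g' : option tree -> nat) :
  (forall a l r, f (Node a l r) = h a * (g l * g' r)) ->
  lsum f (B m n) = lsum h (seq 1 m) *
    lsum (fun i => lsum g (otrees m i) * lsum g' (otrees m (n - i))) (seq 0 (S n)).
Proof.
  intros H. rewrite B_unfold, lsum_flat_map, <- lsum_mult_r.
  apply lsum_ext_in; intros a _. rewrite lsum_flat_map, <- lsum_mult_l.
  apply lsum_ext_in; intros i _. rewrite lsum_flat_map.
  rewrite <- lsum_mult_r, <- lsum_mult_l.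
  apply lsum_ext_in; intros l _. rewrite lsum_map.
  rewrite <- !lsum_mult_l.
  apply lsum_ext_in; intros r _. rewrite H. lia.
Qed.

Lemma tree_option_ind (P : tree -> Prop) :
  (forall a l r, (forall u, l = Some u -> P u) -> (forall u, r = Some u -> P u) ->
     P (Node a l r)) -> forall t, P t.
Proof.
  intros H. fix IH 1. intros [a l r]. apply H.
  - destruct l as [u|]; intros v E; [|discriminate]. injection E as <-. apply IH.
  - destruct r as [u|]; intros v E; [|discriminate]. injection E as <-. apply IH.
Qed.

Fixpoint valid (m : nat) (t : tree) : bool :=
  match t with
  | Node a l r => (1 <=? a) && (a <=? m) &&
      match l with None => true | Some u => valid m u end &&
      match r with None => true | Some u => valid m u end
  end.

Definition osize (o : option tree) : nat :=
  match o with None => 0 | Some t => S (tsize t) end.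

Definition ovalid (m : nat) (o : option tree) : bool :=
  match o with None => true | Some t => valid m t end.

(** Indicators are numbers, so that they can be multiplied and summed by [lsum_B]. *)
Definition same (u t : tree) : nat := if tree_eq_dec u t then 1 else 0.

Definition osame (o o' : option tree) : nat :=
  match o, o' with
  | None, None => 1
  | Some u, Some t => same u t
  | _, _ => 0
  end.

Lemma same_Node (a b : nat) (l r l' r' : option tree) :
  same (Node a l r) (Node b l' r') =
  (if Nat.eq_dec a b then 1 else 0) * (osame l l' * osame r r').
Proof.
  assert (E : forall o o', osame o o' = if (match o, o' with
     | None, None => true
     | Some u, Some t => if tree_eq_dec u t then true else false
     | _, _ => false end) then 1 else 0).
  { intros [u|] [t|]; simpl; unfold same; try destruct (tree_eq_dec u t); easy. }
  unfold same. rewrite !E.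
  destruct (tree_eq_dec (Node a l r) (Node b l' r')) as [H|H].
  - injection H as -> -> ->. destruct (Nat.eq_dec b b); [|congruence].
    destruct l', r'; try destruct (tree_eq_dec t t); try destruct (tree_eq_dec t0 t0);
      congruence || easy.
  - destruct (Nat.eq_dec a b); [|easy].
    destruct l, r, l', r'; repeat destruct (tree_eq_dec _ _); try easy; congruence.
Qed.

(** Equality with [u] factors by [same_Node], so the multiplicity of [u] in the enumeration follows
    by induction on [u]. It yields both membership and the absence of repetitions. *)
Lemma lsum_same_B (m n : nat) (u : tree) :
  lsum (same u) (B m n) =
  if valid m u then if Nat.eq_dec (tsize u) n then 1 else 0 else 0.
Proof.
  revert n; induction u as [a l r IHl IHr] using tree_option_ind; intros n.
  rewrite (lsum_B m n _ (fun b => (if Nat.eq_dec a b then 1 else 0) * 1)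
             (osame l) (osame r)).
  2:{ intros b l' r'. rewrite same_Node. lia. }
  rewrite (lsum_seq_delta (fun _ => 1)).
  assert (E : forall o i, (forall u, o = Some u -> forall n, lsum (same u) (B m n) =
     if valid m u then if Nat.eq_dec (tsize u) n then 1 else 0 else 0) ->
     lsum (osame o) (otrees m i) =
     (if Nat.eq_dec (osize o) i then 1 else 0) * (if ovalid m o then 1 else 0)).
  { intros [u|] [|i] IH; simpl; try easy.
    - rewrite lsum_map. simpl. rewrite (IH u eq_refl).
      destruct (valid m u), (Nat.eq_dec (tsize u) i), (Nat.eq_dec (S (tsize u)) (S i));
        lia.
    - rewrite lsum_map. simpl. rewrite lsum_const. lia. }
  rewrite (lsum_ext_in _ (fun i => (if Nat.eq_dec (osize l) i then 1 else 0) *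
     ((if ovalid m l then 1 else 0) * ((if Nat.eq_dec (osize r) (n - i) then 1 else 0) *
     (if ovalid m r then 1 else 0))))).
  2:{ intros i _. rewrite (E l i IHl), (E r (n - i) IHr). lia. }
  rewrite (lsum_seq_delta (fun i => (if ovalid m l then 1 else 0) *
     ((if Nat.eq_dec (osize r) (n - i) then 1 else 0) * (if ovalid m r then 1 else 0)))).
  change (tsize (Node a l r)) with (osize l + osize r).
  change (valid m (Node a l r)) with
    ((1 <=? a) && (a <=? m) && ovalid m l && ovalid m r)%bool.
  destruct (Nat.leb_spec 1 a), (Nat.leb_spec a m), (le_dec 1 a), (lt_dec a (1 + m));
    try lia; simpl andb; try easy.
  destruct (ovalid m l), (ovalid m r); simpl andb; try easy;
  destruct (le_dec 0 (osize l)), (lt_dec (osize l) (0 + S n)),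
    (Nat.eq_dec (osize r) (n - osize l)), (Nat.eq_dec (osize l + osize r) n); lia.
Qed.

Lemma count_occ_lsum (u : tree) l : count_occ tree_eq_dec l u = lsum (same u) l.
Proof.
  induction l as [|x l IH]; simpl; [easy|]. unfold same at 1.
  destruct (tree_eq_dec x u), (tree_eq_dec u x); congruence || lia.
Qed.

Lemma In_B (m n : nat) (t : tree) :
  In t (B m n) <-> valid m t = true /\ tsize t = n.
Proof.
  rewrite (count_occ_In tree_eq_dec), count_occ_lsum, lsum_same_B.
  destruct (valid m t), (Nat.eq_dec (tsize t) n); intuition (try lia; congruence).
Qed.

Lemma NoDup_all_trees (m n : nat) : NoDup (flat_map (B m) (seq 0 n)).
Proof.
  apply (NoDup_count_occ tree_eq_dec). intros u.
  rewrite count_occ_lsum, lsum_flat_map.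
  rewrite (lsum_ext_in _ (fun k => (if Nat.eq_dec (tsize u) k then 1 else 0) *
     (if valid m u then 1 else 0))).
  2:{ intros k _. rewrite lsum_same_B.
      destruct (valid m u), (Nat.eq_dec (tsize u) k); lia. }
  rewrite (lsum_seq_delta (fun _ => if valid m u then 1 else 0)).
  destruct (le_dec 0 (tsize u)), (lt_dec (tsize u) (0 + n)), (valid m u); lia.
Qed.

Lemma subtrees_valid (m : nat) (t u : tree) :
  In u (subtrees t) -> valid m t = true -> valid m u = true /\ tsize u <= tsize t.
Proof.
  induction t as [a l r IHl IHr] using tree_option_ind. intros [<-|H] V; [easy|].
  simpl in V. repeat (apply andb_prop in V; destruct V as [V ?]).
  apply in_app_or in H. simpl.
  destruct H as [H|H]; [destruct l as [v|]|destruct r as [v|]]; try easy.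
  - destruct (IHl v eq_refl H) as [? ?]; [easy|]. split; [easy|lia].
  - destruct (IHr v eq_refl H) as [? ?]; [easy|]. split; [easy|lia].
Qed.

Definition occurs (u t : tree) : nat :=
  if in_dec tree_eq_dec u (subtrees t) then 1 else 0.

Definition avoids (u t : tree) : nat :=
  if in_dec tree_eq_dec u (subtrees t) then 0 else 1.

Definition oavoids (u : tree) (o : option tree) : nat :=
  match o with None => 1 | Some t => avoids u t end.

(** Subtrees of [t] are valid and of size at most [n]; hence the deduplicated list of subtrees and
    the list of all such trees occurring in [t] are duplicate-free with the same elements. *)
Lemma dag_size_lsum (m n : nat) (t : tree) : In t (B m n) ->
  dag_size t = lsum (fun k => lsum (fun u => occurs u t) (B m k)) (seq 0 (S n)).
Proof.
  intros Ht. apply In_B in Ht as [V S].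
  rewrite <- lsum_flat_map. unfold dag_size.
  rewrite (lsum_ext_in _ (fun u => if (if in_dec tree_eq_dec u (subtrees t)
     then true else false) then 1 else 0)).
  2:{ intros u _. unfold occurs. now destruct (in_dec _ _ _). }
  rewrite <- length_filter_lsum. apply Permutation_length, NoDup_Permutation.
  - apply NoDup_nodup.
  - apply NoDup_filter, NoDup_all_trees.
  - intros u. rewrite nodup_In, filter_In, in_flat_map. split.
    + intros H. destruct (subtrees_valid m t u H V) as [Vu Su]. split.
      * exists (tsize u). split; [apply in_seq; lia|]. now apply In_B.
      * now destruct (in_dec _ _ _).
    + intros [_ H]. now destruct (in_dec _ _ _).
Qed.

(** A node avoids [u] when both children do, unless the node is [u] itself: the children of [u] are
    too small to contain it, and [same] corrects this one case. *)
Lemma avoids_Node (u : tree) (a : nat) (l r : option tree) :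
  avoids u (Node a l r) + same u (Node a l r) = oavoids u l * oavoids u r.
Proof.
  assert (Hl : forall b l' r' v, l' = Some v \/ r' = Some v ->
     ~ In (Node b l' r') (subtrees v)).
  { intros b l' r' v H Hin.
    assert (K : forall x y, In x (subtrees y) -> tsize x <= tsize y).
    { intros x y. induction y as [c p q IHp IHq] using tree_option_ind.
      intros [<-|Hx]; [easy|]. apply in_app_or in Hx. simpl.
      destruct Hx as [Hx|Hx]; [destruct p as [y|]|destruct q as [y|]]; try easy.
      - specialize (IHp y eq_refl Hx). lia.
      - specialize (IHq y eq_refl Hx). lia. }
    specialize (K _ _ Hin). simpl in K. destruct H; subst; lia. }
  assert (E : forall o, oavoids u o = if in_dec tree_eq_dec u
     (match o with None => [] | Some v => subtrees v end) then 0 else 1).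
  { intros [v|]; easy. }
  rewrite !E. unfold avoids, same. cbn [subtrees].
  destruct (tree_eq_dec u (Node a l r)) as [->|Hu].
  - destruct (in_dec _ _ _) as [_|H]; [|now destruct H; left].
    destruct (in_dec _ _ _) as [H|_];
      [destruct l; [exfalso; apply (Hl a (Some t) r t); auto|easy]|].
    destruct (in_dec _ _ _) as [H|_];
      [destruct r; [exfalso; apply (Hl a l (Some t) t); auto|easy]|].
    easy.
  - set (sl := match l with None => [] | Some v => subtrees v end).
    set (sr := match r with None => [] | Some v => subtrees v end).
    destruct (in_dec tree_eq_dec u (Node a l r :: sl ++ sr)) as [H|H];
    destruct (in_dec tree_eq_dec u sl) as [H1|H1];
    destruct (in_dec tree_eq_dec u sr) as [H2|H2]; try easy;
    simpl in H; rewrite in_app_iff in H; intuition congruence.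
Qed.

(** * Convolution recurrences for all trees and for the trees avoiding a given one *)

Definition shift1 (x : nat -> nat) (i : nat) : nat :=
  match i with 0 => 1 | S j => x j end.

(** Coefficientwise form of [A + D = m (1 + z A)^2], where [shift1 x] lists the coefficients of
    [1 + z A]. The term [d] stands on the left to avoid subtraction in [nat]. *)
Definition conv_rec (m : nat) (d x : nat -> nat) : Prop :=
  forall n, x n + d n =
    m * lsum (fun i => shift1 x i * shift1 x (n - i)) (seq 0 (S n)).

(** The right-hand side at [n] involves [x] only below [n], because [shift1] lowers the index. *)
Lemma conv_rec_unique (m : nat) (d x y : nat -> nat) :
  conv_rec m d x -> conv_rec m d y -> forall n, x n = y n.
Proof.
  intros Hx Hy n. induction n as [n IH] using lt_wf_ind.
  specialize (Hx n). specialize (Hy n).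
  rewrite (lsum_ext_in _ (fun i => shift1 y i * shift1 y (n - i))) in Hx; [lia|].
  assert (E : forall i, i <= n -> shift1 x i = shift1 y i).
  { intros [|i] Hi; [easy|]. apply IH. lia. }
  intros i Hi. apply in_seq in Hi. rewrite !E by lia. easy.
Qed.

Lemma lsum_otrees (m i : nat) (g : option tree -> nat) (f : tree -> nat) :
  g None = 1 -> (forall t, g (Some t) = f t) ->
  lsum g (otrees m i) = shift1 (fun n => lsum f (B m n)) i.
Proof.
  intros H0 H. destruct i as [|i]; simpl.
  - rewrite H0. lia.
  - rewrite lsum_map. apply lsum_ext_in. intros t _. apply H.
Qed.

Lemma conv_rec_length_B (m : nat) :
  conv_rec m (fun _ => 0) (fun n => length (B m n)).
Proof.
  intros n. rewrite Nat.add_0_r.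
  rewrite <- (Nat.mul_1_r (length (B m n))), <- lsum_const.
  rewrite (lsum_B m n _ (fun _ => 1) (fun _ => 1) (fun _ => 1)) by easy.
  rewrite lsum_const, length_seq, Nat.mul_1_r. f_equal.
  apply lsum_ext_in. intros i _.
  assert (E : forall j, lsum (fun _ => 1) (otrees m j)
     = shift1 (fun n => length (B m n)) j).
  { intros j. rewrite lsum_const, Nat.mul_1_r.
    destruct j; simpl; rewrite ?length_map; easy. }
  now rewrite !E.
Qed.

(** Summed over all trees of size [n], the correction in [avoids_Node] contributes 1 exactly when
    [n] is the size of [u]. *)
Lemma conv_rec_avoids (m k : nat) (u : tree) : In u (B m k) ->
  conv_rec m (fun n => if Nat.eq_dec k n then 1 else 0)
    (fun n => lsum (avoids u) (B m n)).
Proof.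
  intros Hu n. apply In_B in Hu as [V <-].
  pose proof (lsum_same_B m n u) as E. rewrite V in E. rewrite <- E, <- lsum_plus.
  rewrite (lsum_B m n _ (fun _ => 1) (oavoids u) (oavoids u)).
  2:{ intros a l r. rewrite avoids_Node. lia. }
  rewrite lsum_const, length_seq, Nat.mul_1_r. f_equal.
  apply lsum_ext_in. intros i _.
  rewrite !(lsum_otrees m _ (oavoids u) (avoids u)) by easy. easy.
Qed.

(* The number of trees of size [n] avoiding a fixed tree of size [k]; by
   [conv_rec_unique] it does not depend on the choice of that tree. *)
Definition navoid (m k n : nat) : nat :=
  lsum (avoids (hd (Node 0 None None) (B m k))) (B m n).

Lemma lsum_occurs (m k n : nat) (u : tree) : In u (B m k) ->
  lsum (occurs u) (B m n) + navoid m k n = length (B m n).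
Proof.
  intros Hu.
  assert (Hh : In (hd (Node 0 None None) (B m k)) (B m k)).
  { destruct (B m k); [easy|now left]. }
  unfold navoid.
  rewrite (conv_rec_unique _ _ _ _ (conv_rec_avoids m k _ Hh) (conv_rec_avoids m k u Hu)).
  rewrite <- lsum_plus, <- (Nat.mul_1_r (length _)), <- lsum_const.
  apply lsum_ext_in. intros t _. unfold occurs, avoids.
  now destruct (in_dec _ _ _).
Qed.

(** A left path labelled 1 throughout is a witness. Hence the default of [hd] in [navoid] is never
    reached for [1 <= m]. *)
Lemma B_nonempty (m k : nat) : 1 <= m -> B m k <> [].
Proof.
  intros Hm.
  assert (H : exists t, valid m t = true /\ tsize t = k).
  { induction k as [|k [t [V S]]].
    - exists (Node 1 None None). now destruct m; [lia|].
    - exists (Node 1 (Some t) None). destruct m; [lia|].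
      simpl. rewrite V, S. split; [easy|lia]. }
  destruct H as [t Ht]. apply In_B in Ht. intros E. now rewrite E in Ht.
Qed.

Lemma conv_rec_navoid (m k : nat) : 1 <= m ->
  conv_rec m (fun n => if Nat.eq_dec k n then 1 else 0) (navoid m k).
Proof.
  intros Hm. apply (conv_rec_avoids m k).
  generalize (B_nonempty m k Hm). destruct (B m k); [easy|now left].
Qed.

Lemma navoid_le (m k n : nat) : navoid m k n <= length (B m n).
Proof.
  unfold navoid. rewrite <- (Nat.mul_1_r (length _)), <- lsum_const.
  induction (B m n) as [|t l IH]; simpl; [easy|].
  assert (avoids (hd (Node 0 None None) (B m k)) t <= 1).
  { unfold avoids. destruct (in_dec _ _ _); lia. }
  lia.
Qed.

(** Pairs of a tree and one of its distinct subtrees are grouped by the subtree. By [lsum_occurs]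
    the truncated subtraction is a genuine one. *)
Lemma NB_coeff_sum (m n : nat) :
  NB_coeff m n =
  lsum (fun k => length (B m k) * (length (B m n) - navoid m k n)) (seq 0 (S n)).
Proof.
  change (NB_coeff m n) with (lsum dag_size (B m n)).
  rewrite (lsum_ext_in _ _ _ (dag_size_lsum m n)), lsum_swap.
  apply lsum_ext_in. intros k _. rewrite lsum_swap, <- lsum_const.
  apply lsum_ext_in. intros u Hu.
  pose proof (lsum_occurs m k n u Hu).
  change (lsum (fun x => occurs u x)) with (lsum (occurs u)). lia.
Qed.

(** Both sequences obey the same recurrence until the correction enters at index [k]. *)
Lemma navoid_lt (m k n : nat) : 1 <= m -> n < k -> navoid m k n = length (B m n).
Proof.
  intros Hm. induction n as [n IH] using lt_wf_ind. intros Hn.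
  pose proof (conv_rec_navoid m k Hm n) as H1. pose proof (conv_rec_length_B m n) as H2.
  cbv beta in H1, H2.
  destruct (Nat.eq_dec k n); [lia|].
  rewrite (lsum_ext_in _ (fun i => shift1 (fun n => length (B m n)) i *
     shift1 (fun n => length (B m n)) (n - i))) in H1; [lia|].
  assert (E : forall i, i <= n -> shift1 (navoid m k) i
     = shift1 (fun n => length (B m n)) i).
  { intros [|i] Hi; [easy|]. apply IH; lia. }
  intros i Hi. apply in_seq in Hi. rewrite !E by lia. easy.
Qed.

End Counting.

(** * Central binomial coefficients *)

(* [pcb n] is the central binomial coefficient divided by [4 ^ n], and [tcat n]
   the Catalan number divided by [4 ^ n]. *)
Fixpoint pcb (n : nat) : R :=
  match n with
  | O => 1
  | S k => pcb k * ((2 * INR k + 1) / (2 * INR k + 2))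
  end.

Definition tcat (n : nat) : R := pcb n / (INR n + 1).

Lemma pcb_pos (n : nat) : 0 < pcb n.
Proof.
  induction n as [|n IH]; simpl; [lra|].
  pose proof (pos_INR n). apply Rmult_lt_0_compat; [easy|].
  apply Rdiv_lt_0_compat; lra.
Qed.

Lemma tcat_pos (n : nat) : 0 < tcat n.
Proof.
  pose proof (pos_INR n). pose proof (pcb_pos n). apply Rdiv_lt_0_compat; lra.
Qed.

(** Source of the closed forms for the partial sums of the normalised Catalan series and for its
    tails. *)
Lemma tcat_telescope (n : nat) : tcat n = 2 * (pcb n - pcb (S n)).
Proof.
  unfold tcat. simpl. pose proof (pos_INR n). field. lra.
Qed.

Lemma sum_f_R0_rev (f : nat -> R) (n : nat) :
  sum_f_R0 f n = sum_f_R0 (fun i => f (n - i)%nat) n.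
Proof.
  revert f; induction n as [|n IH]; intros f; [easy|].
  rewrite (decomp_sum (fun i => f (S n - i)%nat)) by lia. simpl pred.
  rewrite tech5, Nat.sub_0_r, IH, Rplus_comm. f_equal.
Qed.

Definition dsqrt (n : nat) : R := match n with O => 1 | S k => - tcat k / 2 end.

(** The equation [(1 - x) f' = - f / 2] of [f = sqrt (1 - x)], read on coefficients. *)
Lemma dsqrt_rec (n : nat) : (INR n + 1) * dsqrt (S n) = (INR n - / 2) * dsqrt n.
Proof.
  destruct n as [|n].
  - simpl. unfold tcat; simpl. field.
  - unfold dsqrt, tcat. rewrite S_INR. simpl.
    pose proof (pos_INR n). field. lra.
Qed.

(* [dsqrt] lists the coefficients of sqrt(1 - x), so its square is 1 - x. *)
Lemma dsqrt_conv (n : nat) :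
  sum_f_R0 (fun i => dsqrt i * dsqrt (S (S n) - i)) (S (S n)) = 0.
Proof.
  set (S' := fun n => sum_f_R0 (fun i => dsqrt i * dsqrt (n - i)) n).
  (* The square [g] of the series satisfies [(1 - x) g' = - g]. At [n = 1] the factor [INR n - 1]
     kills the next coefficient, and then all later ones vanish. *)
  assert (R1 : forall n, (INR n + 1) * S' (S n) = (INR n - 1) * S' n).
  { clear n; intros n.
    (* The summand [dsqrt i * dsqrt (N - i)] is symmetric under [i -> N - i], so the weight [i]
       averages to [N / 2]. *)
    assert (Hw : forall N, 2 * sum_f_R0 (fun i => INR i * (dsqrt i * dsqrt (N - i))) N
       = INR N * S' N).
    { intros N. unfold S'. rewrite (scal_sum _ N (INR N)).
      set (f := fun i => INR i * (dsqrt i * dsqrt (N - i))).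
      replace (2 * sum_f_R0 f N) with (sum_f_R0 f N + sum_f_R0 f N) by ring.
      rewrite (sum_f_R0_rev f) at 2. unfold f.
      rewrite <- sum_plus. apply sum_eq. intros i Hi.
      replace (N - (N - i))%nat with i by lia. rewrite minus_INR by lia. ring. }
    rewrite <- S_INR, <- Hw, decomp_sum by lia. simpl pred.
    replace ((INR n - 1) * S' n) with (INR n * S' n - S' n) by ring.
    rewrite <- Hw. simpl (INR 0). rewrite Rmult_0_l, Rplus_0_l.
    unfold S'.
    transitivity (2 * sum_f_R0 (fun i => (INR i - /2) * (dsqrt i * dsqrt (n - i))) n).
    - f_equal. apply sum_eq. intros i Hi.
      rewrite Nat.sub_succ, S_INR, <- Rmult_assoc, dsqrt_rec. ring.
    - rewrite (sum_eq _ (fun i => INR i * (dsqrt i * dsqrt (n - i)) -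
         dsqrt i * dsqrt (n - i) * /2)) by (intros; ring).
      rewrite minus_sum, <- scal_sum. field. }
  fold (S' (S (S n))). induction n as [|n IH].
  - specialize (R1 1%nat). simpl (INR 1) in R1. lra.
  - specialize (R1 (S (S n))). rewrite IH, !S_INR in R1.
    pose proof (pos_INR n). nra.
Qed.

(** In the vanishing coefficient of the squared series the two end terms give [- tcat (S n)]
    together, and the inner ones a quarter of the Catalan convolution. *)
Lemma tcat_conv (n : nat) :
  4 * tcat (S n) = sum_f_R0 (fun i => tcat i * tcat (n - i)) n.
Proof.
  pose proof (dsqrt_conv n) as H.
  rewrite tech5, decomp_sum in H by lia. simpl pred in H.
  rewrite Nat.sub_diag, Nat.sub_0_r in H. 
  rewrite (sum_eq _ (fun i => tcat i * tcat (n - i) * / 4)) in H.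
  - rewrite <- scal_sum in H. unfold dsqrt in H. lra.
  - intros i Hi. replace (S (S n) - S i)%nat with (S (n - i)) by lia.
    unfold dsqrt. field.
Qed.

Lemma sum_tcat (n : nat) : sum_f_R0 tcat n = 2 - 2 * pcb (S n).
Proof.
  induction n as [|n IH].
  - simpl. unfold tcat; simpl. field.
  - rewrite tech5, IH, tcat_telescope. ring.
Qed.

(** * Wallis integrals *)

Definition cosint (n : nat) : R := RInt (fun x => cos x ^ n) 0 (PI / 2).

Lemma ex_RInt_cos_pow (n : nat) (a b : R) : ex_RInt (fun x => cos x ^ n) a b.
Proof.
  apply (ex_RInt_continuous (V := R_CompleteNormedModule)). intros x _.
  apply (ex_derive_continuous (fun x => cos x ^ n)). auto_derive. easy.
Qed.

(** The integrand is the derivative of [sin x * cos x ^ S n], which vanishes at both ends. *)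
Lemma cosint_rec (n : nat) : (INR n + 2) * cosint (S (S n)) = (INR n + 1) * cosint n.
Proof.
  assert (H : is_RInt (fun x => (INR n + 2) * cos x ^ S (S n) - (INR n + 1) * cos x ^ n)
    0 (PI / 2) 0).
  { replace 0 with (minus (sin (PI / 2) * cos (PI / 2) ^ S n) (sin 0 * cos 0 ^ S n)) at 2.
    2:{ rewrite cos_PI2, sin_0. unfold minus, plus, opp; simpl. ring. }
    apply (is_RInt_derive (fun x => sin x * cos x ^ S n)).
    - intros x _. auto_derive; [easy|].
      pose proof (sin2_cos2 x) as E. unfold Rsqr in E.
      replace (match n with 0%nat => 1 | S _ => INR n + 1 end) with (INR n + 1)
        by (destruct n; simpl; lra).
      simpl pow.
      replace (sin x * (1 * - sin x * ((INR n + 1) * cos x ^ n))) with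
        (- (sin x * sin x) * ((INR n + 1) * cos x ^ n)) by ring.
      replace (sin x * sin x) with (1 - cos x * cos x) by lra.
      ring.
    - intros x _. apply (ex_derive_continuous (V := R_NormedModule)). auto_derive. easy. }
  assert (H2 : is_RInt (fun x => (INR n + 2) * cos x ^ S (S n) - (INR n + 1) * cos x ^ n)
    0 (PI / 2) ((INR n + 2) * cosint (S (S n)) - (INR n + 1) * cosint n)).
  { apply (is_RInt_minus (V := R_NormedModule) (fun x => (INR n + 2) * cos x ^ S (S n))
      (fun x => (INR n + 1) * cos x ^ n));
    apply (is_RInt_scal (V := R_NormedModule));
    apply (RInt_correct (V := R_CompleteNormedModule)), ex_RInt_cos_pow. }
  apply (is_RInt_unique (V := R_CompleteNormedModule)) in H, H2. lra.
Qed.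

Lemma cosint_decr (n : nat) : cosint (S n) <= cosint n.
Proof.
  pose proof PI_RGT_0. apply RInt_le; try apply ex_RInt_cos_pow; [lra|].
  intros x Hx. simpl.
  assert (0 <= cos x) by (apply cos_ge_0; lra).
  pose proof (COS_bound x). pose proof (pow_le (cos x) n ltac:(easy)). nra.
Qed.

Lemma cosint_even (n : nat) : cosint (2 * n) = PI / 2 * pcb n.
Proof.
  induction n as [|n IH].
  - unfold cosint. simpl. rewrite RInt_const. unfold scal; simpl. unfold mult; simpl. ring.
  - replace (2 * S n)%nat with (S (S (2 * n))) by lia.
    pose proof (cosint_rec (2 * n)) as H. rewrite IH, mult_INR in H. simpl (INR 2) in H.
    pose proof (pos_INR n). simpl pcb.
    apply Rmult_eq_reg_l with (2 * INR n + 2); [|lra].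
    replace (2 * INR n + 2) with ((1 + 1) * INR n + 2) at 1 by ring.
    rewrite H. field. lra.
Qed.

Lemma cosint_odd (n : nat) : cosint (S (2 * n)) = / ((2 * INR n + 1) * pcb n).
Proof.
  induction n as [|n IH].
  - unfold cosint. simpl.
    rewrite (RInt_ext _ cos) by (intros; apply Rmult_1_r).
    rewrite (is_RInt_unique cos 0 (PI / 2) (minus (sin (PI / 2)) (sin 0))).
    + rewrite sin_PI2, sin_0. unfold minus, plus, opp; simpl. field.
    + apply (is_RInt_derive sin); intros x _.
      * auto_derive; [easy|ring].
      * apply (ex_derive_continuous cos). auto_derive. easy.
  - replace (S (2 * S n))%nat with (S (S (S (2 * n)))) by lia.
    pose proof (cosint_rec (S (2 * n))) as H. rewrite IH, !S_INR, mult_INR in H.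
    simpl (INR 2) in H. pose proof (pos_INR n). pose proof (pcb_pos n). simpl pcb.
    apply Rmult_eq_reg_l with (2 * INR n + 3); [|lra].
    replace (2 * INR n + 3) with ((1 + 1) * INR n + 1 + 2) at 1 by ring.
    rewrite H, S_INR. field. lra.
Qed.

(** The odd integral is at most the even one just before it, and both are explicit in [pcb n]. *)
Lemma Wallis_lower (n : nat) : / (PI * (INR n + / 2)) <= pcb n ^ 2.
Proof.
  pose proof (cosint_decr (2 * n)) as H. rewrite cosint_even, cosint_odd in H.
  pose proof (pos_INR n). pose proof (pcb_pos n). pose proof PI_RGT_0.
  apply Rmult_le_reg_l with (PI / (2 * pcb n)); [apply Rdiv_lt_0_compat; lra|].
  replace (PI / (2 * pcb n) * / (PI * (INR n + / 2))) with
    (/ ((2 * INR n + 1) * pcb n)) by (field; lra).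
  replace (PI / (2 * pcb n) * pcb n ^ 2) with (PI / 2 * pcb n) by (field; lra).
  easy.
Qed.

(** The even integral of index [2 * n] is at most the odd one just before it. *)
Lemma Wallis_upper (n : nat) : (1 <= n)%nat -> pcb n ^ 2 <= / (PI * INR n).
Proof.
  destruct n as [|n]; [lia|]. intros _.
  pose proof (cosint_decr (S (2 * n))) as H.
  replace (S (S (2 * n))) with (2 * S n)%nat in H by lia.
  rewrite cosint_even, cosint_odd in H.
  pose proof (pos_INR n). pose proof (pcb_pos n). pose proof PI_RGT_0.
  pose proof (pcb_pos (S n)).
  assert (E : (2 * INR n + 1) * pcb n = 2 * INR (S n) * pcb (S n)).
  { rewrite S_INR. simpl pcb. field. lra. }
  rewrite E in H. rewrite S_INR in *.
  apply Rmult_le_reg_l with (PI / (2 * pcb (S n))); [apply Rdiv_lt_0_compat; lra|].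
  replace (PI / (2 * pcb (S n)) * / (PI * (INR n + 1))) with
    (/ (2 * (INR n + 1) * pcb (S n))) by (field; lra).
  replace (PI / (2 * pcb (S n)) * pcb (S n) ^ 2) with (PI / 2 * pcb (S n)) by (field; lra).
  easy.
Qed.

Lemma tcat_le_1 (n : nat) : tcat n <= 1.
Proof.
  pose proof (pos_INR n).
  assert (pcb n <= 1).
  { induction n as [|n IH]; simpl; [lra|]. pose proof (pos_INR n).
    specialize (IH ltac:(easy)). pose proof (pcb_pos n).
    assert ((2 * INR n + 1) / (2 * INR n + 2) <= 1).
    { apply Rmult_le_reg_r with (2 * INR n + 2); [lra|]. unfold Rdiv.
      rewrite Rmult_assoc, Rinv_l by lra. lra. }
    nra. }
  unfold tcat. apply Rmult_le_reg_r with (INR n + 1); [lra|]. unfold Rdiv.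
  rewrite Rmult_assoc, Rinv_l by lra. lra.
Qed.

(** The partial sums are [2 - 2 * pcb (S n)] and Wallis sends [pcb] to 0. The value 2 later bounds
    [|1 + z A|], which selects the branch of the roots. *)
Lemma is_series_tcat : is_series tcat 2.
Proof.
  apply is_series_Reals.
  assert (L : is_lim_seq pcb 0).
  { apply is_lim_seq_incr_1.
    apply is_lim_seq_le_le with (fun _ => 0) (fun n => sqrt (/ INR (S n))).
    - intros n. pose proof (pcb_pos (S n)). split; [lra|].
      rewrite <- (sqrt_pow2 (pcb (S n))) by lra. apply sqrt_le_1_alt.
      apply Rle_trans with (1 := Wallis_upper (S n) ltac:(lia)).
      apply Rinv_le_contravar; [apply lt_0_INR; lia|].
      pose proof PI2_1. pose proof (lt_0_INR (S n) ltac:(lia)). nra.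
    - apply is_lim_seq_const.
    - replace 0 with (sqrt 0) by apply sqrt_0.
      apply is_lim_seq_continuous; [apply continuity_pt_filterlim, continuous_sqrt|].
      apply (is_lim_seq_incr_1 (fun n => / INR n)).
      replace (Finite 0) with (Rbar_inv p_infty) by easy.
      apply is_lim_seq_inv; [apply is_lim_seq_INR|easy]. }
  apply is_series_Reals. unfold is_series.
  apply is_lim_seq_incr_1 in L.
  assert (L2 : is_lim_seq (fun n => 2 - 2 * pcb (S n)) (2 - 2 * 0)).
  { apply is_lim_seq_minus'; [apply is_lim_seq_const|].
    apply (is_lim_seq_scal_l (fun n => pcb (S n)) 2 0 L). }
  replace 2 with (2 - 2 * 0) by ring.
  apply is_lim_seq_ext with (2 := L2). intros n.
  now rewrite sum_n_Reals, sum_tcat.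
Qed.

(** Divided by [(4m)^(n+1)], the counts satisfy the Catalan convolution. The index is [S n] because
    a tree with [n] edges has [n + 1] nodes. *)
Lemma length_B_tcat (m n : nat) :
  INR (length (B m n)) = (4 * INR m) ^ S n * tcat (S n).
Proof.
  induction n as [n IH] using lt_wf_ind.
  pose proof (conv_rec_length_B m n) as H. cbv beta in H. rewrite Nat.add_0_r in H.
  rewrite H, mult_INR.
  assert (E : forall i, (i <= n)%nat ->
    INR (shift1 (fun n => length (B m n)) i) = (4 * INR m) ^ i * tcat i).
  { intros [|i] Hi; [simpl; unfold tcat; simpl; field|]. apply IH. lia. }
  assert (Es : forall f N, INR (lsum f (seq 0 (S N))) = sum_f_R0 (fun i => INR (f i)) N).
  { clear. intros f N. induction N as [|N IH].
    - simpl. now rewrite Nat.add_0_r.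
    - rewrite seq_S, lsum_app, plus_INR, IH, tech5. simpl. now rewrite Nat.add_0_r. }
  rewrite Es, (sum_eq _ (fun i => tcat i * tcat (n - i) * (4 * INR m) ^ n)).
  - rewrite <- scal_sum, <- tcat_conv. simpl. ring.
  - intros i Hi. rewrite mult_INR, !E by lia.
    replace ((4 * INR m) ^ n) with ((4 * INR m) ^ i * (4 * INR m) ^ (n - i))
      by (rewrite <- pow_add; f_equal; lia).
    ring.
Qed.

(** * Principal square root and logarithm *)

Definition off_cut (w : C) : Prop := 0 < fst w \/ snd w <> 0.

Lemma Cmod_sqr (z : C) : Cmod z * Cmod z = fst z * fst z + snd z * snd z.
Proof. unfold Cmod. rewrite sqrt_sqrt; [ring|]. nra. Qed.

Lemma Cmod_fst_le (z : C) : Rabs (fst z) <= Cmod z.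
Proof. apply Rle_trans with (2 := Rmax_Cmod z). apply Rmax_l. Qed.

Lemma Cmod_snd_le (z : C) : Rabs (snd z) <= Cmod z.
Proof. apply Rle_trans with (2 := Rmax_Cmod z). apply Rmax_r. Qed.

Lemma fst_le_Cmod (z : C) : fst z <= Cmod z.
Proof. apply Rle_trans with (2 := Cmod_fst_le z). apply Rle_abs. Qed.

Lemma Cmod_polar_pos (x y : R) : 0 < x ->
  x = Cmod (x, y) * cos (atan (y / x)) /\ y = Cmod (x, y) * sin (atan (y / x)).
Proof.
  intros Hx. rewrite cos_atan, sin_atan.
  assert (E : Cmod (x, y) = x * sqrt (1 + (y / x)²)).
  { rewrite <- (sqrt_square x) at 2 by lra.
    rewrite <- sqrt_mult_alt by nra. unfold Cmod. f_equal. unfold Rsqr; simpl. field. lra. }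
  assert (0 < sqrt (1 + (y / x)²)).
  { apply sqrt_lt_R0. pose proof (Rle_0_sqr (y / x)). lra. }
  rewrite E. split; field; lra.
Qed.

Lemma Carg_polar (z : C) :
  fst z = Cmod z * cos (Carg z) /\ snd z = Cmod z * sin (Carg z).
Proof.
  destruct z as [x y]. unfold Carg; simpl fst; simpl snd.
  destruct (Rlt_dec 0 x) as [Hx|Hx].
  { now apply Cmod_polar_pos. }
  destruct (Rlt_dec x 0) as [Hx'|Hx'].
  - destruct (Cmod_polar_pos (- x) (- y) ltac:(lra)) as [E1 E2].
    replace (- y / - x) with (y / x) in E1, E2 by (field; lra).
    change (- x, - y) with (Copp (x, y)) in E1, E2. rewrite Cmod_opp in E1, E2.
    destruct (Rle_dec 0 y).
    + rewrite neg_cos, neg_sin. lra.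
    + replace (atan (y / x) - PI) with (- (PI - atan (y / x))) by ring.
      rewrite cos_neg, sin_neg.
      replace (PI - atan (y / x)) with (- atan (y / x) + PI) by ring.
      rewrite neg_cos, neg_sin, cos_neg, sin_neg. lra.
  - replace x with 0 by lra. clear Hx Hx'.
    assert (E : Cmod (0, y) = Rabs y).
    { unfold Cmod; simpl. rewrite <- sqrt_Rsqr_abs. f_equal. unfold Rsqr. ring. }
    rewrite E.
    destruct (Rlt_dec 0 y); [|destruct (Rlt_dec y 0)].
    + rewrite cos_PI2, sin_PI2, Rabs_right by lra. lra.
    + rewrite cos_neg, sin_neg, cos_PI2, sin_PI2, Rabs_left by lra. lra.
    + replace y with 0 by lra. rewrite Rabs_R0. lra.
Qed.

Lemma Carg_bound (z : C) : - PI < Carg z <= PI.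
Proof.
  unfold Carg. pose proof (atan_bound (snd z / fst z)). pose proof PI_RGT_0.
  destruct (Rlt_dec 0 (fst z)); [lra|].
  destruct (Rlt_dec (fst z) 0) as [Hx|Hx].
  - destruct (Rle_dec 0 (snd z)) as [Hy|Hy].
    + assert (atan (snd z / fst z) <= 0); [|lra].
      rewrite <- atan_0. apply Rnot_lt_le. intros Hlt. apply (Rlt_asym _ _ Hlt).
      apply Rnot_le_lt. intros Hle.
      assert (snd z / fst z <= 0).
      { unfold Rdiv. pose proof (Rinv_lt_0_compat _ Hx). nra. }
      destruct H1 as [H1|H1].
      * apply atan_increasing in H1. lra.
      * rewrite H1 in Hlt. lra.
    + assert (0 < atan (snd z / fst z)); [|lra].
      rewrite <- atan_0. apply atan_increasing. unfold Rdiv.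
      pose proof (Rinv_lt_0_compat _ Hx). nra.
  - destruct (Rlt_dec 0 (snd z)); [lra|]. destruct (Rlt_dec (snd z) 0); lra.
Qed.

(** On [(-PI, PI]] the sine never has the sign opposite to its argument. *)
Lemma Carg_sign (z : C) : 0 <= snd z * Carg z.
Proof.
  destruct (Carg_polar z) as [_ E]. pose proof (Carg_bound z) as Hb.
  pose proof (Cmod_ge_0 z). rewrite E.
  destruct (Rle_dec 0 (Carg z)).
  - pose proof (sin_ge_0 (Carg z) ltac:(lra) ltac:(lra)). 
    apply Rmult_le_pos; [|lra]. now apply Rmult_le_pos.
  - pose proof (sin_ge_0 (- Carg z) ltac:(lra) ltac:(lra)) as Hs. rewrite sin_neg in Hs.
    replace (Cmod z * sin (Carg z) * Carg z) with
      (Cmod z * - sin (Carg z) * - Carg z) by ring.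
    apply Rmult_le_pos; [|lra]. now apply Rmult_le_pos.
Qed.

Lemma Csqrt_sqr (w : C) : (Csqrt w * Csqrt w)%C = w.
Proof.
  destruct (Carg_polar w) as [E1 E2]. rewrite (surjective_pairing w) at 3.
  unfold Csqrt. set (a := Carg w) in *.
  assert (Ea : a = 2 * (a / 2)) by field.
  rewrite Ea, cos_2a in E1. rewrite Ea, sin_2a in E2. rewrite E1, E2.
  pose proof (sqrt_sqrt (Cmod w) (Cmod_ge_0 w)) as S. revert S.
  generalize (cos (a / 2)) (sin (a / 2)) (sqrt (Cmod w)). intros c s q S.
  unfold Cmult; simpl. rewrite <- S. f_equal; ring.
Qed.

Lemma Csqrt_fst_ge_0 (w : C) : 0 <= fst (Csqrt w).
Proof.
  simpl. apply Rmult_le_pos; [apply sqrt_pos|].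
  pose proof (Carg_bound w). apply cos_ge_0; lra.
Qed.

Lemma Csqrt_fst_pos (w : C) : off_cut w -> 0 < fst (Csqrt w).
Proof.
  intros H. destruct (Csqrt_fst_ge_0 w) as [?|E]; [easy|exfalso].
  pose proof (Csqrt_sqr w) as S. destruct (Csqrt w) as [a b]. simpl in E. subst a.
  rewrite <- S in H. unfold off_cut in H. simpl in H. nra.
Qed.

Lemma Cmod_Csqrt (w : C) : Cmod (Csqrt w) = sqrt (Cmod w).
Proof.
  rewrite <- (Csqrt_sqr w) at 2. rewrite Cmod_mult. symmetry.
  apply sqrt_square, Cmod_ge_0.
Qed.

Lemma Csqr_pos_unique (u v : C) :
  (u * u = v * v)%C -> 0 < fst u -> 0 <= fst v -> u = v.
Proof.
  intros E Hu Hv. assert (H : ((u - v) * (u + v) = 0)%C).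
  { replace ((u - v) * (u + v))%C with (u * u - v * v)%C by ring. rewrite E. ring. }
  apply (f_equal Cmod) in H. rewrite Cmod_mult, Cmod_0 in H.
  apply Rmult_integral in H as [H|H]; apply Cmod_eq_0 in H.
  - replace u with ((u - v) + v)%C by ring. rewrite H. ring.
  - apply (f_equal fst) in H. simpl in H. lra.
Qed.

(** The two square roots of [w] differ by a sign, which the real part decides. All branches below
    are identified through this lemma. *)
Lemma Csqrt_unique (u w : C) : (u * u)%C = w -> 0 < fst u -> Csqrt w = u.
Proof.
  intros E H. symmetry. apply Csqr_pos_unique; [now rewrite Csqrt_sqr|easy|].
  apply Csqrt_fst_ge_0.
Qed.

(** [|u + v|^2 - |u - v|^2] is four times the inner product of [u] and [v] as plane vectors,
    nonnegative under these signs. *)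
Lemma Cmod_add_same_quadrant (u v : C) :
  0 <= fst u -> 0 <= fst v -> 0 <= snd u * snd v ->
  Cmod (u - v) <= Cmod (u + v) /\ Cmod u <= Cmod (u + v).
Proof.
  intros H1 H2 H3. unfold Cmod. split; apply sqrt_le_1_alt; simpl; nra.
Qed.

(** The imaginary part of a root has the sign of that of its radicand. With opposite signs, the real
    part [a * c - b * d] of the product of the roots stays positive. *)
Lemma Csqrt_mult_opposite (w L : C) : off_cut w -> off_cut L -> snd w * snd L <= 0 ->
  Csqrt (w * L) = (Csqrt w * Csqrt L)%C.
Proof.
  intros Hw HL Hs. apply Csqrt_unique.
  - transitivity ((Csqrt w * Csqrt w) * (Csqrt L * Csqrt L))%C; [ring|].
    now rewrite !Csqrt_sqr.
  - pose proof (Csqrt_fst_pos w Hw) as H1. pose proof (Csqrt_fst_pos L HL) as H2.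
    pose proof (Csqrt_sqr w) as S1. pose proof (Csqrt_sqr L) as S2.
    destruct (Csqrt w) as [a b], (Csqrt L) as [c d]. rewrite <- S1, <- S2 in Hs.
    simpl in *. assert (0 < a * c) by nra.
    assert (b * d * (a * c) <= 0) by nra. nra.
Qed.

(** * Absolutely convergent complex series *)

(** Taken componentwise, so that results on real series apply to each part; [abs_summable] is what
    makes both parts converge. *)
Definition CSeries (a : nat -> C) : C :=
  (Series (fun n => fst (a n)), Series (fun n => snd (a n))).

Definition abs_summable (a : nat -> C) : Prop := ex_series (fun n => Cmod (a n)).

Lemma ex_series_dom (a b : nat -> R) :
  (forall n, Rabs (a n) <= b n) -> ex_series b -> ex_series a.
Proof. intros H. apply (ex_series_le (V := R_CompleteNormedModule)). exact H. Qed.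

Lemma abs_summable_dom (a : nat -> C) (b : nat -> R) :
  (forall n, Cmod (a n) <= b n) -> ex_series b -> abs_summable a.
Proof.
  intros H. apply ex_series_dom. intros n.
  rewrite Rabs_right; [easy|]. apply Rle_ge, Cmod_ge_0.
Qed.

Lemma abs_summable_fst (a : nat -> C) : abs_summable a -> ex_series (fun n => fst (a n)).
Proof. apply ex_series_dom. intros n. apply Cmod_fst_le. Qed.

Lemma abs_summable_snd (a : nat -> C) : abs_summable a -> ex_series (fun n => snd (a n)).
Proof. apply ex_series_dom. intros n. apply Cmod_snd_le. Qed.

Lemma CSeries_ext (a b : nat -> C) : (forall n, a n = b n) -> CSeries a = CSeries b.
Proof. intros H. unfold CSeries. f_equal; apply Series_ext; intros n; now rewrite H. Qed.

Lemma CSeries_plus (a b : nat -> C) : abs_summable a -> abs_summable b ->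
  CSeries (fun n => a n + b n)%C = (CSeries a + CSeries b)%C.
Proof.
  intros Ha Hb. unfold CSeries, Cplus; simpl.
  f_equal; apply Series_plus; auto using abs_summable_fst, abs_summable_snd.
Qed.

Lemma CSeries_minus (a b : nat -> C) : abs_summable a -> abs_summable b ->
  CSeries (fun n => a n - b n)%C = (CSeries a - CSeries b)%C.
Proof.
  intros Ha Hb. unfold CSeries, Cminus, Cplus, Copp; simpl.
  f_equal; apply Series_minus; auto using abs_summable_fst, abs_summable_snd.
Qed.

Lemma abs_summable_plus (a b : nat -> C) : abs_summable a -> abs_summable b ->
  abs_summable (fun n => a n + b n)%C.
Proof.
  intros Ha Hb. apply abs_summable_dom with (fun n => Cmod (a n) + Cmod (b n)).
  - intros n. apply Cmod_triangle.
  - now apply (ex_series_plus (V := R_NormedModule)).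
Qed.

Lemma CSeries_scal (c : C) (a : nat -> C) : abs_summable a ->
  CSeries (fun n => c * a n)%C = (c * CSeries a)%C.
Proof.
  intros Ha. pose proof (abs_summable_fst a Ha) as H1.
  pose proof (abs_summable_snd a Ha) as H2. unfold CSeries, Cmult; simpl. f_equal.
  - rewrite <- !Series_scal_l. apply Series_minus;
      now apply (ex_series_scal_l (V := R_NormedModule)).
  - rewrite <- !Series_scal_l. apply Series_plus;
      now apply (ex_series_scal_l (V := R_NormedModule)).
Qed.

Lemma Series_zero : Series (fun _ => 0) = 0.
Proof.
  rewrite (Series_ext _ (fun _ => 0 * 0)) by (intros; ring). rewrite Series_scal_l. ring.
Qed.

(** Pairing the sum [z] with itself: [|z|^2] is the sum of the real parts of [conj z * a n], hence
    at most [|z|] times the sum of the moduli. *)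
Lemma Cmod_CSeries (a : nat -> C) : abs_summable a ->
  Cmod (CSeries a) <= Series (fun n => Cmod (a n)).
Proof.
  intros Ha. set (z := CSeries a).
  assert (H : Cmod z * Cmod z <= Cmod z * Series (fun n => Cmod (a n))).
  { rewrite Cmod_sqr. unfold z at 2 4. unfold CSeries; simpl.
    rewrite <- !Series_scal_l, <- Series_plus;
      try (apply (ex_series_scal_l (V := R_NormedModule));
           auto using abs_summable_fst, abs_summable_snd).
    apply Rle_trans with (1 := Rle_abs _).
    assert (D : forall n, Rabs (fst z * fst (a n) + snd z * snd (a n))
       <= Cmod z * Cmod (a n)).
    { intros n. rewrite <- Cmod_conj, <- Cmod_mult.
      eapply Rle_trans; [|apply Cmod_fst_le]. right. simpl. f_equal. ring. }
    assert (X : ex_series (fun n => Cmod z * Cmod (a n)))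
      by now apply (ex_series_scal_l (V := R_NormedModule)).
    eapply Rle_trans.
    - apply Series_Rabs, ex_series_dom with (2 := X).
      intros n. rewrite Rabs_Rabsolu. apply D.
    - apply Series_le; [|easy]. intros n. split; [apply Rabs_pos|apply D]. }
  destruct (Cmod_ge_0 z) as [Hz|Hz]; [nra|].
  rewrite <- Hz. apply Rle_trans with (Series (fun _ => 0)).
  - rewrite Series_zero. lra.
  - apply Series_le; [|easy]. intros n. split; [lra|apply Cmod_ge_0].
Qed.

(** Runs over the indices strictly below [n], whereas [sum_n] includes [n]. *)
Fixpoint csum (a : nat -> C) (n : nat) : C :=
  match n with O => 0%C | S k => (csum a k + a k)%C end.

Lemma abs_summable_shift (a : nat -> C) (n : nat) : abs_summable a ->
  abs_summable (fun k => a (n + k)%nat).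
Proof.
  intros H. apply (ex_series_incr_n (V := R_NormedModule) (fun k => Cmod (a k)) n) in H.
  exact H.
Qed.

Lemma CSeries_split (a : nat -> C) (n : nat) : abs_summable a ->
  CSeries a = (csum a n + CSeries (fun k => a (n + k)%nat))%C.
Proof.
  intros H. induction n as [|n IH]; simpl.
  - rewrite Cplus_0_l. easy.
  - rewrite IH, <- Cplus_assoc. f_equal.
    pose proof (abs_summable_shift a n H) as H'. unfold CSeries.
    rewrite (Series_incr_1 (fun k => fst (a (n + k)%nat)) (abs_summable_fst _ H')).
    rewrite (Series_incr_1 (fun k => snd (a (n + k)%nat)) (abs_summable_snd _ H')).
    rewrite Nat.add_0_r. unfold Cplus; simpl.
    f_equal; f_equal; apply Series_ext; intros k; now rewrite Nat.add_succ_r.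
Qed.

Lemma Series_split_csum_bound (a : nat -> C) (M : nat -> R) (n : nat) :
  (forall k, Cmod (a k) <= M k) -> ex_series M ->
  Cmod (CSeries a - csum a n)%C <= Series (fun k => M (n + k)%nat).
Proof.
  intros H HM. assert (Ha : abs_summable a) by now apply abs_summable_dom with M.
  rewrite (CSeries_split a n Ha).
  replace (csum a n + CSeries (fun k => a (n + k)%nat) - csum a n)%C with
    (CSeries (fun k => a (n + k)%nat)) by ring.
  eapply Rle_trans; [now apply Cmod_CSeries, abs_summable_shift|].
  apply Series_le.
  - intros k. split; [apply Cmod_ge_0|apply H].
  - now apply (ex_series_incr_n (V := R_NormedModule)).
Qed.

Lemma Series_tail_small (M : nat -> R) (eps : R) : ex_series M -> 0 < eps ->
  exists n, Rabs (Series (fun k => M (n + k)%nat)) < eps.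
Proof.
  intros HM He. pose proof (Series_correct M HM) as L.
  apply is_series_Reals in L. destruct (L eps He) as [N HN].
  exists (S N). specialize (HN N (le_n N)). unfold Rdist in HN.
  rewrite (Series_incr_n M (S N)) in HN by (lia || easy). simpl pred in HN.
  rewrite Rabs_minus_sym in HN.
  replace (sum_f_R0 M N + Series (fun k => M (S N + k)%nat) - sum_f_R0 M N)
    with (Series (fun k => M (S N + k)%nat)) in HN by ring. easy.
Qed.

(** * Limits along an arbitrary filter, for sequences and punctured neighbourhoods alike *)

Definition tends {T} (F : (T -> Prop) -> Prop) (f : T -> C) (l : C) : Prop :=
  forall eps, 0 < eps -> F (fun x => Cmod (f x - l) < eps).

Section Limits.
Context {T : Type} (F : (T -> Prop) -> Prop) {FF : Filter F}.

Lemma tends_const (c : C) : tends F (fun _ => c) c.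
Proof.
  intros eps He. apply filter_forall. intros _.
  replace (c - c)%C with (RtoC 0) by ring. now rewrite Cmod_0.
Qed.

Lemma tends_ext (f g : T -> C) (l : C) :
  F (fun x => f x = g x) -> tends F f l -> tends F g l.
Proof.
  intros E H eps He. specialize (H eps He). generalize (filter_and _ _ E H).
  apply filter_imp. intros x [-> Hx]. exact Hx.
Qed.

Lemma tends_plus (f g : T -> C) (a b : C) :
  tends F f a -> tends F g b -> tends F (fun x => f x + g x)%C (a + b)%C.
Proof.
  intros Hf Hg eps He. assert (He2 : 0 < eps / 2) by lra.
  generalize (filter_and _ _ (Hf _ He2) (Hg _ He2)).
  apply filter_imp. intros x [H1 H2].
  replace (f x + g x - (a + b))%C with ((f x - a) + (g x - b))%C by ring.
  eapply Rle_lt_trans; [apply Cmod_triangle|lra].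
Qed.

Lemma tends_mult (f g : T -> C) (a b : C) :
  tends F f a -> tends F g b -> tends F (fun x => f x * g x)%C (a * b)%C.
Proof.
  intros Hf Hg eps He.
  pose proof (Cmod_ge_0 a) as Ha. pose proof (Cmod_ge_0 b) as Hb.
  set (e := Rmin 1 (eps / (Cmod a + Cmod b + 1))).
  assert (Hq : 0 < eps / (Cmod a + Cmod b + 1)) by (apply Rdiv_lt_0_compat; lra).
  assert (He0 : 0 < e) by (apply Rmin_pos; lra).
  assert (He1 : e <= 1) by apply Rmin_l.
  assert (He2 : e * (Cmod a + Cmod b + 1) <= eps).
  { apply Rle_trans with (eps / (Cmod a + Cmod b + 1) * (Cmod a + Cmod b + 1)).
    - apply Rmult_le_compat_r; [lra|apply Rmin_r].
    - right. field. lra. }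
  generalize (filter_and _ _ (Hf e He0) (Hg e He0)).
  apply filter_imp. intros x [H1 H2].
  replace (f x * g x - a * b)%C with
    ((f x - a) * (g x - b) + (a * (g x - b) + (f x - a) * b))%C by ring.
  eapply Rle_lt_trans; [apply Cmod_triangle|].
  eapply Rle_lt_trans; [apply Rplus_le_compat_l, Cmod_triangle|].
  rewrite !Cmod_mult.
  pose proof (Cmod_ge_0 (f x - a)). pose proof (Cmod_ge_0 (g x - b)).
  generalize dependent (Cmod (f x - a)). generalize dependent (Cmod (g x - b)).
  intros v Hv Hv0 u Hu Hu0.
  assert (u * v < e * 1) by nra. nra.
Qed.

Lemma tends_opp (f : T -> C) (a : C) : tends F f a -> tends F (fun x => - f x)%C (- a)%C.
Proof.
  intros H eps He. generalize (H eps He). apply filter_imp. intros x Hx.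
  replace (- f x - - a)%C with (- (f x - a))%C by ring. now rewrite Cmod_opp.
Qed.

Lemma tends_minus (f g : T -> C) (a b : C) :
  tends F f a -> tends F g b -> tends F (fun x => f x - g x)%C (a - b)%C.
Proof. intros Hf Hg. apply tends_plus; [easy|]. now apply tends_opp. Qed.

Lemma tends_inv (f : T -> C) (a : C) : a <> 0%C ->
  tends F f a -> tends F (fun x => / f x)%C (/ a)%C.
Proof.
  intros Ha H eps He. assert (Ha' : 0 < Cmod a) by now apply Cmod_gt_0.
  set (e := Rmin (Cmod a / 2) (eps * (Cmod a * Cmod a) / 2)).
  assert (0 < Cmod a * Cmod a) by nra.
  assert (He0 : 0 < e) by (apply Rmin_pos; nra).
  generalize (H e He0). apply filter_imp. intros x Hx.
  assert (H1 : Cmod (f x - a) < Cmod a / 2)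
    by (eapply Rlt_le_trans; [apply Hx|apply Rmin_l]).
  assert (H2 : Cmod (f x - a) < eps * (Cmod a * Cmod a) / 2)
    by (eapply Rlt_le_trans; [apply Hx|apply Rmin_r]).
  assert (H3 : Cmod a / 2 < Cmod (f x)).
  { assert (Cmod a <= Cmod (f x) + Cmod (f x - a)); [|lra].
    rewrite <- (Cmod_opp (f x - a)).
    replace a with (f x + - (f x - a))%C at 1 by ring. apply Cmod_triangle. }
  assert (Hf : f x <> 0%C) by (apply Cmod_gt_0; lra).
  replace (/ f x - / a)%C with (- (f x - a) / (f x * a))%C by (field; auto).
  rewrite Cmod_div, Cmod_opp, Cmod_mult.
  2:{ intros E. apply (f_equal Cmod) in E. rewrite Cmod_mult, Cmod_0 in E. nra. }
  assert (Hp : 0 < Cmod (f x) * Cmod a) by nra.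
  apply Rmult_lt_reg_r with (1 := Hp).
  unfold Rdiv. rewrite Rmult_assoc, Rinv_l, Rmult_1_r by lra.
  assert (Cmod a * (Cmod a / 2) < Cmod (f x) * Cmod a) by nra.
  apply Rlt_trans with (1 := H2). nra.
Qed.

Lemma tends_csum (f : T -> nat -> C) (g : nat -> C) (n : nat) :
  (forall k, tends F (fun x => f x k) (g k)) ->
  tends F (fun x => csum (f x) n) (csum g n).
Proof.
  intros H. induction n as [|n IH]; simpl; [apply tends_const|].
  now apply tends_plus.
Qed.

End Limits.

Lemma tends_bound {T} (F : (T -> Prop) -> Prop) {FF : ProperFilter F}
  (f : T -> C) (l : C) (M : R) :
  F (fun x => Cmod (f x) <= M) -> tends F f l -> Cmod l <= M.
Proof.
  intros HM H. apply Rnot_lt_le. intros Hlt.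
  assert (HF : F (fun _ => False)).
  { assert (He : 0 < Cmod l - M) by lra. generalize (filter_and _ _ HM (H _ He)).
    apply filter_imp. intros x [H1 H2].
    assert (Cmod l <= Cmod (f x) + Cmod (f x - l)); [|lra].
    rewrite <- (Cmod_opp (f x - l)).
    replace l with (f x + - (f x - l))%C at 1 by ring. apply Cmod_triangle. }
  now destruct (filter_ex _ HF).
Qed.

(** Dominated convergence for series: the tails are small uniformly in [x], and the finite head
    converges termwise. It serves for partial sums, for termwise differentiation and for the sum
    over the sizes [k]. *)
Lemma Tannery {T} (F : (T -> Prop) -> Prop) {FF : ProperFilter F}
  (f : T -> nat -> C) (g : nat -> C) (M : nat -> R) :
  F (fun x => forall k, Cmod (f x k) <= M k) -> ex_series M ->
  (forall k, tends F (fun x => f x k) (g k)) ->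
  tends F (fun x => CSeries (f x)) (CSeries g).
Proof.
  intros Hd HM Hl eps He.
  assert (Hg : forall k, Cmod (g k) <= M k).
  { intros k. apply (tends_bound F (fun x => f x k)); [|easy].
    revert Hd. apply filter_imp. intros x H. apply H. }
  assert (He3 : 0 < eps / 3) by lra.
  destruct (Series_tail_small M _ HM He3) as [n Hn].
  generalize (filter_and _ _ Hd (tends_csum F f g n Hl _ He3)).
  apply filter_imp. intros x [Hx1 Hx2].
  pose proof (Series_split_csum_bound (f x) M n Hx1 HM) as B1.
  pose proof (Series_split_csum_bound g M n Hg HM) as B2.
  pose proof (Rle_abs (Series (fun k => M (n + k)%nat))).
  replace (CSeries (f x) - CSeries g)%C with
    ((CSeries (f x) - csum (f x) n) + ((csum (f x) n - csum g n) - (CSeries g - csum g n)))%C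
    by ring.
  eapply Rle_lt_trans; [apply Cmod_triangle|].
  eapply Rle_lt_trans; [apply Rplus_le_compat_l, Cmod_triangle|].
  rewrite Cmod_opp. lra.
Qed.

Lemma is_series_of_tends (a : nat -> C) (l : C) :
  tends eventually (csum a) l -> is_series (V := C_NormedModule) a l.
Proof.
  intros H. unfold is_series. apply filterlim_locally. intros eps.
  assert (E : forall n, sum_n (G := C_AbelianMonoid) a n = csum a (S n)).
  { intros n. induction n as [|n IH].
    - rewrite sum_O. simpl. now rewrite Cplus_0_l.
    - rewrite sum_Sn, IH. easy. }
  destruct (H eps (cond_pos eps)) as [N HN]. exists N. intros n Hn.
  apply C_NormedModule_mixin_compat1. rewrite E. apply HN. lia.
Qed.

(** A partial sum is the series of the truncated terms, so dominated convergence applies. *)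
Lemma tends_csum_CSeries (a : nat -> C) : abs_summable a ->
  tends eventually (csum a) (CSeries a).
Proof.
  intros Ha eps He.
  set (trunc := fun (n k : nat) => if lt_dec k n then a k else RtoC 0).
  assert (E : forall n, csum a n = CSeries (trunc n)).
  { intros n. rewrite (CSeries_split _ n).
    - rewrite (CSeries_ext (fun k => trunc n (n + k)%nat) (fun _ => 0%C)).
      + unfold CSeries; simpl. rewrite Series_zero.
        assert (Et : forall j, (j <= n)%nat -> csum (trunc n) j = csum a j).
        { induction j as [|j IH]; intros Hj; [easy|]. simpl. rewrite IH by lia.
          unfold trunc. now destruct (lt_dec j n); [|lia]. }
        rewrite Et by lia. symmetry. apply Cplus_0_r.
      + intros k. unfold trunc. now destruct (lt_dec (n + k) n); [lia|].
    - apply abs_summable_dom with (2 := Ha). intros k. unfold trunc.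
      destruct (lt_dec k n); [lra|]. rewrite Cmod_0. apply Cmod_ge_0. }
  assert (L : tends eventually (fun n => CSeries (trunc n)) (CSeries a)).
  { apply (Tannery _ _ _ (fun k => Cmod (a k))).
    - apply filter_forall. intros n k. unfold trunc.
      destruct (lt_dec k n); [lra|]. rewrite Cmod_0. apply Cmod_ge_0.
    - exact Ha.
    - intros k e He'. exists (S k). intros n Hn. unfold trunc.
      destruct (lt_dec k n); [|lia]. replace (a k - a k)%C with (RtoC 0) by ring.
      now rewrite Cmod_0. }
  generalize (L eps He). apply filter_imp. intros n. now rewrite E.
Qed.

(** The real and imaginary parts combine four Cauchy products of real series. *)
Lemma Cauchy_product (a b c : nat -> C) :
  abs_summable a -> abs_summable b ->
  (forall n, c n = csum (fun i => a i * b (n - i)%nat)%C (S n)) ->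
  CSeries c = (CSeries a * CSeries b)%C.
Proof.
  intros Ha Hb Hc.
  assert (Ef : forall f n, fst (csum f (S n)) = sum_f_R0 (fun i => fst (f i)) n).
  { intros f n. induction n as [|n IH]; [simpl; ring|].
    change (csum f (S (S n))) with (csum f (S n) + f (S n))%C.
    rewrite tech5, <- IH. easy. }
  assert (Es : forall f n, snd (csum f (S n)) = sum_f_R0 (fun i => snd (f i)) n).
  { intros f n. induction n as [|n IH]; [simpl; ring|].
    change (csum f (S (S n))) with (csum f (S n) + f (S n))%C.
    rewrite tech5, <- IH. easy. }
  assert (Rf : forall a, abs_summable a -> ex_series (fun n => Rabs (fst (a n)))).
  { intros x Hx. apply ex_series_dom with (2 := Hx). intros n. rewrite Rabs_Rabsolu.
    apply Cmod_fst_le. }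
  assert (Rs : forall a, abs_summable a -> ex_series (fun n => Rabs (snd (a n)))).
  { intros x Hx. apply ex_series_dom with (2 := Hx). intros n. rewrite Rabs_Rabsolu.
    apply Cmod_snd_le. }
  assert (P : forall u v, ex_series (fun n => Rabs (u n)) -> ex_series (fun n => Rabs (v n)) ->
    is_series (fun n => sum_f_R0 (fun k => u k * v (n - k)%nat) n) (Series u * Series v)).
  { intros u v Hu Hv. apply is_series_mult; try easy;
    apply Series_correct, ex_series_Rabs; easy. }
  unfold CSeries at 1. unfold Cmult, CSeries; simpl. f_equal.
  - apply is_series_unique.
    eapply is_series_ext; [|apply (is_series_minus (V := R_NormedModule));
      [apply P; apply Rf; [exact Ha|exact Hb]|apply P; apply Rs; [exact Ha|exact Hb]]].
    intros n. rewrite Hc, Ef. symmetry. apply minus_sum.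
  - apply is_series_unique.
    eapply is_series_ext; [|apply (is_series_plus (V := R_NormedModule));
      [apply P; [apply Rf, Ha|apply Rs, Hb]|apply P; [apply Rs, Ha|apply Rf, Hb]]].
    intros n. rewrite Hc, Es. symmetry. apply sum_plus.
Qed.

(** * Complex derivatives *)

Definition punctured (z0 : C) (P : C -> Prop) : Prop :=
  exists d, 0 < d /\ forall z, z <> z0 -> Cmod (z - z0) < d -> P z.

#[local] Instance punctured_filter (z0 : C) : ProperFilter (punctured z0).
Proof.
  constructor.
  - intros P [d [Hd H]]. exists (z0 + RtoC (d / 2))%C. apply H.
    + intros E. apply (f_equal fst) in E. simpl in E. lra.
    + replace (z0 + RtoC (d / 2) - z0)%C with (RtoC (d / 2)) by ring.
      rewrite Cmod_R, Rabs_right; lra.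
  - constructor.
    + exists 1. split; [lra|easy].
    + intros P Q [d [Hd H]] [d' [Hd' H']]. exists (Rmin d d').
      split; [now apply Rmin_pos|]. intros z Hz Hm. split.
      * apply H; [easy|]. eapply Rlt_le_trans; [exact Hm|apply Rmin_l].
      * apply H'; [easy|]. eapply Rlt_le_trans; [exact Hm|apply Rmin_r].
    + intros P Q HPQ [d [Hd H]]. exists d. split; [easy|]. auto.
Qed.

Definition cderiv (f : C -> C) (z0 l : C) : Prop :=
  tends (punctured z0) (fun z => (f z - f z0) / (z - z0))%C l.

Definition cdiff (f : C -> C) (z0 : C) : Prop := exists l, cderiv f z0 l.

Lemma Csub_neq_0 (z z0 : C) : z <> z0 -> (z - z0)%C <> 0%C.
Proof.
  intros H E. apply H. replace z with ((z - z0) + z0)%C by ring. rewrite E. ring.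
Qed.

Lemma tends_id (z0 : C) : tends (punctured z0) (fun z => z) z0.
Proof. intros eps He. exists eps. auto. Qed.

Lemma cdiff_tends (f : C -> C) (z0 : C) :
  cdiff f z0 -> tends (punctured z0) f (f z0).
Proof.
  intros [l H].
  apply tends_ext with (fun z => (f z - f z0) / (z - z0) * (z - z0) + f z0)%C;
    [typeclasses eauto| |].
  - exists 1. split; [lra|]. intros z Hz _. field. now apply Csub_neq_0.
  - assert (E : f z0 = (l * (z0 - z0) + f z0)%C) by ring.
    apply (eq_ind_r (tends _ _)) with (2 := E).
    apply tends_plus; [typeclasses eauto| |apply tends_const; typeclasses eauto].
    apply tends_mult; [typeclasses eauto|exact H|].
    apply tends_minus; [typeclasses eauto|apply tends_id|apply tends_const; typeclasses eauto].
Qed.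

Lemma cdiff_const (c z0 : C) : cdiff (fun _ => c) z0.
Proof.
  exists 0%C. eapply tends_ext; [typeclasses eauto| |apply tends_const; typeclasses eauto].
  exists 1. split; [lra|]. intros z Hz _. field. now apply Csub_neq_0.
Qed.

Lemma cdiff_id (z0 : C) : cdiff (fun z => z) z0.
Proof.
  exists 1%C. eapply tends_ext; [typeclasses eauto| |apply tends_const; typeclasses eauto].
  exists 1. split; [lra|]. intros z Hz _. field. now apply Csub_neq_0.
Qed.

Lemma cdiff_plus (f g : C -> C) (z0 : C) :
  cdiff f z0 -> cdiff g z0 -> cdiff (fun z => f z + g z)%C z0.
Proof.
  intros [l Hl] [l' Hl']. exists (l + l')%C.
  eapply tends_ext; [typeclasses eauto| |apply tends_plus; [typeclasses eauto|exact Hl|exact Hl']].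
  exists 1. split; [lra|]. intros z Hz _. simpl. field. now apply Csub_neq_0.
Qed.

Lemma cdiff_mult (f g : C -> C) (z0 : C) :
  cdiff f z0 -> cdiff g z0 -> cdiff (fun z => f z * g z)%C z0.
Proof.
  intros [l Hl] [l' Hl']. exists (l * g z0 + f z0 * l')%C.
  eapply tends_ext; [typeclasses eauto| |apply tends_plus; [typeclasses eauto|
     apply tends_mult; [typeclasses eauto|exact Hl|apply cdiff_tends; now exists l']|
     apply tends_mult; [typeclasses eauto|apply tends_const; typeclasses eauto|exact Hl']]].
  exists 1. split; [lra|]. intros z Hz _. simpl. field. now apply Csub_neq_0.
Qed.

Lemma cdiff_opp (f : C -> C) (z0 : C) : cdiff f z0 -> cdiff (fun z => - f z)%C z0.
Proof.
  intros [l Hl]. exists (- l)%C.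
  eapply tends_ext; [typeclasses eauto| |apply tends_opp; [typeclasses eauto|exact Hl]].
  exists 1. split; [lra|]. intros z Hz _. simpl. field. now apply Csub_neq_0.
Qed.

Lemma cdiff_minus (f g : C -> C) (z0 : C) :
  cdiff f z0 -> cdiff g z0 -> cdiff (fun z => f z - g z)%C z0.
Proof. intros Hf Hg. apply cdiff_plus; [easy|]. now apply cdiff_opp. Qed.

Lemma cdiff_pow (f : C -> C) (z0 : C) (n : nat) :
  cdiff f z0 -> cdiff (fun z => f z ^ n)%C z0.
Proof.
  intros H. induction n as [|n IH]; simpl; [apply cdiff_const|].
  now apply cdiff_mult.
Qed.

Lemma tends_neq_0 {T} (F : (T -> Prop) -> Prop) {FF : Filter F} (f : T -> C) (a : C) :
  a <> 0%C -> tends F f a -> F (fun x => f x <> 0%C).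
Proof.
  intros Ha H. generalize (H (Cmod a) (proj1 (Cmod_gt_0 a) Ha)). apply filter_imp.
  intros x Hx E. rewrite E in Hx. replace (0 - a)%C with (- a)%C in Hx by ring.
  rewrite Cmod_opp in Hx. lra.
Qed.

Lemma cdiff_inv (f : C -> C) (z0 : C) : f z0 <> 0%C ->
  cdiff f z0 -> cdiff (fun z => / f z)%C z0.
Proof.
  intros H0 H. pose proof (cdiff_tends f z0 H) as Hc. destruct H as [l Hl].
  exists (- l * (/ f z0 * / f z0))%C.
  eapply tends_ext; [typeclasses eauto| |apply tends_mult; [typeclasses eauto|
     apply tends_opp; [typeclasses eauto|exact Hl]|
     apply tends_mult; [typeclasses eauto|
       apply tends_inv; [typeclasses eauto|exact H0|exact Hc]|
       apply tends_const; typeclasses eauto]]].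
  generalize (filter_and _ _ (tends_neq_0 _ f _ H0 Hc)
    (ex_intro (fun d => 0 < d /\ forall z, z <> z0 -> Cmod (z - z0) < d -> z <> z0) 1
       (conj Rlt_0_1 (fun z Hz _ => Hz)) : punctured z0 (fun z => z <> z0))).
  apply filter_imp. intros z [Hz Hz0]. simpl. field. auto using Csub_neq_0.
Qed.

(** Rationalising the difference makes continuity and differentiability of the principal root a
    matter of algebra. The denominator stays away from 0 because real parts of roots are nonnegative
    and that of [Csqrt v] is positive. *)
Lemma Csqrt_sub (u v : C) : off_cut v ->
  (Csqrt u - Csqrt v = (u - v) / (Csqrt u + Csqrt v))%C /\
  (Csqrt u + Csqrt v <> 0)%C /\ fst (Csqrt v) <= Cmod (Csqrt u + Csqrt v).
Proof.
  intros Hv. pose proof (Csqrt_fst_pos v Hv). pose proof (Csqrt_fst_ge_0 u).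
  assert (H1 : fst (Csqrt v) <= Cmod (Csqrt u + Csqrt v)).
  { eapply Rle_trans; [|apply fst_le_Cmod]. simpl fst in *. lra. }
  assert (H2 : (Csqrt u + Csqrt v)%C <> 0%C) by (apply Cmod_gt_0; lra).
  repeat split; try easy.
  assert (E : (u - v = (Csqrt u - Csqrt v) * (Csqrt u + Csqrt v))%C).
  { transitivity (Csqrt u * Csqrt u - Csqrt v * Csqrt v)%C; [now rewrite !Csqrt_sqr|ring]. }
  rewrite E. field. exact H2.
Qed.

Lemma Csqrt_Lipschitz (u v : C) : off_cut v ->
  Cmod (Csqrt u - Csqrt v) <= Cmod (u - v) / fst (Csqrt v).
Proof.
  intros Hv. destruct (Csqrt_sub u v Hv) as [E [H1 H2]].
  pose proof (Csqrt_fst_pos v Hv). rewrite E, Cmod_div by easy.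
  apply Rmult_le_compat_l; [apply Cmod_ge_0|]. now apply Rinv_le_contravar.
Qed.

Lemma cdiff_Csqrt (f : C -> C) (z0 : C) : off_cut (f z0) ->
  cdiff f z0 -> cdiff (fun z => Csqrt (f z)) z0.
Proof.
  intros Hv H. pose proof (cdiff_tends f z0 H) as Hc. destruct H as [l Hl].
  pose proof (Csqrt_fst_pos _ Hv) as Hp.
  assert (Hs : tends (punctured z0) (fun z => Csqrt (f z)) (Csqrt (f z0))).
  { intros eps He. assert (He' : 0 < eps * fst (Csqrt (f z0))) by nra.
    generalize (Hc _ He').
    apply filter_imp. intros z Hz. eapply Rle_lt_trans; [now apply Csqrt_Lipschitz|].
    apply Rmult_lt_reg_r with (fst (Csqrt (f z0))); [easy|]. unfold Rdiv.
    rewrite Rmult_assoc, Rinv_l by lra. lra. }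
  exists (l * / (Csqrt (f z0) + Csqrt (f z0)))%C.
  eapply tends_ext; [typeclasses eauto| |apply tends_mult; [typeclasses eauto|exact Hl|
     apply tends_inv; [typeclasses eauto| |apply tends_plus; [typeclasses eauto|exact Hs|
        apply tends_const; typeclasses eauto]]]].
  - exists 1. split; [lra|]. intros z Hz _. simpl.
    destruct (Csqrt_sub (f z) (f z0) Hv) as [E [H1 _]]. rewrite E. field.
    auto using Csub_neq_0.
  - now apply (Csqrt_sub (f z0) (f z0)).
Qed.

(** Lipschitz constants of the terms dominate all their difference quotients, so [Tannery] in the
    punctured neighbourhood differentiates term by term. *)
Lemma cdiff_CSeries (g : nat -> C -> C) (z0 : C) (M : nat -> R) (d : R) : 0 < d ->
  (forall z, Cmod (z - z0) < d -> abs_summable (fun k => g k z)) ->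
  (forall k z, Cmod (z - z0) < d -> Cmod (g k z - g k z0) <= M k * Cmod (z - z0)) ->
  ex_series M -> (forall k, cdiff (g k) z0) ->
  cdiff (fun z => CSeries (fun k => g k z)) z0.
Proof.
  intros Hd Hs HL HM Hg.
  (* [cdiff] only asserts existence, so one derivative per term is chosen. *)
  set (l := fun k => proj1_sig (constructive_indefinite_description _ (Hg k))).
  assert (Hl : forall k, cderiv (g k) z0 (l k)).
  { intros k. unfold l. now destruct (constructive_indefinite_description _ (Hg k)). }
  exists (CSeries l).
  assert (H0 : Cmod (z0 - z0) < d).
  { replace (z0 - z0)%C with (RtoC 0) by ring. now rewrite Cmod_0. }
  apply tends_ext with (fun z => CSeries (fun k => (g k z - g k z0) / (z - z0))%C);
    [typeclasses eauto| |].
  - exists d. split; [easy|]. intros z Hz Hzd.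
    rewrite <- CSeries_minus by now apply Hs.
    rewrite (CSeries_ext _ (fun k => / (z - z0) * (g k z - g k z0))%C).
    2:{ intros k. unfold Cdiv. ring. }
    rewrite CSeries_scal; [unfold Cdiv; ring|].
    eapply abs_summable_dom with (fun k => M k * Cmod (z - z0)).
    + intros k. now apply HL.
    + now apply (ex_series_scal_r (Cmod (z - z0))).
  - apply (Tannery _ _ _ M); [|easy|exact Hl].
    exists d. split; [easy|]. intros z Hz Hzd k.
    pose proof (Csub_neq_0 _ _ Hz) as Hn. rewrite Cmod_div by easy.
    apply Cmod_gt_0 in Hn. apply Rmult_le_reg_r with (Cmod (z - z0)); [easy|].
    unfold Rdiv. rewrite Rmult_assoc, Rinv_l by lra. rewrite Rmult_1_r. now apply HL.
Qed.

Lemma cdiff_ex_derive (f : C -> C) (z0 : C) : cdiff f z0 ->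
  @ex_derive C_AbsRing C_NormedModule f z0.
Proof.
  intros [l H]. exists l. split.
  - apply (is_linear_scal_l (K := C_AbsRing) (V := C_NormedModule) l).
  - intros x Hx eps.
    apply (is_filter_lim_locally_unique (V := AbsRing_NormedModule C_AbsRing)) in Hx. subst x.
    destruct (H eps (cond_pos eps)) as [d [Hd Hz]].
    exists (mkposreal d Hd). intros z Hb.
    change (Cmod (z - z0) < d) in Hb.
    change (Cmod ((f z - f z0) - (z - z0) * l) <= eps * Cmod (z - z0)).
    destruct (Ceq_dec z z0) as [->|Hn].
    + replace ((f z0 - f z0) - (z0 - z0) * l)%C with (RtoC 0) by ring.
      replace (z0 - z0)%C with (RtoC 0) by ring. rewrite Cmod_0. lra.
    + specialize (Hz z Hn Hb). pose proof (Csub_neq_0 _ _ Hn) as Hs.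
      replace ((f z - f z0) - (z - z0) * l)%C with
        (((f z - f z0) / (z - z0) - l) * (z - z0))%C by (field; easy).
      rewrite Cmod_mult. apply Rmult_le_compat_r; [apply Cmod_ge_0|lra].
Qed.

(** * The two square roots on the slit disc *)

Definition slit_disc (m : nat) (z : C) : Prop :=
  Cmod z < / (2 * INR m) /\
  ~ (snd z = 0 /\ / (4 * INR m) <= fst z <= / (2 * INR m)).

Definition wz (m : nat) (z : C) : C := (1 - RtoC (4 * INR m) * z)%C.

Definition epsk (m k : nat) (z : C) : C := (RtoC (4 * INR m) * z ^ S (S k))%C.

Definition wk (m k : nat) (z : C) : C := (wz m z + epsk m k z)%C.

Definition sz (m : nat) (z : C) : C := Csqrt (wz m z).

Definition sk (m k : nat) (z : C) : C := Csqrt (wk m k z).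

Lemma INR_ge_1 (m : nat) : (1 <= m)%nat -> 1 <= INR m.
Proof. intros H. apply (le_INR 1 m H). Qed.

Lemma slit_disc_half (m : nat) (z : C) : (1 <= m)%nat -> slit_disc m z -> Cmod z < / 2.
Proof.
  intros Hm [H _]. pose proof (INR_ge_1 m Hm).
  eapply Rlt_le_trans; [exact H|]. apply Rinv_le_contravar; lra.
Qed.

Lemma slit_disc_small (m : nat) (z : C) : (1 <= m)%nat ->
  Cmod z < / (4 * INR m) -> slit_disc m z.
Proof.
  intros Hm H. pose proof (INR_ge_1 m Hm). split.
  - eapply Rlt_le_trans; [exact H|]. apply Rinv_le_contravar; lra.
  - intros [_ [H1 _]]. pose proof (fst_le_Cmod z). lra.
Qed.

Lemma slit_disc_real (m : nat) (z : C) : (1 <= m)%nat -> slit_disc m z ->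
  snd z = 0 -> 4 * INR m * fst z < 1.
Proof.
  intros Hm [H1 H2] Hz. pose proof (INR_ge_1 m Hm). pose proof (fst_le_Cmod z).
  apply Rmult_lt_reg_l with (/ (4 * INR m)); [apply Rinv_0_lt_compat; lra|].
  rewrite <- Rmult_assoc, Rinv_l, Rmult_1_l, Rmult_1_r by lra.
  apply Rnot_le_lt. intros Hle. apply H2. repeat split; lra.
Qed.

Lemma off_cut_wz (m : nat) (z : C) : (1 <= m)%nat -> slit_disc m z -> off_cut (wz m z).
Proof.
  intros Hm H. pose proof (INR_ge_1 m Hm). unfold off_cut, wz. simpl.
  destruct (Req_dec (snd z) 0) as [E|E].
  - left. pose proof (slit_disc_real m z Hm H E). rewrite E. lra.
  - right. nra.
Qed.

(** Induction on [Im (z v) = Re z Im v + Im z Re v]. *)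
Lemma snd_pow_bound (z : C) (n : nat) :
  Rabs (snd (z ^ S n)%C) <= INR (S n) * Cmod z ^ n * Rabs (snd z).
Proof.
  induction n as [|n IH].
  - right. rewrite Cpow_1_r. simpl. ring.
  - rewrite Cpow_S. change (snd (z * z ^ S n)%C) with
      (fst z * snd (z ^ S n)%C + snd z * fst (z ^ S n)%C).
    eapply Rle_trans; [apply Rabs_triang|]. rewrite !Rabs_mult.
    pose proof (Cmod_fst_le z) as H1. pose proof (Cmod_fst_le (z ^ S n)%C) as H2.
    rewrite Cmod_pow in H2. pose proof (Rabs_pos (snd z)). pose proof (Rabs_pos (fst z)).
    pose proof (Rabs_pos (snd (z ^ S n)%C)).
    replace (INR (S (S n)) * Cmod z ^ S n * Rabs (snd z)) with
      (Cmod z * (INR (S n) * Cmod z ^ n * Rabs (snd z)) + Rabs (snd z) * Cmod z ^ S n)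
      by (rewrite (S_INR (S n)); simpl pow; ring).
    apply Rplus_le_compat.
    + now apply Rmult_le_compat.
    + now apply Rmult_le_compat_l.
Qed.

(** The case [k = 0] is [2 r < 1], and each further step multiplies by [r (k + 3) / (k + 2) < 1].
    With [snd_pow_bound] it keeps [|Im z^(k+2)|] below [|Im z|] off the real axis. *)
Lemma pow_deriv_lt_1 (r : R) (k : nat) : 0 <= r < / 2 -> INR (S (S k)) * r ^ S k < 1.
Proof.
  intros Hr. induction k as [|k IH].
  - simpl. lra.
  - apply Rle_lt_trans with (2 := IH). rewrite !S_INR.
    change (r ^ S (S k)) with (r * r ^ S k).
    pose proof (pow_le r (S k) ltac:(lra)). pose proof (pos_INR k).
    rewrite <- Rmult_assoc. apply Rmult_le_compat_r; [easy|]. nra.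
Qed.

(** The imaginary parts are [- 4m] times [Im z] and times [Im z - Im z^(k+2)], and the subtracted
    part is too small to change the sign. *)
Lemma snd_wk_sign (m k : nat) (z : C) : (1 <= m)%nat -> slit_disc m z ->
  0 <= snd (wz m z) * snd (wk m k z) /\ (snd z <> 0 -> snd (wk m k z) <> 0).
Proof.
  intros Hm H. pose proof (INR_ge_1 m Hm).
  pose proof (snd_pow_bound z (S k)) as B1.
  pose proof (pow_deriv_lt_1 (Cmod z) k
    (conj (Cmod_ge_0 z) (slit_disc_half m z Hm H))) as B2.
  assert (E1 : snd (wz m z) = - (4 * INR m) * snd z) by (unfold wz; simpl; ring).
  assert (E2 : snd (wk m k z) = - (4 * INR m) * (snd z - snd (z ^ S (S k))%C)).
  { unfold wk. change (snd (wz m z + epsk m k z)%C) with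
      (snd (wz m z) + snd (epsk m k z)). rewrite E1. unfold epsk.
    change (snd (RtoC (4 * INR m) * z ^ S (S k))%C) with
      (4 * INR m * snd (z ^ S (S k))%C + 0 * fst (z ^ S (S k))%C). ring. }
  assert (B3 : Rabs (snd (z ^ S (S k))%C) <= Rabs (snd z)).
  { apply Rle_trans with (1 := B1). pose proof (Rabs_pos (snd z)). nra. }
  rewrite E1, E2. generalize dependent (snd (z ^ S (S k))%C). intros y B1 _ B3.
  split.
  - assert (0 <= snd z * (snd z - y)); [|nra].
    unfold Rabs in B3. destruct (Rcase_abs y), (Rcase_abs (snd z)); nra.
  - intros Hz. assert (0 < Rabs (snd z)) by now apply Rabs_pos_lt.
    assert (Rabs y < Rabs (snd z)) by nra.
    assert (snd z - y <> 0); [|nra]. intros E. replace y with (snd z) in * by lra. lra.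
Qed.

Lemma off_cut_wk (m k : nat) (z : C) : (1 <= m)%nat -> slit_disc m z ->
  off_cut (wk m k z).
Proof.
  intros Hm H. pose proof (INR_ge_1 m Hm).
  destruct (Req_dec (snd z) 0) as [E|E].
  - left. pose proof (slit_disc_real m z Hm H E) as Hx.
    pose proof (slit_disc_half m z Hm H) as Hh. pose proof (Cmod_fst_le z) as Hc.
    destruct z as [x y]. simpl fst in Hx, Hc. simpl snd in E. subst y.
    change (x, 0) with (RtoC x) in *.
    replace (wk m k (RtoC x)) with
      (RtoC (1 - 4 * INR m * x + 4 * INR m * (x * (x * x ^ k)))).
    2:{ unfold wk, wz, epsk. change (x * (x * x ^ k)) with (x ^ S (S k)).
        now rewrite RtoC_plus, RtoC_minus, (RtoC_mult _ x), (RtoC_mult _ (x ^ S (S k))),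
          RtoC_pow. }
    change (0 < 1 - 4 * INR m * x + 4 * INR m * (x * (x * x ^ k))).
    (* For [x >= 0] the added power is nonnegative. For [x < 0], [|x| < 1/2] gives
       [x^(k+2) >= - x^2 >= x], so the value is at least 1. *)
    destruct (Rle_dec 0 x) as [Hp|Hp].
    + pose proof (pow_le x k Hp). assert (0 <= x * (x * x ^ k)) by nra. nra.
    + assert (Hk : Rabs (x ^ k) <= 1).
      { rewrite <- RPow_abs. rewrite <- (pow1 k). apply pow_incr.
        split; [apply Rabs_pos|]. lra. }
      rewrite Rabs_left in Hc by lra.
      assert (-1 <= x ^ k) by (unfold Rabs in Hk; destruct (Rcase_abs (x ^ k)); lra).
      assert (0 <= x * x <= - x) by nra.
      assert (x * (x * x ^ k) >= x) by nra. nra.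
  - right. now apply (snd_wk_sign m k z Hm H).
Qed.

Lemma sz_fst_pos (m : nat) (z : C) : (1 <= m)%nat -> slit_disc m z -> 0 < fst (sz m z).
Proof. intros. now apply Csqrt_fst_pos, off_cut_wz. Qed.

Lemma sk_fst_pos (m k : nat) (z : C) : (1 <= m)%nat -> slit_disc m z ->
  0 < fst (sk m k z).
Proof. intros. now apply Csqrt_fst_pos, off_cut_wk. Qed.

Lemma sz_sqr (m : nat) (z : C) : (sz m z * sz m z)%C = wz m z.
Proof. apply Csqrt_sqr. Qed.

Lemma sk_sqr (m k : nat) (z : C) : (sk m k z * sk m k z)%C = wk m k z.
Proof. apply Csqrt_sqr. Qed.

(** The imaginary part of a square is twice the product of the two parts; real parts being positive,
    the signs pass from [wz] and [wk] to their roots. *)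
Lemma sk_sz_same_quadrant (m k : nat) (z : C) : (1 <= m)%nat -> slit_disc m z ->
  0 <= snd (sz m z) * snd (sk m k z).
Proof.
  intros Hm H. pose proof (sz_fst_pos m z Hm H) as H1.
  pose proof (sk_fst_pos m k z Hm H) as H2.
  destruct (snd_wk_sign m k z Hm H) as [H3 _].
  rewrite <- sz_sqr, <- sk_sqr in H3.
  destruct (sz m z) as [a b], (sk m k z) as [c d]. simpl in *.
  assert (0 < a * c) by nra.
  assert (0 <= b * d * (a * c)) by nra. nra.
Qed.

Lemma sz_plus_sk_bounds (m k : nat) (z : C) : (1 <= m)%nat -> slit_disc m z ->
  Cmod (sz m z) <= Cmod (sz m z + sk m k z) /\
  Cmod (epsk m k z) <= Cmod (sz m z + sk m k z) * Cmod (sz m z + sk m k z) /\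
  Cmod (sk m k z - sz m z) <= Cmod (sz m z + sk m k z) /\
  (sz m z + sk m k z <> 0)%C /\ fst (sz m z) <= Cmod (sz m z + sk m k z).
Proof.
  intros Hm H. pose proof (sz_fst_pos m z Hm H) as H1.
  pose proof (sk_fst_pos m k z Hm H) as H2.
  pose proof (sk_sz_same_quadrant m k z Hm H) as H3.
  destruct (Cmod_add_same_quadrant (sz m z) (sk m k z)) as [H4 H5]; try lra.
  assert (E : epsk m k z = ((sk m k z - sz m z) * (sz m z + sk m k z))%C).
  { transitivity (sk m k z * sk m k z - sz m z * sz m z)%C; [|ring].
    rewrite sk_sqr, sz_sqr. unfold wk. ring. }
  replace (sz m z - sk m k z)%C with (- (sk m k z - sz m z))%C in H4 by ring.
  rewrite Cmod_opp in H4.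
  assert (H6 : fst (sz m z) <= Cmod (sz m z + sk m k z)).
  { eapply Rle_trans; [|apply fst_le_Cmod].
    change (fst (sz m z + sk m k z)%C) with (fst (sz m z) + fst (sk m k z)). lra. }
  repeat split; try easy.
  - rewrite E, Cmod_mult. apply Rmult_le_compat_r; [apply Cmod_ge_0|easy].
  - apply Cmod_gt_0. lra.
Qed.

Lemma sz_neq_0 (m : nat) (z : C) : (1 <= m)%nat -> slit_disc m z -> sz m z <> 0%C.
Proof.
  intros Hm H E. pose proof (sz_fst_pos m z Hm H) as H1. rewrite E in H1. simpl in H1. lra.
Qed.

Lemma one_plus_sz (m : nat) (z : C) : 1 <= Cmod (1 + sz m z) /\ (1 + sz m z <> 0)%C.
Proof.
  pose proof (Csqrt_fst_ge_0 (wz m z)) as H. fold (sz m z) in H.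
  assert (1 <= Cmod (1 + sz m z)).
  { eapply Rle_trans; [|apply fst_le_Cmod].
    change (fst (1 + sz m z)%C) with (1 + fst (sz m z)). lra. }
  split; [easy|]. apply Cmod_gt_0. lra.
Qed.

(** * The analytic continuation and its Taylor series *)

Definition bcount (m k : nat) : R := INR (length (B m k)).

Definition gterm (m k : nat) (z : C) : C :=
  (RtoC (bcount m k) * z ^ k * epsk m k z /
   ((sz m z + sk m k z) * (sz m z + sk m k z)))%C.

Definition NB_fun (m : nat) (z : C) : C :=
  ((RtoC (4 * INR m) / ((1 + sz m z) * (1 + sz m z)) - CSeries (fun k => gterm m k z))
   / sz m z)%C.

Lemma bcount_bound (m k : nat) : 0 <= bcount m k <= (4 * INR m) ^ S k.
Proof.
  unfold bcount. split; [apply pos_INR|]. rewrite length_B_tcat.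
  pose proof (tcat_le_1 (S k)). pose proof (pos_INR m).
  pose proof (pow_le (4 * INR m) (S k) ltac:(lra)). nra.
Qed.

Lemma Cmod_epsk (m k : nat) (z : C) : Cmod (epsk m k z) = 4 * INR m * Cmod z ^ S (S k).
Proof.
  unfold epsk. rewrite Cmod_mult, Cmod_pow, Cmod_R, Rabs_right; [easy|].
  pose proof (pos_INR m). lra.
Qed.

Lemma Cmod_RtoC_nonneg (x : R) : 0 <= x -> Cmod (RtoC x) = x.
Proof. intros H. rewrite Cmod_R. now apply Rabs_right, Rle_ge. Qed.

Lemma Cmod_gterm (m k : nat) (z : C) : (1 <= m)%nat -> slit_disc m z ->
  Cmod (gterm m k z) = bcount m k * Cmod z ^ k * Cmod (epsk m k z) /
    (Cmod (sz m z + sk m k z) * Cmod (sz m z + sk m k z)).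
Proof.
  intros Hm H. destruct (sz_plus_sk_bounds m k z Hm H) as [_ [_ [_ [Hn _]]]].
  unfold gterm. rewrite Cmod_div, !Cmod_mult, Cmod_pow, Cmod_RtoC_nonneg.
  - easy.
  - apply bcount_bound.
  - intros E. apply (f_equal Cmod) in E. rewrite Cmod_mult, Cmod_0 in E.
    apply Cmod_gt_0 in Hn. nra.
Qed.

(** [4m r^2 < 1/m <= 1]; this is the ratio of the series of correction terms. *)
Lemma geom_ratio_lt_1 (m : nat) (r : R) : (1 <= m)%nat -> 0 <= r < / (2 * INR m) ->
  0 <= 4 * INR m * (r * r) < 1.
Proof.
  intros Hm [H1 H2]. pose proof (INR_ge_1 m Hm).
  assert (H3 : r * (2 * INR m) < 1).
  { apply Rmult_lt_reg_r with (/ (2 * INR m)); [apply Rinv_0_lt_compat; lra|].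
    rewrite Rmult_assoc, Rinv_r, Rmult_1_r, Rmult_1_l by lra. easy. }
  split; [nra|]. nra.
Qed.

Lemma bcount_pow_bound (m k : nat) (r : R) : 0 <= r ->
  bcount m k * r ^ k * (4 * INR m * r ^ S (S k)) <=
  (4 * INR m) * (4 * INR m) * (r * r) * (4 * INR m * (r * r)) ^ k.
Proof.
  intros Hr. destruct (bcount_bound m k) as [_ Hb]. pose proof (pos_INR m).
  pose proof (pow_le r k Hr). pose proof (pow_le r (S (S k)) Hr).
  apply Rle_trans with ((4 * INR m) ^ S k * r ^ k * (4 * INR m * r ^ S (S k))).
  - apply Rmult_le_compat_r; [nra|]. now apply Rmult_le_compat_r.
  - right. rewrite !Rpow_mult_distr. simpl. ring.
Qed.

(** The denominators are at least [(Re s)^2] in modulus, uniformly in [k], which leaves a geometric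
    series of ratio [4m |z|^2]. *)
Lemma abs_summable_gterm (m : nat) (z : C) : (1 <= m)%nat -> slit_disc m z ->
  abs_summable (fun k => gterm m k z).
Proof.
  intros Hm H.
  apply abs_summable_dom with (fun k => (4 * INR m) * (4 * INR m) * (Cmod z * Cmod z)
    / (fst (sz m z) * fst (sz m z)) * (4 * INR m * (Cmod z * Cmod z)) ^ k).
  - intros k. rewrite Cmod_gterm, Cmod_epsk by easy.
    pose proof (sz_fst_pos m z Hm H).
    destruct (sz_plus_sk_bounds m k z Hm H) as [_ [_ [_ [_ Hf]]]].
    apply Rle_trans with ((4 * INR m) * (4 * INR m) * (Cmod z * Cmod z) *
      (4 * INR m * (Cmod z * Cmod z)) ^ k * / (fst (sz m z) * fst (sz m z)));
      [|right; unfold Rdiv; ring].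
    apply Rmult_le_compat.
    + pose proof (pos_INR m). pose proof (Cmod_ge_0 z). destruct (bcount_bound m k).
      repeat apply Rmult_le_pos; try lra; now apply pow_le.
    + left. apply Rinv_0_lt_compat. nra.
    + apply bcount_pow_bound, Cmod_ge_0.
    + apply Rinv_le_contravar; nra.
  - apply (ex_series_scal_l (V := R_NormedModule)), ex_series_geom.
    destruct H as [H _].
    pose proof (geom_ratio_lt_1 m (Cmod z) Hm (conj (Cmod_ge_0 z) H)).
    rewrite Rabs_right; lra.
Qed.

Lemma CSeries_finite (a : nat -> C) (n : nat) : (forall k, (n <= k)%nat -> a k = 0%C) ->
  abs_summable a /\ CSeries a = csum a n.
Proof.
  intros H. assert (Ha : abs_summable a).
  { unfold abs_summable. apply (ex_series_incr_n (V := R_NormedModule) _ n).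
    apply (ex_series_ext (V := R_NormedModule) (fun _ => 0)).
    - intros k. rewrite H by lia. symmetry. apply Cmod_0.
    - exists 0. apply is_series_Reals. intros eps He. exists 0%nat. intros j _.
      rewrite sum_cte.
      unfold Rdist. rewrite Rmult_0_l, Rminus_0_r, Rabs_R0. easy. }
  split; [easy|]. rewrite (CSeries_split a n Ha).
  rewrite (CSeries_ext _ (fun _ => 0%C)) by (intros; apply H; lia).
  unfold CSeries; simpl. rewrite Series_zero. apply Cplus_0_r.
Qed.

(** * Generating functions for [|z| < 1/(4m)] *)

Definition genfun (x : nat -> nat) (z : C) : C :=
  CSeries (fun n => RtoC (INR (x n)) * z ^ n)%C.

Definition noccur (m k n : nat) : nat := (length (B m n) - navoid m k n)%nat.

Lemma noccur_le (m k n : nat) : (noccur m k n <= length (B m n))%nat.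
Proof. unfold noccur. lia. Qed.

Section SmallDisc.
Context (m : nat) (Hm : (1 <= m)%nat) (z : C) (Hz : Cmod z < / (4 * INR m)).

Lemma Cmod_z_4m : 4 * INR m * Cmod z < 1.
Proof.
  pose proof (INR_ge_1 m Hm).
  apply Rmult_lt_reg_l with (/ (4 * INR m)); [apply Rinv_0_lt_compat; lra|].
  rewrite <- Rmult_assoc, Rinv_l, Rmult_1_l, Rmult_1_r by lra. exact Hz.
Qed.

(** For [n >= 1], [b_(n-1) = (4m)^n tcat n], and [4m |z| < 1]. The bound is free of [z], so every
    such [1 + z A] has modulus at most 2 on the disc. *)
Lemma shift1_term_bound (x : nat -> nat) :
  (forall n, (x n <= length (B m n))%nat) ->
  forall n, Cmod (RtoC (INR (shift1 x n)) * z ^ n)%C <= tcat n.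
Proof.
  intros Hx n. rewrite Cmod_mult, Cmod_pow, Cmod_RtoC_nonneg by apply pos_INR.
  pose proof (Cmod_ge_0 z). pose proof (INR_ge_1 m Hm). pose proof Cmod_z_4m.
  assert (Hs : INR (shift1 x n) <= (4 * INR m) ^ n * tcat n).
  { destruct n as [|n]; [simpl; unfold tcat; simpl; lra|].
    rewrite <- length_B_tcat. apply le_INR, Hx. }
  apply Rle_trans with ((4 * INR m) ^ n * tcat n * Cmod z ^ n).
  - apply Rmult_le_compat_r; [now apply pow_le|easy].
  - replace ((4 * INR m) ^ n * tcat n * Cmod z ^ n) with ((4 * INR m * Cmod z) ^ n * tcat n)
      by (rewrite Rpow_mult_distr; ring).
    rewrite <- (Rmult_1_l (tcat n)) at 2.
    apply Rmult_le_compat_r; [left; apply tcat_pos|].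
    rewrite <- (pow1 n). apply pow_incr. split; [nra|lra].
Qed.

Lemma abs_summable_shift1 (x : nat -> nat) :
  (forall n, (x n <= length (B m n))%nat) ->
  abs_summable (fun n => RtoC (INR (shift1 x n)) * z ^ n)%C.
Proof.
  intros Hx. apply abs_summable_dom with tcat; [now apply shift1_term_bound|].
  exists 2. apply is_series_tcat.
Qed.

Lemma Cmod_genfun_shift1 (x : nat -> nat) :
  (forall n, (x n <= length (B m n))%nat) -> Cmod (genfun (shift1 x) z) <= 2.
Proof.
  intros Hx. unfold genfun. eapply Rle_trans; [now apply Cmod_CSeries, abs_summable_shift1|].
  rewrite <- (is_series_unique _ _ is_series_tcat). apply Series_le.
  - intros n. split; [apply Cmod_ge_0|now apply shift1_term_bound].
  - exists 2. apply is_series_tcat.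
Qed.

Lemma abs_summable_genfun (x : nat -> nat) :
  (forall n, (x n <= length (B m n))%nat) ->
  abs_summable (fun n => RtoC (INR (x n)) * z ^ n)%C.
Proof.
  intros Hx. apply abs_summable_dom with (fun n => (4 * INR m) * (4 * INR m * Cmod z) ^ n).
  - intros n. rewrite Cmod_mult, Cmod_pow, Cmod_RtoC_nonneg by apply pos_INR.
    destruct (bcount_bound m n) as [_ Hb]. unfold bcount in Hb.
    rewrite Rpow_mult_distr, <- Rmult_assoc.
    apply Rmult_le_compat_r; [apply pow_le, Cmod_ge_0|].
    apply Rle_trans with (2 := Hb). apply le_INR, Hx.
  - apply (ex_series_scal_l (V := R_NormedModule)), ex_series_geom.
    pose proof Cmod_z_4m. pose proof (Cmod_ge_0 z). pose proof (INR_ge_1 m Hm).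
    rewrite Rabs_right; [easy|nra].
Qed.

Lemma genfun_shift1 (x : nat -> nat) :
  (forall n, (x n <= length (B m n))%nat) ->
  genfun (shift1 x) z = (1 + z * genfun x z)%C.
Proof.
  intros Hx. unfold genfun.
  rewrite (CSeries_split _ 1 (abs_summable_shift1 x Hx)). simpl csum.
  rewrite (CSeries_ext _ (fun n => z * (RtoC (INR (x n)) * z ^ n))%C).
  2:{ intros n. simpl. ring. }
  rewrite CSeries_scal by now apply abs_summable_genfun. ring.
Qed.

(** The Cauchy product turns the convolution recurrence into the functional equation. *)
Lemma genfun_conv_rec (d x : nat -> nat) : conv_rec m d x ->
  (forall n, (x n <= length (B m n))%nat) ->
  abs_summable (fun n => RtoC (INR (d n)) * z ^ n)%C ->
  (genfun x z + genfun d z =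
   RtoC (INR m) * (genfun (shift1 x) z * genfun (shift1 x) z))%C.
Proof.
  intros Hr Hx Hd. unfold genfun at 3 4.
  set (c := fun n => csum (fun i => (RtoC (INR (shift1 x i)) * z ^ i) *
    (RtoC (INR (shift1 x (n - i))) * z ^ (n - i)))%C (S n)).
  rewrite <- (Cauchy_product _ _ c (abs_summable_shift1 x Hx) (abs_summable_shift1 x Hx))
    by easy.
  unfold genfun. rewrite <- CSeries_plus by (try exact Hd; now apply abs_summable_genfun).
  assert (E : forall n, (RtoC (INR (x n)) * z ^ n + RtoC (INR (d n)) * z ^ n)%C
    = (RtoC (INR m) * c n)%C).
  { intros n. rewrite <- Cmult_plus_distr_r, <- RtoC_plus, <- plus_INR, (Hr n), mult_INR.
    rewrite RtoC_mult, <- Cmult_assoc. f_equal. unfold c.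
    assert (G : forall j, (j <= S n)%nat ->
      (RtoC (INR (lsum (fun i => shift1 x i * shift1 x (n - i)) (seq 0 j))%nat) * z ^ n)%C =
      csum (fun i => (RtoC (INR (shift1 x i)) * z ^ i) *
        (RtoC (INR (shift1 x (n - i))) * z ^ (n - i)))%C j).
    { induction j as [|j IH]; intros Hj; [simpl; ring|].
      rewrite seq_S, lsum_app, plus_INR, RtoC_plus, Cmult_plus_distr_r, IH by lia.
      simpl csum. f_equal. simpl lsum. rewrite Nat.add_0_r, mult_INR, RtoC_mult.
      replace (z ^ n)%C with (z ^ j * z ^ (n - j))%C
        by (rewrite <- Cpow_add_r; f_equal; lia). ring. }
    now apply G. }
  rewrite (CSeries_ext _ _ E). apply CSeries_scal.
  (* Summability of [c] is inherited from the left-hand side, whose terms are [m] times those of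
     [c]. *)
  assert (Hs : abs_summable (fun n => RtoC (INR (x n)) * z ^ n + RtoC (INR (d n)) * z ^ n)%C)
    by (apply abs_summable_plus; [now apply abs_summable_genfun|easy]).
  apply abs_summable_dom with (fun n => / INR m *
    Cmod (RtoC (INR (x n)) * z ^ n + RtoC (INR (d n)) * z ^ n)%C).
  - intros n. rewrite E, Cmod_mult, Cmod_RtoC_nonneg by apply pos_INR.
    pose proof (INR_ge_1 m Hm). right. field. lra.
  - now apply (ex_series_scal_l (V := R_NormedModule)).
Qed.

(** Selects the branch: [|2m z Y| <= 4m |z| < 1] as soon as [|Y| <= 2]. *)
Lemma root_positive (Y : C) : Cmod Y <= 2 ->
  0 < fst (1 - RtoC (2 * INR m) * z * Y)%C.
Proof.
  intros HY. set (v := (RtoC (2 * INR m) * z * Y)%C).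
  change (0 < 1 - fst v). pose proof (fst_le_Cmod v). pose proof (INR_ge_1 m Hm).
  assert (Cmod v <= 4 * INR m * Cmod z).
  { unfold v. rewrite !Cmod_mult, Cmod_RtoC_nonneg by lra.
    pose proof (Cmod_ge_0 z). pose proof (Cmod_ge_0 Y).
    assert (0 <= INR m * Cmod z) by nra. nra. }
  pose proof Cmod_z_4m. lra.
Qed.

Lemma RtoC_4m : RtoC (4 * INR m) = (2 * RtoC (2 * INR m))%C.
Proof. rewrite <- RtoC_mult. f_equal. ring. Qed.

Lemma RtoC_2m : RtoC (2 * INR m) = (2 * RtoC (INR m))%C.
Proof. now rewrite RtoC_mult. Qed.

Notation gB := (genfun (fun n => length (B m n)) z).
Notation gT := (genfun (shift1 (fun n => length (B m n))) z).

Lemma gT_shift : gT = (1 + z * gB)%C.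
Proof. now apply genfun_shift1. Qed.

Lemma gB_quadratic : gB = (RtoC (INR m) * (gT * gT))%C.
Proof.
  rewrite <- (genfun_conv_rec (fun _ => 0%nat)); [|apply conv_rec_length_B|easy|].
  - unfold genfun at 3. rewrite (CSeries_ext _ (fun _ => 0%C)) by (intros; simpl; ring).
    replace (CSeries (fun _ => 0%C)) with (RtoC 0); [ring|].
    unfold CSeries. simpl. now rewrite Series_zero.
  - apply (CSeries_finite _ 0). intros. simpl. ring.
Qed.

(** Completing the square in [T = 1 + m z T^2] gives [(1 - 2m z T)^2 = 1 - 4m z], and
    [root_positive] identifies the root. *)
Lemma sz_gT : sz m z = (1 - RtoC (2 * INR m) * z * gT)%C.
Proof.
  apply Csqrt_unique; [|now apply root_positive, Cmod_genfun_shift1].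
  unfold wz. rewrite RtoC_4m, RtoC_2m.
  transitivity (1 - 4 * (RtoC (INR m) * z) * gT +
    4 * (RtoC (INR m) * z) * (z * (RtoC (INR m) * (gT * gT))))%C; [ring|].
  rewrite <- gB_quadratic, gT_shift. ring.
Qed.

(** Uses [T (1 + s) = 2] rather than [T = (1 - s) / (2m z)], which would exclude [z = 0]. *)
Lemma gB_sz : gB = (RtoC (4 * INR m) / ((1 + sz m z) * (1 + sz m z)))%C.
Proof.
  destruct (one_plus_sz m z) as [_ Hn].
  assert (E : (gT * (1 + sz m z) = 2)%C).
  { rewrite sz_gT, RtoC_2m. transitivity (2 * gT - 2 * z * (RtoC (INR m) * (gT * gT)))%C;
      [ring|]. rewrite <- gB_quadratic, gT_shift. ring. }
  rewrite gB_quadratic. replace gT with (2 / (1 + sz m z))%C.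
  - rewrite RtoC_4m, RtoC_2m. field. exact Hn.
  - rewrite <- E. field. exact Hn.
Qed.

Notation gA k := (genfun (navoid m k) z).
Notation gY k := (genfun (shift1 (navoid m k)) z).

Lemma gY_shift (k : nat) : gY k = (1 + z * gA k)%C.
Proof. apply genfun_shift1. intros n. apply navoid_le. Qed.

Lemma gA_quadratic (k : nat) : (gA k + z ^ k = RtoC (INR m) * (gY k * gY k))%C.
Proof.
  set (d := fun n => if Nat.eq_dec k n then 1%nat else 0%nat).
  assert (Hd : forall j, (S k <= j)%nat -> (RtoC (INR (d j)) * z ^ j)%C = 0%C).
  { intros j Hj. unfold d. destruct (Nat.eq_dec k j); [lia|]. simpl. ring. }
  destruct (CSeries_finite _ (S k) Hd) as [Sd Ed].
  rewrite <- (genfun_conv_rec d); [|now apply conv_rec_navoid|intros; apply navoid_le|easy].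
  f_equal. unfold genfun. rewrite Ed.
  assert (G : forall j, (j <= k)%nat -> csum (fun n => RtoC (INR (d n)) * z ^ n)%C j = 0%C).
  { induction j as [|j IH]; intros Hj; [easy|]. simpl. rewrite IH by lia.
    unfold d. destruct (Nat.eq_dec k j); [lia|]. simpl. ring. }
  simpl csum. rewrite G by lia. unfold d. destruct (Nat.eq_dec k k); [|easy].
  simpl. ring.
Qed.

(** The square is completed as for [sz_gT]; the extra [- z^k] in the equation for [A] becomes
    [4m z^(k+2)] in the discriminant. *)
Lemma sk_gY (k : nat) : sk m k z = (1 - RtoC (2 * INR m) * z * gY k)%C.
Proof.
  apply Csqrt_unique; [|apply root_positive, Cmod_genfun_shift1; intros; apply navoid_le].
  unfold wk, wz, epsk. rewrite RtoC_4m, RtoC_2m.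
  transitivity (1 - 4 * (RtoC (INR m) * z) * gY k +
    4 * (RtoC (INR m) * z) * (z * (RtoC (INR m) * (gY k * gY k))))%C; [ring|].
  rewrite <- gA_quadratic, gY_shift. rewrite !Cpow_S. ring.
Qed.

Lemma genfun_noccur_diff (k : nat) : genfun (noccur m k) z = (gB - gA k)%C.
Proof.
  unfold genfun. rewrite <- CSeries_minus.
  - apply CSeries_ext. intros n. unfold noccur.
    rewrite minus_INR by apply navoid_le. rewrite RtoC_minus. ring.
  - now apply abs_summable_genfun.
  - apply abs_summable_genfun. intros; apply navoid_le.
Qed.

(** Subtracting the two quadratic equations and factoring [T^2 - Y^2], where [T - Y = z (B - A)],
    makes the difference [B - A] satisfy a linear equation. *)
Lemma genfun_noccur_rec (k : nat) :
  (genfun (noccur m k) z * (1 - RtoC (INR m) * z * (gT + gY k)) = z ^ k)%C.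
Proof.
  assert (E : (z ^ k = RtoC (INR m) * (gY k * gY k) - gA k)%C)
    by (rewrite <- gA_quadratic; ring).
  rewrite E, genfun_noccur_diff.
  transitivity ((gB - gA k) - RtoC (INR m) * (z * gB - z * gA k) * (gT + gY k))%C; [ring|].
  replace (z * gB)%C with (gT - 1)%C by (rewrite gT_shift; ring).
  replace (z * gA k)%C with (gY k - 1)%C by (rewrite gY_shift; ring).
  transitivity (gB - RtoC (INR m) * (gT * gT) + (RtoC (INR m) * (gY k * gY k) - gA k))%C;
    [ring|].
  rewrite <- gB_quadratic. ring.
Qed.

Lemma genfun_noccur (k : nat) :
  genfun (noccur m k) z = (2 * z ^ k / (sz m z + sk m k z))%C.
Proof.
  destruct (sz_plus_sk_bounds m k z Hm (slit_disc_small m z Hm Hz)) as [_ [_ [_ [Hn _]]]].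
  rewrite <- (genfun_noccur_rec k).
  replace (1 - RtoC (INR m) * z * (gT + gY k))%C with ((sz m z + sk m k z) / 2)%C.
  - field. exact Hn.
  - rewrite sz_gT, sk_gY, RtoC_2m. field.
Qed.

(** [|T|, |Y| <= 2] bounds the linear factor below by [1 - 4m |z|], independently of [k]; this is
    the domination used in the sum over [k]. *)
Lemma Cmod_genfun_noccur (k : nat) :
  Cmod (genfun (noccur m k) z) <= / (1 - 4 * INR m * Cmod z) * Cmod z ^ k.
Proof.
  pose proof Cmod_z_4m as H4. pose proof (INR_ge_1 m Hm) as H1.
  pose proof (genfun_noccur_rec k) as E. apply (f_equal Cmod) in E.
  rewrite Cmod_mult, Cmod_pow in E. rewrite <- E.
  set (v := (1 - RtoC (INR m) * z * (gT + gY k))%C) in *.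
  assert (Hv : 1 - 4 * INR m * Cmod z <= Cmod v).
  { assert (T1 : Cmod gT <= 2) by now apply Cmod_genfun_shift1.
    assert (T2 : Cmod (gY k) <= 2)
      by (apply Cmod_genfun_shift1; intros; apply navoid_le).
    pose proof (Cmod_triangle gT (gY k)) as T3.
    assert (T4 : 1 <= Cmod v + Cmod (RtoC (INR m) * z * (gT + gY k))).
    { rewrite <- Cmod_1. replace (RtoC 1) with (v + RtoC (INR m) * z * (gT + gY k))%C at 1
        by (unfold v; ring). apply Cmod_triangle. }
    rewrite !Cmod_mult, Cmod_RtoC_nonneg in T4 by lra.
    pose proof (Cmod_ge_0 z). pose proof (Cmod_ge_0 (gT + gY k)).
    assert (INR m * Cmod z * Cmod (gT + gY k) <= INR m * Cmod z * 4)
      by (apply Rmult_le_compat_l; nra). lra. }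
  pose proof (Cmod_ge_0 (genfun (noccur m k) z)).
  apply Rmult_le_reg_l with (1 - 4 * INR m * Cmod z); [lra|].
  rewrite <- Rmult_assoc, Rinv_r by lra. nra.
Qed.

End SmallDisc.

(** * Exchange of the sums over the tree size [n] and the subtree size [k] *)

Lemma Cmod_csum_le (a : nat -> C) (n : nat) : abs_summable a ->
  Cmod (csum a n) <= Series (fun k => Cmod (a k)).
Proof.
  intros Ha.
  assert (H : forall n, Cmod (csum a n) + Series (fun k => Cmod (a (n + k)%nat))
    <= Series (fun k => Cmod (a k))).
  { clear n. induction n as [|n IH].
    - simpl. rewrite Cmod_0. lra.
    - eapply Rle_trans; [|exact IH]. simpl csum.
      pose proof (abs_summable_shift a n Ha) as Hs. unfold abs_summable in Hs.
      rewrite (Series_incr_1 (fun k => Cmod (a (n + k)%nat)) Hs), Nat.add_0_r.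
      rewrite (Series_ext (fun k => Cmod (a (S n + k)%nat)) (fun k => Cmod (a (n + S k)%nat)))
        by (intros k; now rewrite Nat.add_succ_r).
      pose proof (Cmod_triangle (csum a n) (a n)). lra. }
  specialize (H n).
  assert (0 <= Series (fun k => Cmod (a (n + k)%nat))); [|lra].
  rewrite <- Series_zero. apply Series_le.
  - intros k. split; [lra|apply Cmod_ge_0].
  - now apply abs_summable_shift.
Qed.

Lemma noccur_lt (m k n : nat) : (1 <= m)%nat -> (n < k)%nat -> noccur m k n = 0%nat.
Proof. intros Hm H. unfold noccur. rewrite navoid_lt by easy. lia. Qed.

(** Since [noccur m k n] vanishes for [n < k], each series over [k] here is a finite sum, and
    extending the range to all [k] changes nothing. *)
Lemma csum_NB_coeff (m : nat) (z : C) (N : nat) : (1 <= m)%nat ->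
  csum (fun n => RtoC (INR (NB_coeff m n)) * z ^ n)%C N =
  CSeries (fun k => RtoC (bcount m k) * csum (fun n => RtoC (INR (noccur m k n)) * z ^ n) N)%C.
Proof.
  intros Hm.
  assert (Z : forall N k, (N <= k)%nat ->
    csum (fun n => RtoC (INR (noccur m k n)) * z ^ n)%C N = 0%C).
  { clear N. induction N as [|N IH]; intros k Hk; [easy|]. simpl.
    rewrite IH, noccur_lt by lia. simpl. ring. }
  induction N as [|N IH].
  - destruct (CSeries_finite (fun k => RtoC (bcount m k) *
      csum (fun n => RtoC (INR (noccur m k n)) * z ^ n) 0)%C 0) as [_ E].
    + intros k _. simpl. ring.
    + now rewrite E.
  - simpl csum. rewrite IH.
    rewrite (CSeries_ext (fun k => RtoC (bcount m k) *
      (csum (fun n => RtoC (INR (noccur m k n)) * z ^ n) N +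
       RtoC (INR (noccur m k N)) * z ^ N))%C
      (fun k => RtoC (bcount m k) * csum (fun n => RtoC (INR (noccur m k n)) * z ^ n) N +
       RtoC (bcount m k) * (RtoC (INR (noccur m k N)) * z ^ N))%C) by (intros; ring).
    destruct (CSeries_finite (fun k => RtoC (bcount m k) *
      (RtoC (INR (noccur m k N)) * z ^ N))%C (S N)) as [S2 E2].
    { intros k Hk. rewrite noccur_lt by lia. simpl. ring. }
    rewrite CSeries_plus; [|apply (CSeries_finite _ N)|easy].
    2:{ intros k Hk. rewrite Z by easy. ring. }
    f_equal. rewrite E2, NB_coeff_sum. clear. fold (noccur m).
    assert (G : forall j, csum (fun k => RtoC (bcount m k) *
      (RtoC (INR (noccur m k N)) * z ^ N))%C j =
      (RtoC (INR (lsum (fun k => length (B m k) * noccur m k N)%nat (seq 0 j))) * z ^ N)%C).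
    { induction j as [|j IH]; [simpl; ring|].
      rewrite seq_S, lsum_app, plus_INR, RtoC_plus. simpl csum. rewrite IH.
      simpl lsum. rewrite Nat.add_0_r, mult_INR, RtoC_mult. unfold bcount. ring. }
    symmetry. apply G.
Qed.

(* The partial sums of the series are themselves series over the size [k] of the
   subtree, dominated uniformly, so the limit may be taken termwise. *)
Lemma tends_csum_NB (m : nat) (z : C) : (1 <= m)%nat -> Cmod z < / (4 * INR m) ->
  tends eventually (csum (fun n => RtoC (INR (NB_coeff m n)) * z ^ n)%C)
    (CSeries (fun k => RtoC (bcount m k) * genfun (noccur m k) z)%C).
Proof.
  intros Hm Hz. pose proof (Cmod_z_4m m Hm z Hz) as H4. pose proof (INR_ge_1 m Hm).
  pose proof (Cmod_ge_0 z).
  apply tends_ext with (fun N => CSeries (fun k => RtoC (bcount m k) *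
    csum (fun n => RtoC (INR (noccur m k n)) * z ^ n) N)%C); [typeclasses eauto| |].
  { apply filter_forall. intros N. symmetry. now apply csum_NB_coeff. }
  apply (Tannery _ _ _ (fun k => bcount m k *
    (/ (1 - 4 * INR m * Cmod z) * Cmod z ^ k))).
  - apply filter_forall. intros N k. rewrite Cmod_mult.
    rewrite Cmod_RtoC_nonneg by apply bcount_bound.
    apply Rmult_le_compat_l; [apply bcount_bound|].
    eapply Rle_trans; [apply Cmod_csum_le, (abs_summable_genfun m Hm z Hz), noccur_le|].
    (* The coefficients are nonnegative, so the sum of the moduli is the generating function at the
       real point [|z|], where [Cmod_genfun_noccur] applies. *)
    assert (Hr : Cmod (RtoC (Cmod z)) = Cmod z) by now apply Cmod_RtoC_nonneg.
    assert (Hz' : Cmod (RtoC (Cmod z)) < / (4 * INR m)) by now rewrite Hr.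
    pose proof (Cmod_genfun_noccur m Hm _ Hz' k) as Hb. rewrite Hr in Hb.
    eapply Rle_trans; [|exact Hb]. eapply Rle_trans; [|apply fst_le_Cmod].
    change (fst (genfun (noccur m k) (RtoC (Cmod z)))) with
      (Series (fun n => fst (RtoC (INR (noccur m k n)) * RtoC (Cmod z) ^ n)%C)).
    right. apply Series_ext. intros n.
    rewrite <- RtoC_pow, <- RtoC_mult. rewrite Cmod_mult, Cmod_pow.
    rewrite Cmod_RtoC_nonneg by apply pos_INR. easy.
  - apply ex_series_dom with (fun k => 4 * INR m * / (1 - 4 * INR m * Cmod z) *
      (4 * INR m * Cmod z) ^ k).
    + intros k. destruct (bcount_bound m k) as [B0 B1].
      pose proof (pow_le (Cmod z) k ltac:(easy)).
      assert (0 < / (1 - 4 * INR m * Cmod z)) by (apply Rinv_0_lt_compat; lra).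
      rewrite Rabs_right by (apply Rle_ge; apply Rmult_le_pos; nra).
      eapply Rle_trans; [apply Rmult_le_compat_r; [nra|exact B1]|].
      right. rewrite (Rpow_mult_distr (4 * INR m) (Cmod z)), <- tech_pow_Rmult. ring.
    + apply (ex_series_scal_l (V := R_NormedModule)), ex_series_geom.
      rewrite Rabs_right; [easy|nra].
  - intros k. apply tends_mult; [typeclasses eauto|apply tends_const; typeclasses eauto|].
    unfold genfun. apply tends_csum_CSeries, (abs_summable_genfun m Hm z Hz), noccur_le.
Qed.

Lemma NB_fun_eq (m : nat) (z : C) : (1 <= m)%nat -> Cmod z < / (4 * INR m) ->
  CSeries (fun k => RtoC (bcount m k) * genfun (noccur m k) z)%C = NB_fun m z.
Proof.
  intros Hm Hz. pose proof (slit_disc_small m z Hm Hz) as HD.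
  pose proof (sz_neq_0 m z Hm HD) as Hs.
  assert (Sb : abs_summable (fun k => RtoC (bcount m k) * z ^ k)%C)
    by now apply (abs_summable_genfun m Hm z Hz (fun n => length (B m n))).
  rewrite (CSeries_ext _ (fun k => / sz m z * (RtoC (bcount m k) * z ^ k - gterm m k z))%C).
  - rewrite CSeries_scal, CSeries_minus; try easy.
    + unfold NB_fun. rewrite <- (gB_sz m Hm z Hz). unfold genfun.
      change (fun n => RtoC (INR (length (B m n))) * z ^ n)%C with
        (fun k => RtoC (bcount m k) * z ^ k)%C. field. exact Hs.
    + now apply abs_summable_gterm.
    + apply abs_summable_plus; [easy|].
      apply abs_summable_dom with (2 := abs_summable_gterm m z Hm HD).
      intros k. rewrite Cmod_opp. lra.
  - intros k. rewrite (genfun_noccur m Hm z Hz).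
    destruct (sz_plus_sk_bounds m k z Hm HD) as [_ [_ [_ [Hn _]]]].
    unfold gterm.
    replace (epsk m k z) with (sk m k z * sk m k z - sz m z * sz m z)%C.
    + field. auto.
    + rewrite sk_sqr, sz_sqr. unfold wk. ring.
Qed.

Lemma NB_fun_pseries (m : nat) (z : C) : (1 <= m)%nat -> Cmod z < / (4 * INR m) ->
  @is_pseries C_AbsRing C_NormedModule
    (fun n => RtoC (INR (NB_coeff m n))) z (NB_fun m z).
Proof.
  intros Hm Hz. unfold is_pseries.
  apply (is_series_ext (V := C_NormedModule)
    (fun n => RtoC (INR (NB_coeff m n)) * z ^ n)%C).
  - assert (P : forall n, pow_n (K := C_AbsRing) z n = (z ^ n)%C).
    { induction n as [|n IH]; [easy|]. simpl. now rewrite IH. }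
    intros n.
    change ((RtoC (INR (NB_coeff m n)) * z ^ n)%C =
      (pow_n (K := C_AbsRing) z n * RtoC (INR (NB_coeff m n)))%C).
    rewrite Cmult_comm. apply (f_equal (fun x => Cmult x _)). symmetry. apply P.
  - apply is_series_of_tends. rewrite <- NB_fun_eq by easy. now apply tends_csum_NB.
Qed.

(** * Holomorphy on the slit disc *)

Lemma slit_disc_open (m : nat) (z0 : C) : (1 <= m)%nat -> slit_disc m z0 ->
  exists d, 0 < d /\ forall z, Cmod (z - z0) < d -> slit_disc m z.
Proof.
  intros Hm H. pose proof (INR_ge_1 m Hm) as H1. destruct (H) as [Ha Hb].
  assert (T : forall z, Cmod z <= Cmod z0 + Cmod (z - z0)).
  { intros z. replace z with (z0 + (z - z0))%C at 1 by ring. apply Cmod_triangle. }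
  destruct (Req_dec (snd z0) 0) as [E|E].
  - pose proof (slit_disc_real m z0 Hm H E) as Hr.
    assert (Hr' : fst z0 < / (4 * INR m)).
    { apply Rmult_lt_reg_l with (4 * INR m); [lra|]. rewrite Rinv_r; lra. }
    exists (Rmin (/ (2 * INR m) - Cmod z0) (/ (4 * INR m) - fst z0)).
    split; [apply Rmin_pos; lra|]. intros z Hz.
    assert (Z1 := Rlt_le_trans _ _ _ Hz (Rmin_l _ _)).
    assert (Z2 := Rlt_le_trans _ _ _ Hz (Rmin_r _ _)).
    split; [specialize (T z); lra|]. intros [_ [Hc _]].
    pose proof (fst_le_Cmod (z - z0)) as Hf.
    change (fst (z - z0)%C) with (fst z - fst z0) in Hf. lra.
  - exists (Rmin (/ (2 * INR m) - Cmod z0) (Rabs (snd z0))).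
    split; [apply Rmin_pos; [lra|now apply Rabs_pos_lt]|]. intros z Hz.
    assert (Z1 := Rlt_le_trans _ _ _ Hz (Rmin_l _ _)).
    assert (Z2 := Rlt_le_trans _ _ _ Hz (Rmin_r _ _)).
    split; [specialize (T z); lra|]. intros [Hc _].
    pose proof (Cmod_snd_le (z - z0)) as Hf.
    change (snd (z - z0)%C) with (snd z - snd z0) in Hf.
    rewrite Hc, Rminus_0_l, Rabs_Ropp in Hf. lra.
Qed.

Lemma Cpow_Lipschitz (r : R) (z w : C) (n : nat) : Cmod z <= r -> Cmod w <= r ->
  Cmod (z ^ S n - w ^ S n) <= INR (S n) * r ^ n * Cmod (z - w).
Proof.
  intros Hz Hw. pose proof (Cmod_ge_0 z). pose proof (Cmod_ge_0 w).
  pose proof (Cmod_ge_0 (z - w)).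
  induction n as [|n IH].
  - rewrite !Cpow_1_r. simpl. lra.
  - rewrite (Cpow_S z), (Cpow_S w).
    replace (z * z ^ S n - w * w ^ S n)%C with
      (z * (z ^ S n - w ^ S n) + (z - w) * w ^ S n)%C by ring.
    eapply Rle_trans; [apply Cmod_triangle|]. rewrite !Cmod_mult, Cmod_pow.
    replace (INR (S (S n)) * r ^ S n * Cmod (z - w)) with
      (r * (INR (S n) * r ^ n * Cmod (z - w)) + Cmod (z - w) * r ^ S n)
      by (rewrite (S_INR (S n)); simpl pow; ring).
    apply Rplus_le_compat.
    + apply Rmult_le_compat; auto using Cmod_ge_0.
    + apply Rmult_le_compat_l; [easy|]. apply pow_incr. lra.
Qed.

Lemma positive_min (f : nat -> R) (K : nat) : (forall k, 0 < f k) ->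
  exists c, 0 < c /\ forall k, (k < K)%nat -> c <= f k.
Proof.
  intros H. induction K as [|K [c [Hc Hk]]].
  - exists 1. split; [lra|lia].
  - exists (Rmin c (f K)). split; [now apply Rmin_pos|]. intros k Hlt.
    destruct (Nat.eq_dec k K) as [->|Hn]; [apply Rmin_r|].
    eapply Rle_trans; [apply Rmin_l|]. apply Hk. lia.
Qed.

(** [s_k] tends to [s], so from some index on [Re s_k >= Re s / 2]; the finitely many others have a
    positive minimum. *)
Lemma sk_fst_lower (m : nat) (z : C) : (1 <= m)%nat -> slit_disc m z ->
  exists c, 0 < c /\ forall k, c <= fst (sk m k z).
Proof.
  intros Hm H. pose proof (INR_ge_1 m Hm) as H1.
  pose proof (sz_fst_pos m z Hm H) as Hs. set (a := fst (sz m z)) in *.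
  pose proof (slit_disc_half m z Hm H) as Hh. pose proof (Cmod_ge_0 z) as H0.
  (* The threshold makes [|s_k - s| <= 4m |z|^(k+2) / a] at most [a / 2]. *)
  destruct (pow_lt_1_zero (Cmod z)) with (y := a * a / (8 * INR m)) as [K HK].
  - rewrite Rabs_right; lra.
  - apply Rdiv_lt_0_compat; nra.
  - destruct (positive_min (fun k => fst (sk m k z)) K) as [c [Hc Hk]].
    { intros k. now apply sk_fst_pos. }
    exists (Rmin c (a / 2)). split; [apply Rmin_pos; lra|]. intros k.
    destruct (lt_dec k K) as [Hlt|Hge].
    { eapply Rle_trans; [apply Rmin_l|auto]. }
    eapply Rle_trans; [apply Rmin_r|].
    specialize (HK (S (S k)) ltac:(lia)). rewrite <- RPow_abs in HK.
    rewrite Rabs_right in HK by lra.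
    pose proof (Csqrt_Lipschitz (wk m k z) (wz m z) (off_cut_wz m z Hm H)) as L.
    fold (sk m k z) (sz m z) a in L. unfold wk in L.
    replace (wz m z + epsk m k z - wz m z)%C with (epsk m k z) in L by ring.
    rewrite Cmod_epsk in L. set (p := Cmod z ^ S (S k)) in *.
    assert (L2 : 4 * INR m * p / a <= a / 2).
    { apply Rmult_le_reg_r with a; [easy|]. unfold Rdiv at 1.
      rewrite Rmult_assoc, Rinv_l, Rmult_1_r by lra.
      assert (p * (8 * INR m) < a * a); [|lra].
      apply Rmult_lt_reg_r with (/ (8 * INR m)); [apply Rinv_0_lt_compat; lra|].
      rewrite Rmult_assoc, Rinv_r, Rmult_1_r by lra. exact HK. }
    pose proof (Cmod_fst_le (sk m k z - sz m z)) as L3.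
    change (fst (sk m k z - sz m z)%C) with (fst (sk m k z) - a) in L3.
    pose proof (Rle_abs (- (fst (sk m k z) - a))) as L4. rewrite Rabs_Ropp in L4. lra.
Qed.

(** Cauchy square of the geometric series. *)
Lemma ex_series_linear_geom (q : R) : Rabs q < 1 -> ex_series (fun k => INR (S k) * q ^ k).
Proof.
  intros Hq.
  assert (G : ex_series (fun n => Rabs (q ^ n))).
  { apply (ex_series_ext (V := R_NormedModule) (fun n => Rabs q ^ n)).
    - intros n. now rewrite RPow_abs.
    - apply ex_series_geom. now rewrite Rabs_Rabsolu. }
  pose proof (Series_correct _ (ex_series_geom q Hq)) as E.
  exists (Series (fun n => q ^ n) * Series (fun n => q ^ n)).
  apply (is_series_ext (V := R_NormedModule)
    (fun n => sum_f_R0 (fun k => q ^ k * q ^ (n - k)) n)).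
  - intros n. rewrite (sum_eq _ (fun _ => q ^ n)).
    + rewrite sum_cte. apply Rmult_comm.
    + intros i Hi. rewrite <- pow_add. f_equal. lia.
  - now apply is_series_mult.
Qed.

Lemma cdiff_wz (m : nat) (z0 : C) : cdiff (wz m) z0.
Proof.
  apply cdiff_minus; [apply cdiff_const|].
  apply cdiff_mult; [apply cdiff_const|apply cdiff_id].
Qed.

Lemma cdiff_epsk (m k : nat) (z0 : C) : cdiff (epsk m k) z0.
Proof.
  apply cdiff_mult; [apply cdiff_const|]. apply cdiff_pow, cdiff_id.
Qed.

Lemma cdiff_sz (m : nat) (z0 : C) : (1 <= m)%nat -> slit_disc m z0 -> cdiff (sz m) z0.
Proof. intros Hm H. apply cdiff_Csqrt; [now apply off_cut_wz|apply cdiff_wz]. Qed.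

Lemma cdiff_sk (m k : nat) (z0 : C) : (1 <= m)%nat -> slit_disc m z0 ->
  cdiff (sk m k) z0.
Proof.
  intros Hm H. apply cdiff_Csqrt; [now apply off_cut_wk|].
  apply cdiff_plus; [apply cdiff_wz|apply cdiff_epsk].
Qed.

Lemma Csqr_neq_0 (z : C) : z <> 0%C -> (z * z)%C <> 0%C.
Proof.
  intros Hz E. apply (f_equal Cmod) in E. rewrite Cmod_mult, Cmod_0 in E.
  apply Cmod_gt_0 in Hz. nra.
Qed.

Lemma cdiff_gterm (m k : nat) (z0 : C) : (1 <= m)%nat -> slit_disc m z0 ->
  cdiff (gterm m k) z0.
Proof.
  intros Hm H. destruct (sz_plus_sk_bounds m k z0 Hm H) as [_ [_ [_ [Hn _]]]].
  assert (Hd : cdiff (fun z => sz m z + sk m k z)%C z0)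
    by (apply cdiff_plus; [now apply cdiff_sz|now apply cdiff_sk]).
  apply cdiff_mult.
  - apply cdiff_mult; [|apply cdiff_epsk].
    apply cdiff_mult; [apply cdiff_const|apply cdiff_pow, cdiff_id].
  - apply cdiff_inv; [now apply Csqr_neq_0|]. now apply cdiff_mult.
Qed.

Lemma Cmod_inv_le (z : C) (c : R) : 0 < c -> c <= Cmod z -> Cmod (/ z) <= / c.
Proof.
  intros Hc H. rewrite Cmod_inv by (apply Cmod_gt_0; lra). now apply Rinv_le_contravar.
Qed.

Lemma Cinv_Lipschitz (u v : C) (c : R) : 0 < c -> c <= Cmod u -> c <= Cmod v ->
  Cmod (/ u - / v) <= / c * / c * Cmod (u - v).
Proof.
  intros Hc Hu Hv. assert (u <> 0%C) by (apply Cmod_gt_0; lra).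
  assert (v <> 0%C) by (apply Cmod_gt_0; lra).
  replace (/ u - / v)%C with (/ u * / v * - (u - v))%C by (field; auto).
  rewrite !Cmod_mult, Cmod_opp. apply Rmult_le_compat_r; [apply Cmod_ge_0|].
  apply Rmult_le_compat; auto using Cmod_ge_0, Cmod_inv_le.
Qed.

(** Product rule for [z^(2k+2)] times [(s + s_k)^(-2)]. The increments of [s] and [s_k] are at most
    [4m h / c] and [8m h / c], whence 12 for their sum and 24 for its inverse square.
    [Csqrt_Lipschitz] refers to one endpoint, so the lower bound on [Re s_k] at the base point [z0]
    is enough. *)
Lemma gterm_Lipschitz (m k : nat) (z z0 : C) (r c : R) : (1 <= m)%nat ->
  slit_disc m z -> slit_disc m z0 -> 0 < c -> r < / 2 ->
  Cmod z <= r -> Cmod z0 <= r ->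
  c <= fst (sz m z) -> c <= fst (sz m z0) -> c <= fst (sk m k z0) ->
  Cmod (gterm m k z - gterm m k z0) <=
  4 * INR m * (4 * INR m) * (2 * / (c * c) + 24 * INR m * / (c * c * (c * c))) *
  (INR (S k) * (4 * INR m * (r * r)) ^ k) * Cmod (z - z0).
Proof.
  intros Hm D D0 Hc Hr Hz Hz0 Hs Hs0 Hk.
  pose proof (INR_ge_1 m Hm) as H1. pose proof (Cmod_ge_0 z) as Hz1.
  set (h := Cmod (z - z0)) in *. assert (Hh : 0 <= h) by apply Cmod_ge_0.
  assert (Hr0 : 0 <= r) by lra.
  set (u := (sz m z + sk m k z)%C). set (u0 := (sz m z0 + sk m k z0)%C).
  assert (Hu : c <= Cmod u).
  { eapply Rle_trans; [exact Hs|]. now apply sz_plus_sk_bounds. }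
  assert (Hu0 : c <= Cmod u0).
  { eapply Rle_trans; [exact Hs0|]. now apply sz_plus_sk_bounds. }
  assert (Hw : Cmod (wz m z - wz m z0) = 4 * INR m * h).
  { unfold wz. replace (1 - RtoC (4 * INR m) * z - (1 - RtoC (4 * INR m) * z0))%C with
      (- (RtoC (4 * INR m) * (z - z0)))%C by ring.
    rewrite Cmod_opp, Cmod_mult, Cmod_RtoC_nonneg by lra. easy. }
  assert (He : Cmod (epsk m k z - epsk m k z0) <= 4 * INR m * h).
  { unfold epsk. replace (RtoC (4 * INR m) * z ^ S (S k) - RtoC (4 * INR m) * z0 ^ S (S k))%C
      with (RtoC (4 * INR m) * (z ^ S (S k) - z0 ^ S (S k)))%C by ring.
    rewrite Cmod_mult, Cmod_RtoC_nonneg by lra. apply Rmult_le_compat_l; [lra|].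
    eapply Rle_trans; [apply (Cpow_Lipschitz r); easy|].
    pose proof (pow_deriv_lt_1 r k (conj Hr0 Hr)). fold h. nra. }
  assert (Hsd : Cmod (sz m z - sz m z0) <= 4 * INR m * h * / c).
  { eapply Rle_trans; [apply Csqrt_Lipschitz; now apply off_cut_wz|].
    rewrite Hw. apply Rmult_le_compat_l; [nra|]. now apply Rinv_le_contravar. }
  assert (Hkd : Cmod (sk m k z - sk m k z0) <= 8 * INR m * h * / c).
  { eapply Rle_trans; [apply Csqrt_Lipschitz; now apply off_cut_wk|].
    assert (Cmod (wk m k z - wk m k z0) <= 8 * INR m * h).
    { unfold wk. replace (wz m z + epsk m k z - (wz m z0 + epsk m k z0))%C with
        ((wz m z - wz m z0) + (epsk m k z - epsk m k z0))%C by ring.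
      eapply Rle_trans; [apply Cmod_triangle|]. lra. }
    apply Rmult_le_compat; [apply Cmod_ge_0| |easy|now apply Rinv_le_contravar].
    left. apply Rinv_0_lt_compat. fold (sk m k z0). lra. }
  assert (Hud : Cmod (u - u0) <= 12 * INR m * h * / c).
  { unfold u, u0. replace (sz m z + sk m k z - (sz m z0 + sk m k z0))%C with
      ((sz m z - sz m z0) + (sk m k z - sk m k z0))%C by ring.
    eapply Rle_trans; [apply Cmod_triangle|]. lra. }
  assert (Hic : 0 < / c) by now apply Rinv_0_lt_compat.
  set (ic := / c) in *.
  assert (V : Cmod (/ u - / u0) <= 12 * INR m * h * (ic * ic * ic)).
  { eapply Rle_trans; [apply (Cinv_Lipschitz u u0 c); easy|]. fold ic.
    apply Rle_trans with (ic * ic * (12 * INR m * h * ic)); [|right; ring].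
    apply Rmult_le_compat_l; [nra|easy]. }
  assert (Vu : Cmod (/ u) <= ic) by now apply Cmod_inv_le.
  assert (Vu0 : Cmod (/ u0) <= ic) by now apply Cmod_inv_le.
  assert (W : Cmod (/ u * / u - / u0 * / u0) <= 24 * INR m * h * (ic * ic * (ic * ic))).
  { replace (/ u * / u - / u0 * / u0)%C with ((/ u - / u0) * (/ u + / u0))%C by ring.
    rewrite Cmod_mult. pose proof (Cmod_triangle (/ u) (/ u0)).
    apply Rle_trans with (12 * INR m * h * (ic * ic * ic) * (2 * ic)); [|right; ring].
    apply Rmult_le_compat; auto using Cmod_ge_0. lra. }
  assert (P : Cmod (z ^ k * z ^ S (S k) - z0 ^ k * z0 ^ S (S k)) <=
    2 * INR (S k) * (r * r) ^ k * h).
  { rewrite <- !Cpow_add_r. replace (k + S (S k))%nat with (S (S (2 * k)))%nat by lia.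
    eapply Rle_trans; [apply (Cpow_Lipschitz r); easy|]. fold h.
    apply Rmult_le_compat_r; [easy|].
    replace (INR (S (S (2 * k)))) with (2 * INR (S k))
      by (rewrite !S_INR, mult_INR; simpl; ring).
    apply Rmult_le_compat_l; [pose proof (pos_INR (S k)); lra|].
    change (r ^ S (2 * k)) with (r * r ^ (2 * k)). rewrite pow_mult.
    replace (r ^ 2) with (r * r) by ring.
    pose proof (pow_le (r * r) k ltac:(nra)). nra. }
  assert (P0 : Cmod (z0 ^ k * z0 ^ S (S k)) <= (r * r) ^ k).
  { rewrite Cmod_mult, !Cmod_pow.
    apply Rle_trans with (r ^ k * r ^ S (S k)).
    - pose proof (Cmod_ge_0 z0). apply Rmult_le_compat; try (now apply pow_le);
      apply pow_incr; lra.
    - simpl. rewrite Rpow_mult_distr. pose proof (pow_le r k Hr0).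
      assert (0 <= r ^ k * r ^ k) by nra.
      replace (r ^ k * (r * (r * r ^ k))) with (r * r * (r ^ k * r ^ k)) by ring.
      assert (r * r <= 1) by nra. nra. }
  destruct (bcount_bound m k) as [B0 B1].
  unfold gterm, epsk. fold u u0. unfold Cdiv.
  assert (Eu : (/ (u * u) = / u * / u)%C).
  { field. apply Cmod_gt_0. lra. }
  assert (Eu0 : (/ (u0 * u0) = / u0 * / u0)%C).
  { field. apply Cmod_gt_0. lra. }
  rewrite Eu, Eu0.
  replace (RtoC (bcount m k) * z ^ k * (RtoC (4 * INR m) * z ^ S (S k)) * (/ u * / u) -
    RtoC (bcount m k) * z0 ^ k * (RtoC (4 * INR m) * z0 ^ S (S k)) * (/ u0 * / u0))%C with
    (RtoC (bcount m k) * RtoC (4 * INR m) *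
      ((z ^ k * z ^ S (S k) - z0 ^ k * z0 ^ S (S k)) * (/ u * / u) +
       z0 ^ k * z0 ^ S (S k) * (/ u * / u - / u0 * / u0)))%C by ring.
  rewrite Cmod_mult, (Cmod_mult (RtoC (bcount m k)) (RtoC (4 * INR m))).
  rewrite (Cmod_RtoC_nonneg _ B0), (Cmod_RtoC_nonneg (4 * INR m)) by lra.
  pose proof (pow_le (r * r) k ltac:(nra)) as Pp.
  assert (S1 : 1 <= INR (S k)) by (rewrite S_INR; pose proof (pos_INR k); lra).
  set (X := Cmod _) in |- *.
  assert (HX : X <= (2 * / (c * c) + 24 * INR m * / (c * c * (c * c))) *
    (INR (S k) * (r * r) ^ k) * h).
  { unfold X. eapply Rle_trans; [apply Cmod_triangle|].
    rewrite (Cmod_mult _ (/ u * / u)), (Cmod_mult _ (/ u * / u - _)), (Cmod_mult (/ u) (/ u)).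
    rewrite !Rinv_mult. fold ic.
    apply Rle_trans with (2 * INR (S k) * (r * r) ^ k * h * (ic * ic) +
      (r * r) ^ k * (24 * INR m * h * (ic * ic * (ic * ic)))).
    - apply Rplus_le_compat.
      + apply Rmult_le_compat; auto using Cmod_ge_0.
        * apply Rmult_le_pos; apply Cmod_ge_0.
        * apply Rmult_le_compat; auto using Cmod_ge_0.
      + apply Rmult_le_compat; auto using Cmod_ge_0.
    - assert (0 <= INR m * h) by nra. assert (0 < ic * ic) by nra.
      assert (0 <= INR m * h * (ic * ic * (ic * ic)) * (r * r) ^ k).
      { apply Rmult_le_pos; [|easy]. apply Rmult_le_pos; [easy|nra]. }
      nra. }
  assert (HX0 : 0 <= X) by apply Cmod_ge_0.
  apply Rle_trans with ((4 * INR m) ^ S k * (4 * INR m) * X).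
  { apply Rmult_le_compat_r; [easy|]. apply Rmult_le_compat_r; [lra|easy]. }
  eapply Rle_trans; [apply Rmult_le_compat_l; [|exact HX]|].
  - pose proof (pow_le (4 * INR m) (S k) ltac:(lra)). nra.
  - right. rewrite (Rpow_mult_distr (4 * INR m) (r * r)), <- tech_pow_Rmult. ring.
Qed.

Lemma cdiff_CSeries_gterm (m : nat) (z0 : C) : (1 <= m)%nat -> slit_disc m z0 ->
  cdiff (fun z => CSeries (fun k => gterm m k z)) z0.
Proof.
  intros Hm H. pose proof (INR_ge_1 m Hm) as H1.
  destruct (slit_disc_open m z0 Hm H) as [d1 [Hd1 Hopen]].
  destruct (sk_fst_lower m z0 Hm H) as [c1 [Hc1 Hk]].
  pose proof (sz_fst_pos m z0 Hm H) as Hs. set (a := fst (sz m z0)) in *.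
  set (c := Rmin c1 (a / 2)). assert (Hc : 0 < c) by (apply Rmin_pos; lra).
  destruct (H) as [Hz0 _]. pose proof (Cmod_ge_0 z0) as P0.
  set (r := (Cmod z0 + / (2 * INR m)) / 2).
  assert (Hr : 0 <= r < / (2 * INR m)) by (unfold r; lra).
  (* The three radii keep [z] in the slit disc, [|z| <= r] ([r] is the midpoint of [|z0|] and
     [1/(2m)]), and [Re s >= a / 2]. *)
  set (d := Rmin d1 (Rmin (/ (2 * INR m) - r) (a * a / (8 * INR m)))).
  assert (Hd : 0 < d).
  { repeat apply Rmin_pos; try lra. apply Rdiv_lt_0_compat; nra. }
  apply (cdiff_CSeries _ z0 (fun k =>
    4 * INR m * (4 * INR m) * (2 * / (c * c) + 24 * INR m * / (c * c * (c * c))) *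
    (INR (S k) * (4 * INR m * (r * r)) ^ k)) d Hd).
  - intros z Hz. apply abs_summable_gterm; [easy|]. apply Hopen.
    eapply Rlt_le_trans; [exact Hz|apply Rmin_l].
  - intros k z Hz.
    assert (Z1 : Cmod (z - z0) < d1) by (eapply Rlt_le_trans; [exact Hz|apply Rmin_l]).
    assert (Z2 : Cmod (z - z0) < / (2 * INR m) - r).
    { eapply Rlt_le_trans; [exact Hz|]. eapply Rle_trans; [apply Rmin_r|apply Rmin_l]. }
    assert (Z3 : Cmod (z - z0) < a * a / (8 * INR m)).
    { eapply Rlt_le_trans; [exact Hz|]. eapply Rle_trans; [apply Rmin_r|apply Rmin_r]. }
    assert (Ca : c <= a / 2) by apply Rmin_r.
    apply gterm_Lipschitz; auto.
    + eapply Rlt_le_trans; [apply Hr|]. apply Rinv_le_contravar; lra.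
    + assert (T : Cmod z <= Cmod z0 + Cmod (z - z0)).
      { replace z with (z0 + (z - z0))%C at 1 by ring. apply Cmod_triangle. }
      unfold r in *. lra.
    + unfold r. lra.
    + pose proof (Csqrt_Lipschitz (wz m z) (wz m z0) (off_cut_wz m z0 Hm H)) as L.
      fold (sz m z) (sz m z0) a in L. unfold wz in L at 1 2.
      replace (1 - RtoC (4 * INR m) * z - (1 - RtoC (4 * INR m) * z0))%C with
        (- (RtoC (4 * INR m) * (z - z0)))%C in L by ring.
      rewrite Cmod_opp, Cmod_mult, Cmod_RtoC_nonneg in L by lra.
      assert (L2 : 4 * INR m * Cmod (z - z0) / a <= a / 2).
      { apply Rmult_le_reg_r with a; [easy|]. unfold Rdiv at 1.
        rewrite Rmult_assoc, Rinv_l, Rmult_1_r by lra.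
        assert (Cmod (z - z0) * (8 * INR m) < a * a); [|lra].
        apply Rmult_lt_reg_r with (/ (8 * INR m)); [apply Rinv_0_lt_compat; lra|].
        rewrite Rmult_assoc, Rinv_r, Rmult_1_r by lra. exact Z3. }
      pose proof (Cmod_fst_le (sz m z - sz m z0)) as L3.
      change (fst (sz m z - sz m z0)%C) with (fst (sz m z) - a) in L3.
      pose proof (Rle_abs (- (fst (sz m z) - a))) as L4. rewrite Rabs_Ropp in L4. lra.
    + fold a. lra.
    + eapply Rle_trans; [apply Rmin_l|apply Hk].
  - apply (ex_series_scal_l (V := R_NormedModule)), ex_series_linear_geom.
    pose proof (geom_ratio_lt_1 m r Hm Hr). rewrite Rabs_right; lra.
  - intros k. now apply cdiff_gterm.
Qed.

Lemma cdiff_NB_fun (m : nat) (z0 : C) : (1 <= m)%nat -> slit_disc m z0 ->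
  cdiff (NB_fun m) z0.
Proof.
  intros Hm H. apply cdiff_mult; [apply cdiff_minus|].
  - apply cdiff_mult; [apply cdiff_const|].
    apply cdiff_inv; [apply Csqr_neq_0, one_plus_sz|].
    apply cdiff_mult; (apply cdiff_plus; [apply cdiff_const|now apply cdiff_sz]).
  - now apply cdiff_CSeries_gterm.
  - apply cdiff_inv; [now apply sz_neq_0|now apply cdiff_sz].
Qed.

(** * Behaviour at the singularity *)

(** The rate [n^(-3/2)], shifted by 3 so that consecutive values have ratio at most [8/5], hence
    below 2. *)
Definition hh (n : nat) : R := / ((INR n + 3) * sqrt (INR n + 3)).

Lemma hh_pos (n : nat) : 0 < hh n.
Proof.
  pose proof (pos_INR n). apply Rinv_0_lt_compat.
  apply Rmult_lt_0_compat; [lra|]. apply sqrt_lt_R0. lra.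
Qed.

Lemma hh_decr (n j : nat) : hh (n + j) <= hh n.
Proof.
  pose proof (pos_INR n). pose proof (pos_INR j). unfold hh. rewrite plus_INR.
  apply Rinv_le_contravar.
  - apply Rmult_lt_0_compat; [lra|]. apply sqrt_lt_R0. lra.
  - apply Rmult_le_compat; [lra|apply sqrt_pos|lra|]. apply sqrt_le_1_alt. lra.
Qed.

(** Wallis with the crude bound [PI > 2] gives [pcb (S k)^2 (k + 1) <= 1/2], and
    [k + 3 <= 3 (k + 1)] absorbs the shift. *)
Lemma tcat_hh (k : nat) : tcat (S k) <= 2 * hh k.
Proof.
  pose proof (pos_INR k) as Hk. pose proof (pcb_pos (S k)) as Hp.
  pose proof (Wallis_upper (S k) ltac:(lia)) as Hu. rewrite S_INR in Hu.
  pose proof PI2_1 as HPI.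
  set (q := sqrt (INR k + 3)). assert (Hq : 0 < q) by (apply sqrt_lt_R0; lra).
  assert (Hqq : q * q = INR k + 3) by (apply sqrt_sqrt; lra).
  assert (H1 : pcb (S k) * q <= 4 / 3).
  { assert (E : pcb (S k) ^ 2 * (INR k + 1) <= / 2).
    { apply Rle_trans with (/ (PI * (INR k + 1)) * (INR k + 1)).
      - apply Rmult_le_compat_r; lra.
      - replace (/ (PI * (INR k + 1)) * (INR k + 1)) with (/ PI) by (field; lra).
        apply Rinv_le_contravar; lra. }
    assert (E2 : (pcb (S k) * q) * (pcb (S k) * q) <= 3 / 2).
    { replace (pcb (S k) * q * (pcb (S k) * q)) with (pcb (S k) ^ 2 * (q * q)) by ring.
      rewrite Hqq. nra. }
    nra. }
  unfold tcat, hh. fold q. rewrite S_INR.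
  apply Rmult_le_reg_r with ((INR k + 3) * q * (INR k + 2)); [nra|].
  replace (pcb (S k) / (INR k + 1 + 1) * ((INR k + 3) * q * (INR k + 2))) with
    (pcb (S k) * q * (INR k + 3)) by (field; lra).
  replace (2 * / ((INR k + 3) * q) * ((INR k + 3) * q * (INR k + 2))) with
    (2 * (INR k + 2)) by (field; lra).
  nra.
Qed.

Lemma hh_pred (n : nat) : hh n <= 8 / 5 * hh (S n).
Proof.
  pose proof (pos_INR n) as Hn. unfold hh. rewrite S_INR.
  set (p := sqrt (INR n + 3)). set (q := sqrt (INR n + 1 + 3)).
  assert (Hp : 0 < p) by (apply sqrt_lt_R0; lra).
  assert (Hq : 0 < q) by (apply sqrt_lt_R0; lra).
  assert (Hpp : p * p = INR n + 3) by (apply sqrt_sqrt; lra).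
  assert (Hqq : q * q = INR n + 1 + 3) by (apply sqrt_sqrt; lra).
  assert (Hqp : q <= 6 / 5 * p) by nra.
  apply Rmult_le_reg_r with ((INR n + 3) * p * ((INR n + 1 + 3) * q));
    [repeat apply Rmult_lt_0_compat; lra|].
  replace (/ ((INR n + 3) * p) * ((INR n + 3) * p * ((INR n + 1 + 3) * q))) with
    ((INR n + 4) * q) by (field; lra).
  replace (8 / 5 * / ((INR n + 1 + 3) * q) * ((INR n + 3) * p * ((INR n + 1 + 3) * q)))
    with (8 / 5 * ((INR n + 3) * p)) by (field; lra).
  nra.
Qed.

(** The constant 5 reproduces itself: [5 * (1/2) * (8/5) + 1 = 5]. *)
Lemma hh_geom_sum (n : nat) :
  sum_f_R0 (fun k => hh k * (/ 2) ^ (n - k)) n <= 5 * hh n.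
Proof.
  induction n as [|n IH].
  - simpl. pose proof (hh_pos 0). lra.
  - rewrite tech5, Nat.sub_diag.
    rewrite (sum_eq _ (fun k => hh k * (/ 2) ^ (n - k) * / 2)).
    + rewrite <- scal_sum. pose proof (hh_pred n). simpl pow. lra.
    + intros i Hi. replace (S n - i)%nat with (S (n - i)) by lia. simpl. ring.
Qed.

Lemma pow_le_3 (a : R) (N : nat) : 0 <= a -> INR N * a <= 1 -> (1 + a) ^ N <= 3.
Proof.
  intros Ha H. apply Rle_trans with (2 := exp_le_3).
  apply Rle_trans with (exp (INR N * a)).
  - clear H. induction N as [|N IH]; [simpl; rewrite Rmult_0_l, exp_0; lra|].
    rewrite S_INR. replace ((INR N + 1) * a) with (a + INR N * a) by ring.
    rewrite exp_plus. simpl pow.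
    pose proof (exp_ineq1_le a). pose proof (pow_le (1 + a) N ltac:(lra)).
    apply Rmult_le_compat; lra.
  - destruct H as [H|H]; [left; now apply exp_increasing|right; now rewrite H].
Qed.

Lemma INR_le_pow4 (n : nat) : INR n * 4 <= 4 ^ n.
Proof.
  induction n as [|n IH]; [simpl; lra|]. rewrite S_INR. simpl pow.
  destruct n as [|n]; [simpl; lra|]. rewrite S_INR in *. pose proof (pos_INR n). lra.
Qed.

(** * Estimates near [1/(4m)], with [n] the integer part of [ln (1/a) / ln q] *)

Section NearSingularity.
Context (m : nat) (Hm : (1 <= m)%nat) (z : C) (HD : slit_disc m z).
Notation a := (Cmod (wz m z)).
Notation q := (4 * INR m).
Context (Ha : a <= / 8) (n : nat) (Hn1 : a * q ^ n <= 1) (Hn2 : 1 < a * q ^ S n).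

Lemma a_pos : 0 < a.
Proof.
  apply Cmod_gt_0. intros E. pose proof (off_cut_wz m z Hm HD) as H.
  rewrite E in H. destruct H as [H|H]; simpl in H; lra.
Qed.

Lemma q_ge_4 : 4 <= q.
Proof. pose proof (INR_ge_1 m Hm). lra. Qed.

(** [4 n <= 4^n <= q^n <= 1/a]. *)
Lemma n_a_small : INR n * a <= / 4.
Proof.
  pose proof a_pos. pose proof q_ge_4. pose proof (INR_le_pow4 n).
  pose proof (pow_incr 4 q n ltac:(lra)).
  assert (INR n * 4 <= q ^ n) by lra.
  assert (a * (INR n * 4) <= a * q ^ n) by (apply Rmult_le_compat_l; lra). lra.
Qed.

(** The variable rescaled so that the singularity lies at 1. *)
Definition yz : C := (RtoC q * z)%C.

Lemma yz_wz : yz = (1 - wz m z)%C.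
Proof. unfold yz, wz. ring. Qed.

Lemma Cmod_yz_upper : Cmod yz <= 1 + a.
Proof.
  rewrite yz_wz. eapply Rle_trans; [apply Cmod_triangle|]. rewrite Cmod_opp, Cmod_1. lra.
Qed.

Lemma Cmod_yz_lower : 7 / 8 <= Cmod yz.
Proof.
  assert (1 <= Cmod yz + a); [|lra]. rewrite <- Cmod_1.
  replace (RtoC 1) with (yz + wz m z)%C at 1 by (rewrite yz_wz; ring).
  apply Cmod_triangle.
Qed.

(** The exponent [2n + 4] is the total power [k + (k + 2)] of [yz] at [k = n + 1]; there
    [(2n + 4) a <= 1/2 + 1/2]. *)
Lemma Cmod_yz_pow (N : nat) : (N <= 2 * n + 4)%nat -> Cmod yz ^ N <= 3.
Proof.
  intros HN. pose proof a_pos. pose proof n_a_small.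
  apply Rle_trans with ((1 + a) ^ N).
  - apply pow_incr. split; [apply Cmod_ge_0|apply Cmod_yz_upper].
  - apply pow_le_3; [lra|]. apply le_INR in HN.
    rewrite plus_INR, mult_INR in HN. simpl in HN.
    apply Rle_trans with (((1 + 1) * INR n + (1 + 1 + 1 + 1)) * a); [|lra].
    apply Rmult_le_compat_r; lra.
Qed.

(** The correction term stripped of its coefficient, using [b_k z^k = q tcat (k+1) yz^k]. This is
    the factor that switches from 1 to 0 around [k = n]. *)
Definition hk (k : nat) : C :=
  (yz ^ k * epsk m k z / ((sz m z + sk m k z) * (sz m z + sk m k z)))%C.

Lemma gterm_hk (k : nat) : gterm m k z = (RtoC (q * tcat (S k)) * hk k)%C.
Proof.
  unfold gterm, hk, yz, bcount. rewrite length_B_tcat, Cpow_mult_l, <- RtoC_pow.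
  rewrite <- tech_pow_Rmult, !RtoC_mult. unfold Cdiv. ring.
Qed.

Lemma Cmod_sz : Cmod (sz m z) * Cmod (sz m z) = a.
Proof. rewrite <- Cmod_mult, sz_sqr. easy. Qed.

Lemma Cmod_epsk_yz (k : nat) : Cmod (epsk m k z) * q ^ S k = Cmod yz ^ S (S k).
Proof.
  rewrite Cmod_epsk. unfold yz. pose proof q_ge_4.
  rewrite Cmod_mult, Cmod_RtoC_nonneg by lra.
  rewrite (Rpow_mult_distr q (Cmod z)), <- !tech_pow_Rmult. ring.
Qed.

(** With [|s + s_k|^2 >= a], the modulus is at most [|yz|^(2k+2) / (a q^(k+1))]. The first [n + 1]
    powers of [q] are paid by [a q^(n+1) > 1], and each further one beats [|yz|^2 <= 2] by a factor
    2. *)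
Lemma hk_far (j : nat) : Cmod (hk (S n + j)) <= 3 * (/ 2) ^ j.
Proof.
  set (k := (S n + j)%nat). pose proof a_pos as Ha0. pose proof q_ge_4 as Hq.
  destruct (sz_plus_sk_bounds m k z Hm HD) as [B1 [_ [_ [B2 _]]]].
  set (S' := Cmod (sz m z + sk m k z)) in *.
  assert (HS : a <= S' * S').
  { rewrite <- Cmod_sz. apply Rmult_le_compat; auto using Cmod_ge_0. }
  set (Y := Cmod yz). assert (HY0 : 0 <= Y) by apply Cmod_ge_0.
  assert (HY : Y <= 9 / 8) by (unfold Y; pose proof Cmod_yz_upper; lra).
  assert (E : Cmod (hk k) <= Y ^ k * Cmod (epsk m k z) / a).
  { unfold hk. rewrite Cmod_div by now apply Csqr_neq_0.
    rewrite !Cmod_mult, Cmod_pow. fold Y S'. unfold Rdiv.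
    apply Rmult_le_compat_l.
    - apply Rmult_le_pos; [now apply pow_le|apply Cmod_ge_0].
    - now apply Rinv_le_contravar. }
  eapply Rle_trans; [exact E|].
  assert (Hqk : 0 < q ^ S k) by (apply pow_lt; lra).
  apply Rmult_le_reg_r with (a * q ^ S k); [nra|].
  replace (Y ^ k * Cmod (epsk m k z) / a * (a * q ^ S k)) with
    (Y ^ k * (Cmod (epsk m k z) * q ^ S k)) by (field; lra).
  rewrite Cmod_epsk_yz. fold Y. rewrite <- pow_add.
  replace (k + S (S k))%nat with ((2 * n + 4) + 2 * j)%nat by (unfold k; lia).
  rewrite pow_add. pose proof (Cmod_yz_pow (2 * n + 4) ltac:(lia)) as H3. fold Y in H3.
  apply Rle_trans with (3 * Y ^ (2 * j)).
  { apply Rmult_le_compat_r; [now apply pow_le|easy]. }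
  rewrite Rmult_assoc. apply Rmult_le_compat_l; [lra|].
  replace (S k) with (S n + S j)%nat by (unfold k; lia). rewrite pow_add.
  apply Rle_trans with ((/ 2) ^ j * q ^ j).
  - rewrite pow_mult, <- Rpow_mult_distr. apply pow_incr. simpl. split; [nra|].
    assert (Y * Y <= 2) by nra. lra.
  - apply Rmult_le_compat_l; [apply pow_le; lra|].
    assert (Hj : 0 < q ^ j) by (apply pow_lt; lra).
    change (q ^ S j) with (q * q ^ j).
    replace (a * (q ^ S n * (q * q ^ j))) with (a * q ^ S n * (q * q ^ j)) by ring.
    assert (q ^ j <= q * q ^ j) by nra. nra.
Qed.

(** From [eps_k / (s + s_k)^2 = 1 - 2 s / (s + s_k)]. Here [|s|^2 = a] and [|s + s_k|^2 >= |eps_k|],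
    so the square of the quotient is of order [a q^(k+1) <= q 4^(k-n)], whence the rate
    [2^(k-n)]. *)
Lemma hk_near (k : nat) : (k <= n)%nat ->
  Cmod (1 - hk k) <= 3 * (INR n * a) + 5 * q * (/ 2) ^ (n - k).
Proof.
  intros Hk. pose proof a_pos as Ha0. pose proof q_ge_4 as Hq.
  destruct (sz_plus_sk_bounds m k z Hm HD) as [B1 [B3 [_ [B2 _]]]].
  assert (B4 : 0 < Cmod (sz m z + sk m k z)) by now apply Cmod_gt_0.
  assert (E : (1 - hk k = (1 - yz ^ k) + 2 * yz ^ k * sz m z / (sz m z + sk m k z))%C).
  { unfold hk. replace (epsk m k z) with (sk m k z * sk m k z - sz m z * sz m z)%C.
    - field. exact B2.
    - rewrite sk_sqr, sz_sqr. unfold wk. ring. }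
  rewrite E. eapply Rle_trans; [apply Cmod_triangle|]. clear E. apply Rplus_le_compat.
  - destruct k as [|k].
    + simpl Cpow. replace (1 - 1)%C with (RtoC 0) by ring. rewrite Cmod_0.
      pose proof (pos_INR n). nra.
    + rewrite <- (Cpow_1_l (S k)).
      eapply Rle_trans; [apply (Cpow_Lipschitz (1 + a));
        [rewrite Cmod_1; lra|apply Cmod_yz_upper]|].
      replace (1 - yz)%C with (wz m z) by (rewrite yz_wz; ring).
      assert (H3 : (1 + a) ^ k <= 3).
      { apply pow_le_3; [lra|]. pose proof n_a_small.
        assert (INR k <= INR n) by (apply le_INR; lia).
        assert (INR k * a <= INR n * a) by (apply Rmult_le_compat_r; lra). lra. }
      assert (H4 : INR (S k) <= INR n) by now apply le_INR.
      pose proof (pos_INR (S k)). pose proof (pow_le (1 + a) k ltac:(lra)).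
      rewrite <- Rmult_assoc. apply Rmult_le_compat_r; [lra|].
      rewrite Rmult_comm. now apply Rmult_le_compat.
  - rewrite Cmod_div, !Cmod_mult, Cmod_pow, Cmod_RtoC_nonneg by (easy || lra).
    set (S' := Cmod (sz m z + sk m k z)) in *. set (Y := Cmod yz).
    set (sg := Cmod (sz m z)).
    assert (HY : 7 / 8 <= Y) by apply Cmod_yz_lower.
    assert (Hsg : sg * sg = a) by apply Cmod_sz.
    assert (HYk : 0 < Y ^ k) by (apply pow_lt; lra).
    assert (HYk3 : Y ^ k <= 3) by (apply Cmod_yz_pow; lia).
    pose proof (Cmod_epsk_yz k) as He. fold Y in He.
    set (ep := Cmod (epsk m k z)) in *.
    set (P := q ^ S k) in *. assert (HP : 0 < P) by (apply pow_lt; lra).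
    set (h := (/ 2) ^ (n - k)). assert (Hh : 0 < h) by (apply pow_lt; lra).
    (* [a q^n <= 1] and [q >= 4 = (1/h)^2] per step; [h * h] is [4^(k-n)]. *)
    assert (HaP : a * P <= q * (h * h)).
    { unfold P, h. rewrite <- Rpow_mult_distr. change (q ^ S k) with (q * q ^ k).
      assert (Hqn : q ^ n = q ^ k * q ^ (n - k)) by (rewrite <- pow_add; f_equal; lia).
      rewrite Hqn in Hn1. assert (0 < q ^ k) by (apply pow_lt; lra).
      assert (G : 1 <= (/ 2 * / 2) ^ (n - k) * q ^ (n - k)).
      { rewrite <- Rpow_mult_distr. apply pow_R1_Rle. lra. }
      assert (0 < q ^ (n - k)) by (apply pow_lt; lra).
      replace (a * (q * q ^ k)) with (q * (a * q ^ k)) by ring.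
      apply Rmult_le_compat_l; [lra|].
      apply Rmult_le_reg_r with (q ^ (n - k)); [easy|]. lra. }
    set (X := 2 * Y ^ k * sg / S').
    assert (HX : X * S' = 2 * Y ^ k * sg) by (unfold X; field; lra).
    assert (HX0 : 0 <= X).
    { unfold X. apply Rmult_le_pos; [|left; now apply Rinv_0_lt_compat].
      apply Rmult_le_pos; [lra|apply Cmod_ge_0]. }
    (* Multiplying by [P] turns [eps_k] into [Y^(k+2)], from which one factor [Y^k] cancels. *)
    assert (HXep : X * X * (Y * Y) <= 4 * Y ^ k * (a * P)).
    { assert (X * X * ep <= 4 * (Y ^ k * Y ^ k) * a).
      { apply Rle_trans with (X * X * (S' * S')).
        - apply Rmult_le_compat_l; [nra|easy].
        - right. replace (X * X * (S' * S')) with ((X * S') * (X * S')) by ring.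
          rewrite HX, <- Hsg. ring. }
      assert (X * X * (ep * P) <= 4 * (Y ^ k * Y ^ k) * a * P)
        by (rewrite <- Rmult_assoc; apply Rmult_le_compat_r; lra).
      rewrite He in H0. simpl pow in H0.
      apply Rmult_le_reg_r with (Y ^ k); [easy|]. lra. }
    assert (HXX : X * X <= (5 * q * h) * (5 * q * h)).
    { assert (HYY : 49 / 64 <= Y * Y) by nra.
      assert (X * X * (49 / 64) <= X * X * (Y * Y)) by (apply Rmult_le_compat_l; nra).
      assert (4 * Y ^ k * (a * P) <= 12 * (q * (h * h))).
      { apply Rmult_le_compat; [lra|nra|lra|easy]. }
      assert (0 < h * h) by nra. assert (q <= q * q) by nra.
      assert (q * (h * h) <= q * q * (h * h)) by (apply Rmult_le_compat_r; lra).
      assert (0 < q * (h * h)) by (apply Rmult_lt_0_compat; lra).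
      lra. }
    assert (0 < q * h) by nra.
    apply Rnot_lt_le. intros Hlt. nra.
Qed.

(** The constant [q] is the value of [4m / (1 + s)^2] at [s = 0]; after cancellation only the tail
    [2 q pcb (n + 2)] is left. *)
Lemma csum_tcat (N : nat) :
  csum (fun k => RtoC (q * tcat (S k))) (S N) = RtoC (q - 2 * q * pcb (S (S N))).
Proof.
  assert (G : forall j, csum (fun k => RtoC (q * tcat (S k))) j =
    RtoC (q * (sum_f_R0 tcat j - 1))).
  { induction j as [|j IH].
    - simpl. f_equal. unfold tcat; simpl. field.
    - simpl csum. rewrite IH, <- RtoC_plus, tech5. f_equal. ring. }
  rewrite G, sum_tcat. f_equal. ring.
Qed.

Lemma Cmod_csum_sum (f : nat -> C) (g : nat -> R) (N : nat) :
  (forall k, (k <= N)%nat -> Cmod (f k) <= g k) ->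
  Cmod (csum f (S N)) <= sum_f_R0 g N.
Proof.
  induction N as [|N IH]; intros H.
  - simpl. rewrite Cplus_0_l. now apply H.
  - rewrite tech5. change (csum f (S (S N))) with (csum f (S N) + f (S N))%C.
    eapply Rle_trans; [apply Cmod_triangle|]. apply Rplus_le_compat; [|now apply H].
    apply IH. intros k Hk. apply H. lia.
Qed.

Lemma NB_fun_near_pcb :
  Cmod (sz m z * NB_fun m z - RtoC (2 * q * pcb (S (S n)))) <=
  q * (3 * sqrt a + 3 * (INR n * a) + (50 * q + 12) * hh n).
Proof.
  pose proof a_pos as Ha0. pose proof q_ge_4 as Hq. pose proof (pos_INR n) as Hn0.
  pose proof (sz_neq_0 m z Hm HD) as Hs. destruct (one_plus_sz m z) as [O1 O2].
  pose proof (abs_summable_gterm m z Hm HD) as Hg.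
  (* Three errors: the closed form against its value at [s = 0], the head with [hk] replaced by 1,
     and the tail with [hk] replaced by 0. *)
  assert (E : (sz m z * NB_fun m z - RtoC (2 * q * pcb (S (S n))) =
    - (RtoC q * (sz m z * (2 + sz m z) / ((1 + sz m z) * (1 + sz m z)))) +
    (csum (fun k => RtoC (q * tcat (S k)) * (1 - hk k))%C (S n) -
     CSeries (fun j => gterm m (S n + j) z)))%C).
  { unfold NB_fun. rewrite (CSeries_split _ (S n) Hg).
    assert (Ec : forall j, (csum (fun k => RtoC (q * tcat (S k)) * (1 - hk k)) j =
      csum (fun k => RtoC (q * tcat (S k))) j - csum (fun k => gterm m k z) j)%C).
    { induction j as [|j IH]; [simpl; ring|]. simpl csum. rewrite IH, gterm_hk. ring. }
    rewrite Ec, csum_tcat, RtoC_minus. field. auto. }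
  rewrite E. clear E.
  eapply Rle_trans; [apply Cmod_triangle|].
  eapply Rle_trans; [apply Rplus_le_compat_l, Cmod_triangle|]. rewrite !Cmod_opp.
  assert (P1 : Cmod (RtoC q * (sz m z * (2 + sz m z) / ((1 + sz m z) * (1 + sz m z))))
    <= q * (3 * sqrt a)).
  { rewrite Cmod_mult, Cmod_RtoC_nonneg by lra. apply Rmult_le_compat_l; [lra|].
    rewrite Cmod_div by now apply Csqr_neq_0. rewrite !Cmod_mult.
    assert (Es : Cmod (sz m z) = sqrt a) by apply Cmod_Csqrt. rewrite Es.
    assert (H1 : Cmod (2 + sz m z) <= 3).
    { eapply Rle_trans; [apply Cmod_triangle|]. rewrite Es, Cmod_RtoC_nonneg by lra.
      assert (sqrt a <= 1); [|lra]. rewrite <- sqrt_1. apply sqrt_le_1_alt. lra. }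
    pose proof (sqrt_pos a) as Hsa. pose proof (Cmod_ge_0 (2 + sz m z)).
    unfold Rdiv. rewrite <- (Rmult_1_r (3 * sqrt a)), (Rmult_comm 3).
    apply Rmult_le_compat.
    - now apply Rmult_le_pos.
    - left. apply Rinv_0_lt_compat. nra.
    - now apply Rmult_le_compat_l.
    - apply Rle_trans with (/ 1); [apply Rinv_le_contravar; nra|rewrite Rinv_1; lra]. }
  assert (P2 : Cmod (csum (fun k => RtoC (q * tcat (S k)) * (1 - hk k))%C (S n)) <=
    q * (3 * (INR n * a)) + q * (50 * q * hh n)).
  { eapply Rle_trans; [apply (Cmod_csum_sum _ (fun k =>
      tcat (S k) * (q * (3 * (INR n * a))) + hh k * (/ 2) ^ (n - k) * (q * (10 * q))))|].
    - intros k Hk. pose proof (tcat_pos (S k)) as Ht.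
      rewrite Cmod_mult, Cmod_RtoC_nonneg by (apply Rmult_le_pos; lra).
      pose proof (hk_near k Hk) as H1. pose proof (tcat_hh k) as H2.
      assert (H3 : 0 < (/ 2) ^ (n - k)) by (apply pow_lt; lra).
      eapply Rle_trans; [apply Rmult_le_compat_l; [apply Rmult_le_pos; lra|exact H1]|].
      rewrite Rmult_plus_distr_l. apply Rplus_le_compat; [right; ring|].
      replace (q * tcat (S k) * (5 * q * (/ 2) ^ (n - k))) with
        (tcat (S k) * ((/ 2) ^ (n - k) * (q * (5 * q)))) by ring.
      replace (hh k * (/ 2) ^ (n - k) * (q * (10 * q))) with
        (2 * hh k * ((/ 2) ^ (n - k) * (q * (5 * q)))) by ring.
      apply Rmult_le_compat_r; [|easy]. apply Rmult_le_pos; nra.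
    - rewrite sum_plus, <- !scal_sum. pose proof (hh_geom_sum n) as H1.
      assert (H2 : sum_f_R0 (fun k => tcat (S k)) n <= 1).
      { assert (G : forall j, sum_f_R0 (fun k => tcat (S k)) j = sum_f_R0 tcat (S j) - 1).
        { intros j. rewrite (decomp_sum tcat) by lia. simpl pred.
          replace (tcat 0) with 1 by (unfold tcat; simpl; field). ring. }
        rewrite G, sum_tcat. pose proof (pcb_pos (S (S n))). lra. }
      apply Rplus_le_compat.
      + rewrite <- (Rmult_1_r (q * (3 * (INR n * a)))) at 2.
        apply Rmult_le_compat_l; [|easy].
        apply Rmult_le_pos; [lra|]. nra.
      + apply Rle_trans with (q * (10 * q) * (5 * hh n)); [|right; ring].
        apply Rmult_le_compat_l; [nra|easy]. }
  assert (P3 : Cmod (CSeries (fun j => gterm m (S n + j) z)) <= q * (12 * hh n)).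
  { assert (Hb : forall j, Cmod (gterm m (S n + j) z) <= 6 * q * hh n * (/ 2) ^ j).
    { intros j. rewrite gterm_hk. pose proof (tcat_pos (S (S n + j))) as Ht.
      rewrite Cmod_mult, Cmod_RtoC_nonneg by (apply Rmult_le_pos; lra).
      pose proof (hk_far j) as H1. pose proof (tcat_hh (S n + j)) as H2.
      pose proof (hh_decr n (S j)) as H3.
      replace (n + S j)%nat with (S n + j)%nat in H3 by lia.
      replace (6 * q * hh n * (/ 2) ^ j) with (q * (2 * hh n) * (3 * (/ 2) ^ j)) by ring.
      apply Rmult_le_compat; [apply Rmult_le_pos; lra|apply Cmod_ge_0| |easy].
      apply Rmult_le_compat_l; lra. }
    assert (Hge : ex_series (fun j => 6 * q * hh n * (/ 2) ^ j)).
    { apply (ex_series_scal_l (V := R_NormedModule)), ex_series_geom.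
      rewrite Rabs_right; lra. }
    eapply Rle_trans; [apply Cmod_CSeries, abs_summable_dom with (1 := Hb), Hge|].
    eapply Rle_trans; [apply Series_le with (2 := Hge)|].
    - intros j. split; [apply Cmod_ge_0|apply Hb].
    - rewrite Series_scal_l, Series_geom by (rewrite Rabs_right; lra).
      right. field. }
  pose proof (hh_pos n). nra.
Qed.

End NearSingularity.

(** * Passage from [n] to powers of the logarithm *)

Lemma exp_ge_sqr (u : R) : 0 <= u -> u * u / 4 <= exp u.
Proof.
  intros Hu. replace u with (u / 2 + u / 2) at 3 by field. rewrite exp_plus.
  pose proof (exp_ineq1_le (u / 2)). nra.
Qed.

Lemma exp_half_sqr (l : R) : exp (- l) = exp (- (l / 2)) * exp (- (l / 2)).
Proof. rewrite <- exp_plus. f_equal. field. Qed.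

(** With [a = exp (- l)], these absorb the errors [sqrt a] and [n a] into [l^(-3/2)]. *)
Lemma exp_neg_bounds (l : R) : 1 <= l ->
  exp (- (l / 2)) <= 16 * / (l * sqrt l) /\ l * exp (- l) <= 32 * / (l * sqrt l).
Proof.
  intros Hl. pose proof (exp_pos (l / 2)) as Hp.
  assert (Hs : 0 < sqrt l) by (apply sqrt_lt_R0; lra).
  assert (Hss : sqrt l * sqrt l = l) by (apply sqrt_sqrt; lra).
  assert (H1 : exp (- (l / 2)) <= 16 * / (l * sqrt l)).
  { rewrite exp_Ropp. replace (16 * / (l * sqrt l)) with (/ (l * sqrt l / 16)) by (field; lra).
    apply Rinv_le_contravar.
    - apply Rdiv_lt_0_compat; nra.
    - pose proof (exp_ge_sqr (l / 2) ltac:(lra)).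
      assert (sqrt l <= l) by nra. nra. }
  split; [easy|]. rewrite exp_half_sqr.
  assert (H2 : l * exp (- (l / 2)) <= 2).
  { rewrite exp_Ropp. apply Rmult_le_reg_r with (exp (l / 2)); [easy|].
    rewrite Rmult_assoc, Rinv_l by lra. pose proof (exp_ineq1_le (l / 2)). lra. }
  pose proof (exp_pos (- (l / 2))). rewrite <- Rmult_assoc.
  apply Rle_trans with (2 * exp (- (l / 2))).
  - apply Rmult_le_compat_r; lra.
  - lra.
Qed.

(** Wallis at [n + 2] puts [pcb^2] between [1/(PI (x + 5/2))] and [1/(PI x)], because [n + 2 >= x]
    and [n <= x]. The difference of squares is then divided by the root itself. *)
Lemma pcb_near_sqrt (x : R) (n : nat) : 0 < x -> INR n <= x -> x < INR n + 1 ->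
  Rabs (pcb (S (S n)) - sqrt (/ (PI * x))) <= 5 / 2 * / (x * sqrt x).
Proof.
  intros Hx H1 H2. pose proof (pos_INR n) as Hn. pose proof PI2_1 as HPI.
  pose proof (pcb_pos (S (S n))) as Hp.
  pose proof (Wallis_upper (S (S n)) ltac:(lia)) as Hu.
  pose proof (Wallis_lower (S (S n))) as Hl. rewrite !S_INR in Hu, Hl.
  set (p := pcb (S (S n))) in *. set (t := sqrt (/ (PI * x))).
  assert (Hpx : 0 < PI * x) by nra.
  assert (Ht : 0 < t) by (apply sqrt_lt_R0, Rinv_0_lt_compat; easy).
  assert (Htt : t * t = / (PI * x)).
  { apply sqrt_sqrt. left. now apply Rinv_0_lt_compat. }
  assert (Hpt : p * p <= t * t).
  { rewrite Htt. replace (p * p) with (p ^ 2) by ring. eapply Rle_trans; [exact Hu|].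
    apply Rinv_le_contravar; [easy|]. apply Rmult_le_compat_l; lra. }
  assert (Hle : p <= t) by nra.
  rewrite Rabs_left1 by lra.
  assert (Hdiff : t * t - p * p <= 5 / 2 * / x * (t * t)).
  { assert (L : / (PI * (x + 5 / 2)) <= p * p).
    { replace (p * p) with (p ^ 2) by ring. eapply Rle_trans; [|exact Hl].
      apply Rinv_le_contravar; [nra|]. apply Rmult_le_compat_l; lra. }
    apply Rle_trans with (t * t - / (PI * (x + 5 / 2))); [lra|]. rewrite Htt.
    replace (/ (PI * x) - / (PI * (x + 5 / 2))) with
      (5 / 2 * / (x + 5 / 2) * / (PI * x)) by (field; lra).
    apply Rmult_le_compat_r; [left; now apply Rinv_0_lt_compat|].
    apply Rmult_le_compat_l; [lra|]. apply Rinv_le_contravar; lra. }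
  assert (Hsx : 0 < sqrt x) by now apply sqrt_lt_R0.
  assert (Htx : t <= / sqrt x).
  { unfold t. rewrite sqrt_inv. apply Rinv_le_contravar; [easy|].
    apply sqrt_le_1_alt. nra. }
  assert (Hix : 0 < / x) by now apply Rinv_0_lt_compat.
  apply Rle_trans with (5 / 2 * / x * t).
  - apply Rmult_le_reg_r with t; [easy|]. nra.
  - rewrite Rinv_mult, <- Rmult_assoc. apply Rmult_le_compat_l; lra.
Qed.

Lemma Csqrt_RtoC (x : R) : 0 < x -> Csqrt (RtoC x) = RtoC (sqrt x).
Proof.
  intros H. apply Csqrt_unique.
  - rewrite <- RtoC_mult, sqrt_sqrt by lra. easy.
  - simpl. now apply sqrt_lt_R0.
Qed.

(** [L] is within [PI] of its real part, and both roots have modulus at least [sqrt (fst L)]. *)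
Lemma inv_Csqrt_near (L : C) : 0 < fst L -> Rabs (snd L) <= PI ->
  Cmod (/ Csqrt L - RtoC (/ sqrt (fst L))) <= PI * / (fst L * sqrt (fst L)).
Proof.
  intros Hl Hs. set (l := fst L) in *.
  assert (Hq : 0 < sqrt l) by now apply sqrt_lt_R0.
  assert (Hqq : sqrt l * sqrt l = l) by (apply sqrt_sqrt; lra).
  assert (Hoff : off_cut (RtoC l)) by now left.
  pose proof (Csqrt_Lipschitz L (RtoC l) Hoff) as H1. rewrite Csqrt_RtoC in H1 by easy.
  change (fst (RtoC (sqrt l))) with (sqrt l) in H1.
  assert (Hd : Cmod (L - RtoC l) <= PI).
  { replace (L - RtoC l)%C with (0, snd L).
    - eapply Rle_trans; [|exact Hs]. unfold Cmod. simpl. rewrite <- sqrt_Rsqr_abs.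
      right. f_equal. unfold Rsqr. ring.
    - destruct L as [x y]. unfold l. apply injective_projections; simpl; ring. }
  assert (HL : sqrt l <= Cmod (Csqrt L)).
  { rewrite Cmod_Csqrt. apply sqrt_le_1_alt. apply fst_le_Cmod. }
  assert (Hr : Cmod (RtoC (sqrt l)) = sqrt l) by (apply Cmod_RtoC_nonneg; lra).
  rewrite RtoC_inv by lra.
  eapply Rle_trans; [apply (Cinv_Lipschitz _ _ (sqrt l)); lra|].
  rewrite <- Rinv_mult, Hqq, Rinv_mult.
  assert (Hil : 0 < / l) by now apply Rinv_0_lt_compat.
  apply Rle_trans with (/ l * (PI / sqrt l)); [|right; unfold Rdiv; ring].
  apply Rmult_le_compat_l; [lra|]. eapply Rle_trans; [exact H1|].
  apply Rmult_le_compat_r; [left; now apply Rinv_0_lt_compat|easy].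
Qed.

Lemma neg_ln_ge_1 (a : R) : 0 < a <= / 8 -> 1 <= - ln a.
Proof.
  intros [H0 H8]. assert (ln a <= -1); [|lra]. rewrite <- (ln_exp (-1)).
  apply Rcomplements.ln_le; [easy|].
  change (exp (-1)) with (exp (- (1))). rewrite exp_Ropp.
  apply Rle_trans with (1 := H8). apply Rinv_le_contravar; [apply exp_pos|].
  pose proof exp_le_3. lra.
Qed.

Lemma ln_ge_1 (q : R) : 4 <= q -> 1 <= ln q.
Proof.
  intros Hq. rewrite <- (ln_exp 1). apply Rcomplements.ln_le; [apply exp_pos|].
  pose proof exp_le_3. lra.
Qed.

Lemma log_scale (q l : R) : 4 <= q -> 0 < l ->
  exists n : nat, INR n <= l / ln q < INR n + 1 /\
    exp (- l) * q ^ n <= 1 /\ 1 < exp (- l) * q ^ S n.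
Proof.
  intros Hq Hl.
  assert (Hlq : 1 <= ln q) by now apply ln_ge_1.
  assert (Hx : 0 <= l / ln q) by (left; apply Rdiv_lt_0_compat; lra).
  destruct (nfloor_ex (l / ln q) Hx) as [n [H1 H2]]. exists n.
  assert (E : forall j, exp (- l) * q ^ j = exp (INR j * ln q - l)).
  { intros j. rewrite <- Rpower_pow by lra. unfold Rpower. rewrite <- exp_plus. f_equal. ring. }
  assert (Hxl : l / ln q * ln q = l) by (field; lra).
  split; [easy|]. rewrite !E. split.
  - rewrite <- exp_0. assert (INR n * ln q <= l) by (rewrite <- Hxl; apply Rmult_le_compat_r; lra).
    destruct (Req_dec (INR n * ln q - l) 0) as [->|Hne]; [lra|].
    left. apply exp_increasing. lra.
  - rewrite <- exp_0 at 1. apply exp_increasing. rewrite S_INR.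
    assert (l < (INR n + 1) * ln q) by (rewrite <- Hxl; apply Rmult_lt_compat_r; lra). lra.
Qed.

Lemma NB_fun_asymp (m : nat) : (1 <= m)%nat -> exists K,
  forall z, slit_disc m z -> Cmod (wz m z) <= / 8 ->
  let l := - ln (Cmod (wz m z)) in
  Cmod (sz m z * NB_fun m z -
    RtoC (8 * INR m * sqrt (ln (4 * INR m) / PI) * / sqrt l)) <= K * / (l * sqrt l).
Proof.
  intros Hm. set (q := 4 * INR m).
  assert (Hq : 4 <= q) by now apply q_ge_4.
  set (lq := ln q). assert (Hlq : 1 <= lq) by now apply ln_ge_1.
  set (W := lq * sqrt lq).
  (* [48 = 3 * 16] and [96 = 3 * 32] come from [exp_neg_bounds]; [W] is [(ln q)^(3/2)], the price of
     replacing [x = l / ln q] by [l]. *)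
  exists (q * (48 + 96 + (50 * q + 12) * W) + 5 * q * W).
  intros z HD Ha. cbv zeta. pose proof (a_pos m Hm z HD) as Ha0.
  set (a := Cmod (wz m z)) in *. set (l := - ln a).
  assert (Ea : a = exp (- l)) by (unfold l; rewrite Ropp_involutive, exp_ln; easy).
  assert (Hl : 1 <= l) by now apply neg_ln_ge_1.
  destruct (log_scale q l Hq ltac:(lra)) as [n [[Hn1 Hn2] [Hq1 Hq2]]].
  fold lq in Hn1, Hn2. rewrite <- Ea in Hq1, Hq2.
  pose proof (NB_fun_near_pcb m Hm z HD Ha n Hq1 Hq2) as Hmain. fold a q in Hmain.
  set (x := l / lq) in *. assert (Hx : 0 < x) by (apply Rdiv_lt_0_compat; lra).
  pose proof (pcb_near_sqrt x n Hx Hn1 Hn2) as Hp.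
  set (E := / (l * sqrt l)).
  assert (Hsl : 0 < sqrt l) by (apply sqrt_lt_R0; lra).
  assert (Hslq : 0 < sqrt lq) by (apply sqrt_lt_R0; lra).
  assert (Hsx : 0 < sqrt x) by now apply sqrt_lt_R0.
  assert (HE : 0 < E) by (apply Rinv_0_lt_compat; nra).
  assert (Hxx : / (x * sqrt x) = W * E).
  { unfold E, W, x. unfold Rdiv. rewrite sqrt_mult_alt, sqrt_inv by lra. field. lra. }
  destruct (exp_neg_bounds l Hl) as [B1 B2]. fold E in B1, B2. rewrite <- Ea in B2.
  assert (Hsa : sqrt a <= 16 * E).
  { rewrite Ea, exp_half_sqr, sqrt_square; [easy|]. left. apply exp_pos. }
  assert (Hna : INR n * a <= 32 * E).
  { eapply Rle_trans; [|exact B2]. apply Rmult_le_compat_r; [lra|].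
    apply Rle_trans with (1 := Hn1). unfold x.
    apply Rmult_le_reg_r with lq; [lra|]. unfold Rdiv.
    rewrite Rmult_assoc, Rinv_l by lra. nra. }
  assert (Hhh : hh n <= W * E).
  { rewrite <- Hxx. unfold hh. apply Rinv_le_contravar; [nra|].
    apply Rmult_le_compat; try lra. apply sqrt_le_1_alt. lra. }
  (* Origin of [kappa]: [sqrt (1 / (PI x))] with [x = l / ln q] produces [sqrt (ln q / PI)]. *)
  assert (Ht : 8 * INR m * sqrt (lq / PI) * / sqrt l = 2 * q * sqrt (/ (PI * x))).
  { pose proof PI_RGT_0.
    replace (/ (PI * x)) with (lq / PI * / l) by (unfold x; field; lra).
    assert (0 <= lq / PI) by (left; apply Rdiv_lt_0_compat; lra).
    rewrite sqrt_mult_alt, sqrt_inv by easy. unfold q. ring. }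
  rewrite Ht.
  replace (sz m z * NB_fun m z - RtoC (2 * q * sqrt (/ (PI * x))))%C with
    ((sz m z * NB_fun m z - RtoC (2 * q * pcb (S (S n)))) +
     RtoC (2 * q * (pcb (S (S n)) - sqrt (/ (PI * x)))))%C.
  2:{ rewrite (Rmult_minus_distr_l (2 * q)), RtoC_minus. ring. }
  eapply Rle_trans; [apply Cmod_triangle|].
  rewrite Cmod_R, Rabs_mult, (Rabs_right (2 * q)) by lra. rewrite Hxx in Hp.
  assert (A1 : 2 * q * Rabs (pcb (S (S n)) - sqrt (/ (PI * x))) <= 5 * q * W * E).
  { apply Rle_trans with (2 * q * (5 / 2 * (W * E))); [|right; field].
    apply Rmult_le_compat_l; lra. }
  assert (A2 : q * (3 * sqrt a + 3 * (INR n * a) + (50 * q + 12) * hh n) <=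
    q * (48 * E + 96 * E + (50 * q + 12) * (W * E))).
  { apply Rmult_le_compat_l; [lra|].
    assert ((50 * q + 12) * hh n <= (50 * q + 12) * (W * E))
      by (apply Rmult_le_compat_l; lra). lra. }
  lra.
Qed.

Lemma snd_Cinv_sign (w : C) : w <> 0%C -> snd w * snd (/ w)%C <= 0.
Proof.
  intros Hw. apply Cmod_gt_0 in Hw. pose proof (Cmod_sqr w) as E.
  destruct w as [x y]. simpl in *.
  assert (0 < x * x + y * y) by nra.
  replace (y * (- y / (x * (x * 1) + y * (y * 1)))) with
    (- (y * y * / (x * x + y * y))) by (field; nra).
  assert (0 < / (x * x + y * y)) by now apply Rinv_0_lt_compat. nra.
Qed.

Theorem theorem7 (m : nat) (Hm : (1 <= m)%nat) :
  let kappa := sqrt (ln (4 * INR m) / PI) in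
  let rho := / (4 * INR m) in
  let D (z : C) :=
    Cmod z < / (2 * INR m) /\
    ~ (snd z = 0 /\ / (4 * INR m) <= fst z <= / (2 * INR m)) in
  exists F : C -> C,
    (* F is holomorphic (hence analytic) on the open domain D *)
    (forall z, D z -> @ex_derive C_AbsRing C_NormedModule F z) /\
    (* F is the sum of the series N^B_m(z) on its disc of convergence |z| < 1/(4m) *)
    (forall z, Cmod z < rho ->
       @is_pseries C_AbsRing C_NormedModule
         (fun n => RtoC (INR (NB_coeff m n))) z (F z)) /\
    (* asymptotic expansion as z -> 1/(4m) inside D *)
    (exists (K delta : R), 0 < delta /\
       forall z, D z -> Cmod (z - RtoC rho) < delta ->
         let w := (1 - RtoC (4 * INR m) * z)%C in
         let L := Clog (/ w)%C in
         Cmod (F z - RtoC (8 * INR m * kappa) / Csqrt (w * L))%C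
           <= K * Cmod (/ Csqrt (w * (L * L * L)))%C).
Proof.
  intros kappa rho D. exists (NB_fun m). split; [|split].
  - intros z Hz. now apply cdiff_ex_derive, cdiff_NB_fun.
  - intros z Hz. now apply NB_fun_pseries.
  - destruct (NB_fun_asymp m Hm) as [K0 HK].
    pose proof (INR_ge_1 m Hm) as H1. pose proof PI_4 as HPI4. pose proof PI_RGT_0 as HPI.
    set (c := 8 * INR m * kappa).
    (* The radius gives [|w| = 4m |z - rho| <= 1/8], the range of [NB_fun_asymp]. The factor 12
       covers [|L|^3 <= 125 l^3 <= 144 l^3]. *)
    exists (12 * (Rabs K0 + Rabs c * PI)), (/ (32 * INR m)).
    split; [apply Rinv_0_lt_compat; lra|]. intros z Hz Hd w L.
    change (slit_disc m z) in Hz.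
    change w with (wz m z) in *. clear w.
    assert (Ha : Cmod (wz m z) <= / 8).
    { assert (E : wz m z = (- (RtoC (4 * INR m) * (z - RtoC rho)))%C).
      { unfold wz. transitivity (RtoC (4 * INR m * rho) - RtoC (4 * INR m) * z)%C.
        - unfold rho. rewrite Rinv_r by lra. easy.
        - rewrite RtoC_mult. ring. }
      rewrite E, Cmod_opp, Cmod_mult, Cmod_RtoC_nonneg by lra.
      apply Rle_trans with (4 * INR m * / (32 * INR m)).
      - apply Rmult_le_compat_l; lra.
      - right. field. lra. }
    pose proof (a_pos m Hm z Hz) as Ha0. pose proof (HK z Hz Ha) as HG. cbv zeta in HG.
    fold kappa c in HG. set (a := Cmod (wz m z)) in *. set (l := - ln a) in *.
    assert (Hw0 : wz m z <> 0%C) by now apply Cmod_gt_0.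
    assert (Hl : 1 <= l) by now apply neg_ln_ge_1.
    assert (HL1 : fst L = l).
    { unfold L, Clog. simpl. rewrite Cmod_inv by easy. fold a. now rewrite ln_Rinv. }
    assert (HL2 : Rabs (snd L) <= PI).
    { unfold L, Clog. simpl. pose proof (Carg_bound (/ wz m z)%C).
      apply Rabs_le. lra. }
    assert (HLc : off_cut L) by (left; lra).
    (* [Im L] is the argument of [1/w], whose imaginary part has the sign opposite to that of [w].
       This is what splits [Csqrt (w * L)] into a product. *)
    assert (HwL : snd (wz m z) * snd L <= 0).
    { pose proof (snd_Cinv_sign (wz m z) Hw0) as S1.
      pose proof (Carg_sign (/ wz m z)%C) as S2.
      change (snd L) with (Carg (/ wz m z)%C).
      destruct (Carg_polar (/ wz m z)%C) as [_ S3].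
      destruct (Req_dec (snd (/ wz m z)%C) 0) as [S4|S4].
      - assert (snd (wz m z) = 0); [|nra].
        replace (wz m z) with (/ / wz m z)%C by (field; easy).
        unfold Cinv at 1. cbn [snd]. rewrite S4. unfold Rdiv. ring.
      - set (u := snd (wz m z)) in *. set (v := snd (/ wz m z)%C) in *.
        set (t := Carg (/ wz m z)%C) in *.
        assert (u * t * (v * v) <= 0) by nra.
        assert (0 < v * v) by nra. nra. }
    pose proof (off_cut_wz m z Hm Hz) as Hoff.
    rewrite (Csqrt_mult_opposite _ _ Hoff HLc HwL). fold (sz m z).
    pose proof (sz_neq_0 m z Hm Hz) as Hs0.
    assert (HsL0 : Csqrt L <> 0%C).
    { intros E. pose proof (Csqrt_fst_pos L HLc) as P. rewrite E in P. simpl in P. lra. }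
    set (E := / (l * sqrt l)).
    assert (Hsl : 0 < sqrt l) by (apply sqrt_lt_R0; lra).
    assert (HE : 0 < E) by (apply Rinv_0_lt_compat; nra).
    assert (HLi : Cmod (/ Csqrt L - RtoC (/ sqrt l)) <= PI * E).
    { pose proof (inv_Csqrt_near L ltac:(lra) HL2) as H. rewrite HL1 in H. exact H. }
    (* With [1/s] factored out, the error is that of [NB_fun_asymp] plus the cost of replacing
       [sqrt l] by the complex [Csqrt L]. *)
    replace (NB_fun m z - RtoC c / (sz m z * Csqrt L))%C with
      (/ sz m z * ((sz m z * NB_fun m z - RtoC (c * / sqrt l)) -
        RtoC c * (/ Csqrt L - RtoC (/ sqrt l))))%C.
    2:{ rewrite (RtoC_mult c). field. auto. }
    rewrite Cmod_mult, Cmod_inv by easy.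
    assert (Hsz : Cmod (sz m z) = sqrt a) by apply Cmod_Csqrt. rewrite Hsz.
    assert (Hsa : 0 < sqrt a) by now apply sqrt_lt_R0.
    apply Rle_trans with (/ sqrt a * ((Rabs K0 + Rabs c * PI) * E)).
    { apply Rmult_le_compat_l; [left; now apply Rinv_0_lt_compat|].
      eapply Rle_trans; [apply Cmod_triangle|]. rewrite Cmod_opp, Cmod_mult, Cmod_R.
      rewrite Rmult_plus_distr_r. apply Rplus_le_compat.
      - eapply Rle_trans; [exact HG|]. fold E.
        apply Rmult_le_compat_r; [lra|apply Rle_abs].
      - rewrite Rmult_assoc. apply Rmult_le_compat_l; [apply Rabs_pos|easy]. }
    (* [|Im L| <= PI <= 4 <= 4 l]. *)
    assert (HLm : l <= Cmod L <= 5 * l).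
    { split; [rewrite <- HL1; apply fst_le_Cmod|].
      assert (T : Cmod L <= Cmod (RtoC l) + Cmod (L - RtoC l)).
      { replace L with (RtoC l + (L - RtoC l))%C at 1 by ring. apply Cmod_triangle. }
      rewrite Cmod_RtoC_nonneg in T by lra.
      replace (L - RtoC l)%C with (0, snd L) in T.
      - assert (T2 : Cmod (0, snd L) = Rabs (snd L)).
        { unfold Cmod. simpl. rewrite <- sqrt_Rsqr_abs. f_equal. unfold Rsqr. ring. }
        rewrite T2 in T. lra.
      - rewrite <- HL1. destruct L as [x y]. apply injective_projections; simpl; ring. }
    assert (Hden : 0 < Cmod (wz m z * (L * L * L))).
    { rewrite !Cmod_mult. fold a.
      apply Rmult_lt_0_compat; [easy|]. repeat apply Rmult_lt_0_compat; lra. }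
    assert (Hd0 : Csqrt (wz m z * (L * L * L)) <> 0%C).
    { apply Cmod_gt_0. rewrite Cmod_Csqrt. now apply sqrt_lt_R0. }
    rewrite Cmod_inv by easy. rewrite Cmod_Csqrt.
    assert (Hbound : sqrt (Cmod (wz m z * (L * L * L))) <= 12 * (sqrt a * (l * sqrt l))).
    { rewrite !Cmod_mult. fold a.
      apply Rle_trans with (sqrt (a * (144 * (l * l * l)))).
      - apply sqrt_le_1_alt. apply Rmult_le_compat_l; [lra|].
        assert (Cmod L * Cmod L <= 25 * (l * l)) by nra.
        assert (Cmod L * Cmod L * Cmod L <= 25 * (l * l) * (5 * l))
          by (apply Rmult_le_compat; nra).
        assert (0 < l * l * l) by (repeat apply Rmult_lt_0_compat; lra). lra.
      - rewrite sqrt_mult_alt by lra.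
        replace (144 * (l * l * l)) with ((12 * l) * (12 * l) * l) by ring.
        rewrite sqrt_mult_alt by nra. rewrite sqrt_square by lra. right. ring. }
    pose proof (Rabs_pos K0). pose proof (Rabs_pos c).
    assert (HC : 0 <= Rabs K0 + Rabs c * PI) by nra.
    apply Rle_trans with (12 * (Rabs K0 + Rabs c * PI) * / (12 * (sqrt a * (l * sqrt l)))).
    + right. unfold E. field. lra.
    + apply Rmult_le_compat_l; [lra|]. apply Rinv_le_contravar; [|easy].
      now apply sqrt_lt_R0.
Qed.
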